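(* Let $H$ be an arbitrary (finite or infinite dimensional) pointed Hopf algebra of rank one over a field $k$, and let $G=G(H)$ be its group of group-like elements. Then $H$ is isomorphic to a quotient of a Hopf-Ore extension of its coradical $H_0=kG$. Precisely, there exist a character $\chi\in\widehat{G}$, an element $a\in Z(G)$ and a $1$-cocycle $\alpha\in Z^1_{\chi}(G)$ such that $H\cong kG(\chi,a,\delta)/I$ as Hopf algebras, where $\delta$ is defined by $\delta(g)=g(1-a)\alpha(g)$, $g\in G$, and $I$ is a Hopf ideal of $kG(\chi,a,\delta)$ described as follows. (a) In the case $\mathrm{char}(k)=0$: (i) if $\chi(a)$ is a primitive $n$-th root of unity for some $n\geq 2$, then $I=\langle x^n-\beta(1-a^n)\rangle$ for some $\beta\in k$; (ii) if $\chi(a)$ is not a primitive $n$-th root of unity for any $n\geq 2$, then $I=0$. (b) In the case $\mathrm{char}(k)=p>0$: (i) if $\chi(a)$ is a primitive $n$-th root of unity for some $n\geq 2$, then $I=\langle x^n-\beta(1-a^n)\rangle$ for some $\beta\in k$; (ii) if $\chi(a)=1$ and $a^{-1}xa=x$, then $I=\langle x^p-\beta x-\gamma(1-a^p)\rangle$ for some $\beta,\gamma\in k$; moreover, $a^p=a$ if $\beta\neq 0$; (iii) if $\chi(a)=1$ and $a^{-1}xa=x+\alpha(a)(1-a)$ with $\alpha(a)\neq 0$, then after a suitable substitution of $x$ (replacing $x$ by $\alpha(a)^{-1}x$, i.e. choosing $\alpha$ with $\alpha(a)=1$), $I=\langle x^p-x-\gamma(1-a^p)\rangle$ for some $\gamma\in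 k$; (iv) if $\chi(a)$ is not a primitive $n$-th root of unity for any $n\geq 1$, then $I=0$.
   Context: $k$ is an arbitrary field. For a group $G$, $\widehat{G}$ is the group of characters $G\to k^{\times}$, $Z(G)$ is the center, and for $\chi\in\widehat{G}$, $Z^1_{\chi}(G)$ is the set of linear maps $\alpha:kG\to k$ with $\alpha(gh)=\alpha(g)+\chi(g)\alpha(h)$ for all $g,h\in G$. For $\chi\in\widehat{G}$, $a\in Z(G)$, $\alpha\in Z^1_{\chi}(G)$ and $\delta(g)=g(1-a)\alpha(g)$, the Hopf-Ore extension $kG(\chi,a,\delta)$ is the Hopf algebra generated as an algebra by $kG$ and a variable $x$ with relations $xg=\chi(g)gx+\delta(g)$, i.e. $g^{-1}xg=\chi(g)x+\alpha(g)(1-a)$ ($g\in G$); it has $k$-basis $\{gx^i\mid g\in G,\ i\geq0\}$, contains $kG$ as a Hopf subalgebra, and $\Delta(x)=x\otimes a+1\otimes x$, $\varepsilon(x)=0$, $S(x)=-xa^{-1}$. $\langle y\rangle$ denotes the two-sided ideal generated by $y$. Rank: let $H$ be a Hopf algebra with coradical filtration $H_0\subseteq H_1\subseteq\cdots$ such that $H_0$ is a Hopf subalgebra. If $H$ is generated by $H_1$ as an algebra and $\dim_k(k\otimes_{H_0}H_1)=n+1$ (with $k$ the trivial $H_0$-module via the counit and $H_1$ a left $H_0$-module by multiplication), then $H$ has rank $n$. If $H$ is pointed then $H_0=kG(H)$. *)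

(* Defs.v *)
From HB Require Import structures.
From mathcomp Require Import all_boot all_algebra.
From mathcomp Require Import finmap.
From mathcomp Require Import boolp.
From mathcomp Require Import monalg.

Set Implicit Arguments.
Unset Strict Implicit.
Unset Printing Implicit Defensive.

Import GRing.Theory.

Local Open Scope ring_scope.
Local Open Scope quotient_scope.

Section Span.
Variables (k : fieldType) (V : lmodType k).

Definition span (P : V -> Prop) : {pred V} :=
  fun v => `[< forall S : submodClosed V, (forall w, P w -> w \in S) -> v \in S >].

Lemma spanP P v : reflect
  (forall S : submodClosed V, (forall w, P w -> w \in S) -> v \in S)
  (v \in span P).
Proof. exact: asboolP. Qed.

Lemma span_subsemimod P : GRing.subsemimod_closed (span P).
Proof.
split; first split.
- by apply/spanP => S _; exact: rpred0.
- move=> u v /spanP Su /spanP Sv; apply/spanP => S PS.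
  by apply: rpredD; [exact: Su | exact: Sv].
- move=> c v /spanP Sv; apply/spanP => S PS; apply: rpredZ; exact: Sv.
Qed.
HB.instance Definition _ P :=
  GRing.isSubmodClosed.Build k V (span P) (span_subsemimod P).

Lemma mem_span (P : V -> Prop) v : P v -> v \in span P.
Proof. by move=> Pv; apply/spanP => S; exact. Qed.

Lemma span_min (P : V -> Prop) (S : submodClosed V) v :
  (forall w, P w -> w \in S) -> v \in span P -> v \in S.
Proof. by move=> PS /spanP; apply. Qed.

End Span.

Section SubModule.
Variables (k : fieldType) (V : lmodType k) (S : submodClosed V).

Definition submod : Type := {v : V | v \in S}.
HB.instance Definition _ := [isSub of submod for @sval V _].
HB.instance Definition _ := [Choice of submod by <:].
Fact submod_subproof : GRing.subsemimod_closed S.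
Proof.
split; first by split; [exact: rpred0 | exact: rpredD].
exact: rpredZ.
Qed.
HB.instance Definition _ :=
  GRing.SubChoice_isSubLmodule.Build k V _ submod submod_subproof.

End SubModule.

Section QuotientType.
Variables (k : fieldType) (V : lmodType k) (S : submodClosed V).

Definition zmod_pred : {pred V} := fun v => v \in S.
Fact zmod_pred_closed : zmod_closed zmod_pred.
Proof.
split=> [|u v]; first exact: (rpred0 S).
move=> Su Sv; rewrite -scaleN1r; apply: (@rpredD _ S) => //.
exact: (@rpredZ _ _ S).
Qed.
HB.instance Definition _ := GRing.isZmodClosed.Build V zmod_pred zmod_pred_closed.

Definition quotmod : Type := {ideal_quot zmod_pred}.
HB.instance Definition _ := Choice.on quotmod.

End QuotientType.

(* The operations are locked so that unification does not unfold them. *)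
HB.lock Definition qproj (k : fieldType) (V : lmodType k) (S : submodClosed V)
  (v : V) : quotmod S := \pi_{ideal_quot (zmod_pred S)} v.
HB.lock Definition qrepr (k : fieldType) (V : lmodType k) (S : submodClosed V)
  (q : quotmod S) : V := repr (q : {ideal_quot (zmod_pred S)}).
HB.lock Definition qadd (k : fieldType) (V : lmodType k) (S : submodClosed V)
  (p q : quotmod S) : quotmod S := qproj S (qrepr p + qrepr q).
HB.lock Definition qopp (k : fieldType) (V : lmodType k) (S : submodClosed V)
  (q : quotmod S) : quotmod S := qproj S (- qrepr q).
HB.lock Definition qscale (k : fieldType) (V : lmodType k) (S : submodClosed V)
  (c : k) (q : quotmod S) : quotmod S := qproj S (c *: qrepr q).

Section QuotientModule.
Variables (k : fieldType) (V : lmodType k) (S : submodClosed V).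
Implicit Types (u v : V) (p q : quotmod S).
Local Notation pi := (qproj S).

Lemma qreprK : cancel (@qrepr k V S) pi.
Proof. rewrite qproj.unlock qrepr.unlock; exact: reprK. Qed.

Lemma qprojP u v : reflect (pi u = pi v) (u - v \in S).
Proof.
have -> : (u - v \in S) = (pi u == pi v); last exact: eqP.
by rewrite qproj.unlock -Quotient.idealrBE.
Qed.

Lemma qprojK v : qrepr (pi v) - v \in S.
Proof. by apply/qprojP; rewrite qreprK. Qed.

Lemma qind (P : quotmod S -> Prop) : (forall v, P (pi v)) -> forall q, P q.
Proof. by move=> Pq q; rewrite -(qreprK q). Qed.

Lemma qaddE u v : qadd (pi u) (pi v) = pi (u + v).
Proof.
rewrite qadd.unlock; apply/qprojP; rewrite opprD addrACA.
by apply: rpredD; exact: qprojK.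
Qed.
Lemma qscaleE c v : qscale c (pi v) = pi (c *: v).
Proof. by rewrite qscale.unlock; apply/qprojP; rewrite -scalerBr; exact/rpredZ/qprojK. Qed.
Lemma qoppE v : qopp (pi v) = pi (- v).
Proof.
rewrite qopp.unlock; apply/qprojP.
by have := @rpredZ k V S (-1) _ (qprojK v); rewrite scaleN1r opprD.
Qed.

Fact qaddA : associative (@qadd k V S).
Proof. by elim/qind=> u; elim/qind=> v; elim/qind=> w; rewrite !qaddE addrA. Qed.
Fact qaddC : commutative (@qadd k V S).
Proof. by elim/qind=> u; elim/qind=> v; rewrite !qaddE addrC. Qed.
Fact qadd0 : left_id (pi 0) (@qadd k V S).
Proof. by elim/qind=> u; rewrite qaddE add0r. Qed.
Fact qaddN : left_inverse (pi 0) (@qopp k V S) (@qadd k V S).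
Proof. by elim/qind=> u; rewrite qoppE qaddE addNr. Qed.
HB.instance Definition _ :=
  GRing.isZmodule.Build (quotmod S) qaddA qaddC qadd0 qaddN.

Fact qscaleA a b q : qscale a (qscale b q) = qscale (a * b) q.
Proof. by elim/qind: q => v; rewrite !qscaleE scalerA. Qed.
Fact qscale1 : left_id 1 (@qscale k V S).
Proof. by elim/qind => v; rewrite qscaleE scale1r. Qed.
Fact qscaleDr : right_distributive (@qscale k V S) +%R.
Proof.
move=> c; elim/qind => u; elim/qind => v.
by rewrite [_ + _]qaddE !qscaleE [RHS]qaddE scalerDr.
Qed.
Fact qscaleDl q : {morph (@qscale k V S)^~ q : a b / a + b}.
Proof.
by move=> a b; elim/qind: q => v; rewrite !qscaleE [RHS]qaddE scalerDl.
Qed.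
HB.instance Definition _ :=
  GRing.Zmodule_isLmodule.Build k (quotmod S) qscaleA qscale1 qscaleDr qscaleDl.

Fact qproj_linear : linear pi.
Proof. by move=> c u v; rewrite [_ *: pi u]qscaleE [RHS]qaddE. Qed.
HB.instance Definition _ := GRing.isLinear.Build k V (quotmod S) _ pi qproj_linear.

End QuotientModule.

Section Basis.
Variables (k : fieldType) (V : lmodType k) (I : choiceType).

(* {malg k[I]}, the finitely supported functions I -> k, is the free k-module
   on I; << i >> is the basis vector at i. *)
Definition lincomb (b : I -> V) (c : {malg k[I]}) : V :=
  \sum_(i <- msupp c) c@_i *: b i.

Definition is_basis (b : I -> V) := bijective (lincomb b).

Lemma lincombEw b (c : {malg k[I]}) (d : {fset I}) :
  (msupp c `<=` d)%fset -> lincomb b c = \sum_(i <- d) c@_i *: b i.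
Proof.
move=> le; rewrite /lincomb; apply/esym.
rewrite (bigID (fun i => i \in msupp c)) /= [X in _ + X]big1 ?addr0; last first.
  by move=> i /mcoeff_outdom ->; rewrite scale0r.
rewrite -big_filter; apply: perm_big; apply: uniq_perm.
- by rewrite filter_uniq // fset_uniq.
- exact: fset_uniq.
move=> i; rewrite mem_filter; case: (boolP (i \in msupp c)) => //= ic.
by move/fsubsetP: le => /(_ i ic).
Qed.

Lemma lincomb_is_linear b : linear (lincomb b).
Proof.
move=> a c d; pose s := (msupp c `|` msupp d)%fset.
have lc : (msupp c `<=` s)%fset by exact: fsubsetUl.
have ld : (msupp d `<=` s)%fset by exact: fsubsetUr.
have lz : (msupp (a *: c + d) `<=` s)%fset.
  apply: (fsubset_trans (msuppD_le _ _)).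
  by rewrite fsubUset ld andbT (fsubset_trans (msuppZ_le _ _)).
rewrite !(lincombEw b (d := s)) // scaler_sumr -big_split /=.
by apply: eq_bigr => i _; rewrite mcoeffD mcoeffZ scalerDl scalerA.
Qed.
HB.instance Definition _ b :=
  GRing.isLinear.Build k {malg k[I]} V _ (lincomb b) (lincomb_is_linear b).

Lemma lincombU b i : lincomb b << i >> = b i.
Proof.
by rewrite /lincomb msuppU oner_eq0 big_seq_fset1 mcoeffUU scale1r.
Qed.

Lemma malg_lincomb (c : {malg k[I]}) : c = \sum_(i <- msupp c) c@_i *: << i >>.
Proof.
rewrite {1}[c]monalgE; apply: eq_bigr => i _.
apply/malgP => j; rewrite mcoeffZ !mcoeffU.
by rewrite mulrnAr mulr1.
Qed.

End Basis.

Definition has_dim (k : fieldType) (V : lmodType k) (n : nat) :=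
  exists b : 'I_n -> V, is_basis b.

Section TensorType.
Variables (k : fieldType) (U V : lmodType k).

Definition tensor_rel (t : {malg k[(U * V)%type]}) : Prop :=
  (exists c u1 u2 v, t = << (c *: u1 + u2, v) >> - (c *: << (u1, v) >> + << (u2, v) >>)) \/
  (exists c u v1 v2, t = << (u, c *: v1 + v2) >> - (c *: << (u, v1) >> + << (u, v2) >>)).

Definition tensor : Type := quotmod (span tensor_rel).
HB.instance Definition _ := GRing.Lmodule.on tensor.

End TensorType.

HB.lock Definition tens (k : fieldType) (U V : lmodType k) (u : U) (v : V) : tensor U V :=
  qproj (span (@tensor_rel k U V)) << (u, v) >>.

Notation "u \ox v" := (tens u v) (at level 40, left associativity) : ring_scope.

(* The linear map U (x) V -> W induced by f; meaningful only for bilinear f, in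
   which case it does not depend on the choice of representatives (tliftE). *)
HB.lock Definition tlift (k : fieldType) (U V W : lmodType k) (f : U -> V -> W)
  (t : tensor U V) : W := lincomb (fun p => f p.1 p.2) (qrepr t).

Section Tensor.
Variables (k : fieldType) (U V : lmodType k).

Let F : lmodType k := {malg k[(U * V)%type]}.
Let rel := span (@tensor_rel k U V).

Lemma tens_bilinear : bilinear_for *:%R *:%R (@tens k U V).
Proof.
split=> [v|u] c w1 w2; rewrite tens.unlock -linearP; apply/qprojP/mem_span.
- by left; exists c, w1, w2, v.
- by right; exists c, u, w1, w2.
Qed.

Lemma tlift_qproj (W : lmodType k) (f : U -> V -> W) : bilinear_for *:%R *:%R f ->
  forall t : F, tlift f (qproj rel t) = lincomb (fun p => f p.1 p.2) t.
Proof.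
move=> [fl fr] t; rewrite tlift.unlock; set g := lincomb _.
pose K : {pred F} := fun t => g t == 0.
have KC : GRing.subsemimod_closed K.
  split; first split.
  - by rewrite unfold_in /K /g linear0.
  - move=> x y /eqP gx /eqP gy; apply/eqP.
    by rewrite /g linearD /= -/g gx gy addr0.
  - by move=> c x /eqP gx; apply/eqP; rewrite /g linearZ /= -/g gx scaler0.
pose M := GRing.isSubmodClosed.Build k F K KC.
pose KS : submodClosed F := HB.pack K M.
apply/eqP; rewrite -subr_eq0 /g -linearB.
have := qprojK rel t.
apply: (@span_min _ _ _ KS) => w [[c [u1 [u2 [v ->]]]]|[c [u [v1 [v2 ->]]]]];
  rewrite unfold_in /K /g linearB linearP /= !lincombU /=.
- by rewrite fl subrr.
- by rewrite fr subrr.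
Qed.

Lemma tliftE (W : lmodType k) (f : U -> V -> W) : bilinear_for *:%R *:%R f ->
  forall u v, tlift f (u \ox v) = f u v.
Proof. by move=> bf u v; rewrite tens.unlock tlift_qproj // lincombU. Qed.

Lemma tlift_linear (W : lmodType k) (f : U -> V -> W) :
  bilinear_for *:%R *:%R f -> linear (tlift f).
Proof.
by move=> bf c; elim/qind => s; elim/qind => t; rewrite -linearP !tlift_qproj // linearP.
Qed.

Lemma tliftP (W : lmodType k) (f : U -> V -> W) : bilinear_for *:%R *:%R f ->
  forall c s t, tlift f (c *: s + t) = c *: tlift f s + tlift f t.
Proof. exact: tlift_linear. Qed.

Lemma linear_swap (W : lmodType k) (a b : k) (t u v w : W) :
  a *: (b *: t + u) + (b *: v + w) = b *: (a *: t + v) + (a *: u + w).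
Proof. by rewrite !scalerDr !scalerA [a * b]mulrC addrACA. Qed.

Lemma tensor_ind (P : tensor U V -> Prop) :
  (forall u v, P (u \ox v)) -> (forall c s t, P s -> P t -> P (c *: s + t)) ->
  forall t, P t.
Proof.
rewrite tens.unlock => Pt PZ; elim/qind => t; rewrite [t]malg_lincomb.
elim: (enum_fset (msupp t)) => [|i s IH].
  have := PZ (-1) _ _ (Pt 0 0) (Pt 0 0).
  by rewrite big_nil linear0 scaleN1r addNr.
rewrite big_cons linearP; apply: PZ => //.
by case: i.
Qed.

End Tensor.

Section TensorMaps.
Variable k : fieldType.
Implicit Types U V W : lmodType k.

Lemma tensorDl U V (u1 u2 : U) (v : V) : (u1 + u2) \ox v = u1 \ox v + u2 \ox v.
Proof. by have := (tens_bilinear U V).1 v 1 u1 u2; rewrite /= !scale1r. Qed.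
Lemma tensorDr U V (u : U) (v1 v2 : V) : u \ox (v1 + v2) = u \ox v1 + u \ox v2.
Proof. by have := (tens_bilinear U V).2 u 1 v1 v2; rewrite /= !scale1r. Qed.
Lemma tensor0l U V (v : V) : (0 : U) \ox v = 0.
Proof. by apply: (@addrI _ (0 \ox v)); rewrite -tensorDl !addr0. Qed.
Lemma tensor0r U V (u : U) : u \ox (0 : V) = 0.
Proof. by apply: (@addrI _ (u \ox 0)); rewrite -tensorDr !addr0. Qed.
Lemma tensorZl U V c (u : U) (v : V) : (c *: u) \ox v = c *: (u \ox v).
Proof. by have := (tens_bilinear U V).1 v c u 0; rewrite /= !addr0 tensor0l addr0. Qed.
Lemma tensorZr U V c (u : U) (v : V) : u \ox (c *: v) = c *: (u \ox v).
Proof. by have := (tens_bilinear U V).2 u c v 0; rewrite /= !addr0 tensor0r addr0. Qed.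

Definition tmap U U' V V' (f : {linear U -> U'}) (g : {linear V -> V'}) :
  tensor U V -> tensor U' V' := tlift (fun u v => f u \ox g v).

Lemma tmap_bilinear U U' V V' (f : {linear U -> U'}) (g : {linear V -> V'}) :
  bilinear_for *:%R *:%R (fun u v => f u \ox g v).
Proof.
by split=> [v|u] c x y; rewrite linearP ?tensorDl ?tensorDr ?tensorZl ?tensorZr.
Qed.
Lemma tmap_linear U U' V V' (f : {linear U -> U'}) (g : {linear V -> V'}) :
  linear (tmap f g).
Proof. exact/tlift_linear/tmap_bilinear. Qed.
HB.instance Definition _ U U' V V' (f : {linear U -> U'}) (g : {linear V -> V'}) :=
  GRing.isLinear.Build k (tensor U V) (tensor U' V') _ (tmap f g) (tmap_linear f g).
Lemma tmapP U U' V V' (f : {linear U -> U'}) (g : {linear V -> V'}) c s t :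
  tmap f g (c *: s + t) = c *: tmap f g s + tmap f g t.
Proof. exact: (tliftP (tmap_bilinear f g)). Qed.
Lemma tmapE U U' V V' (f : {linear U -> U'}) (g : {linear V -> V'}) u v :
  tmap f g (u \ox v) = f u \ox g v.
Proof. exact/tliftE/tmap_bilinear. Qed.

Definition tassoc U V W : tensor (tensor U V) W -> tensor U (tensor V W) :=
  tlift (fun t w => tlift (fun u v => u \ox (v \ox w)) t).

Lemma tassoc_bilinear1 U V W (w : W) :
  bilinear_for *:%R *:%R (fun (u : U) (v : V) => u \ox (v \ox w)).
Proof.
by split=> [v|u] c x y; rewrite ?tensorDl ?tensorZl // tensorDr tensorZr.
Qed.
Lemma tassoc_bilinear U V W : bilinear_for *:%R *:%R
  (fun (t : tensor U V) (w : W) => tlift (fun u v => u \ox (v \ox w)) t).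
Proof.
split=> [w|t] c x y; first exact/tlift_linear/tassoc_bilinear1.
have E w u v := tliftE (@tassoc_bilinear1 U V W w) u v.
have L w := tliftP (@tassoc_bilinear1 U V W w).
elim/tensor_ind: t => [u v|d s t IHs IHt].
  by rewrite /= !E !tensorDr !tensorZr.
rewrite /= 3!L IHs IHt.
exact: linear_swap.
Qed.
Lemma tassoc_linear U V W : linear (@tassoc U V W).
Proof. exact/tlift_linear/tassoc_bilinear. Qed.
HB.instance Definition _ U V W := GRing.isLinear.Build k
  (tensor (tensor U V) W) (tensor U (tensor V W)) _ (@tassoc U V W) (@tassoc_linear U V W).
Lemma tassocP U V W c (s t : tensor (tensor U V) W) :
  tassoc (c *: s + t) = c *: tassoc s + tassoc t.
Proof. exact: (tliftP (tassoc_bilinear U V W)). Qed.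
Lemma tassocE U V W (u : U) (v : V) (w : W) :
  tassoc ((u \ox v) \ox w) = u \ox (v \ox w).
Proof.
by rewrite /tassoc (tliftE (tassoc_bilinear _ _ _)) (tliftE (tassoc_bilinear1 _ _ _)).
Qed.

End TensorMaps.

Section TensorAlgebra.
Variables (k : fieldType) (A B : algType k).

Definition tmul (s t : tensor A B) : tensor A B :=
  tlift (fun a b => tlift (fun c d => (a * c) \ox (b * d)) t) s.

Lemma tmul_bilinear1 a b :
  bilinear_for *:%R *:%R (fun (c : A) (d : B) => (a * c) \ox (b * d)).
Proof.
split=> [d|c] z x y; rewrite mulrDr -scalerAr ?tensorDl ?tensorZl //.
by rewrite tensorDr tensorZr.
Qed.
Lemma tmul_bilinear2 (t : tensor A B) : bilinear_for *:%R *:%R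
  (fun a b => tlift (fun c d => (a * c) \ox (b * d)) t).
Proof.
split=> [b|a] z x y; elim/tensor_ind: t => [c d|e s t IHs IHt].
- by rewrite !(tliftE (tmul_bilinear1 _ _)) mulrDl -scalerAl tensorDl tensorZl.
- rewrite 3!(tliftP (tmul_bilinear1 _ _)) IHs IHt.
  exact: linear_swap.
- by rewrite !(tliftE (tmul_bilinear1 _ _)) mulrDl -scalerAl tensorDr tensorZr.
- rewrite 3!(tliftP (tmul_bilinear1 _ _)) IHs IHt.
  exact: linear_swap.
Qed.
Lemma tmulE a b c d : tmul (a \ox b) (c \ox d) = (a * c) \ox (b * d).
Proof.
by rewrite /tmul (tliftE (tmul_bilinear2 _)) (tliftE (tmul_bilinear1 _ _)).
Qed.
Lemma tmulPl c s1 s2 t : tmul (c *: s1 + s2) t = c *: tmul s1 t + tmul s2 t.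
Proof. by rewrite /tmul (tliftP (tmul_bilinear2 t)). Qed.
Lemma tmulPr s c t1 t2 : tmul s (c *: t1 + t2) = c *: tmul s t1 + tmul s t2.
Proof.
elim/tensor_ind: s => [a b|e s t IHs IHt].
  rewrite /tmul (tliftE (tmul_bilinear2 t1)) (tliftE (tmul_bilinear2 t2)).
  by rewrite (tliftE (tmul_bilinear2 _)) (tliftP (tmul_bilinear1 a b)).
rewrite 3!tmulPl IHs IHt.
exact: linear_swap.
Qed.
Lemma tmulA : associative tmul.
Proof.
move=> r s t; elim/tensor_ind: r => [a b|e r1 r2 IH1 IH2]; last first.
  by rewrite 3!tmulPl IH1 IH2.
elim/tensor_ind: s => [c d|e s1 s2 IH1 IH2]; last first.
  by rewrite tmulPl 2!tmulPr tmulPl IH1 IH2.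
elim/tensor_ind: t => [f g|e s1 s2 IH1 IH2]; last first.
  by rewrite 3!tmulPr IH1 IH2.
by rewrite !tmulE !mulrA.
Qed.
Lemma tmul1 t : tmul t (1 \ox 1) = t.
Proof.
elim/tensor_ind: t => [a b|e s1 s2 IH1 IH2]; first by rewrite tmulE !mulr1.
by rewrite tmulPl IH1 IH2.
Qed.
Lemma tmul1l t : tmul (1 \ox 1) t = t.
Proof.
elim/tensor_ind: t => [a b|e s1 s2 IH1 IH2]; first by rewrite tmulE !mul1r.
by rewrite tmulPr IH1 IH2.
Qed.

End TensorAlgebra.

HB.mixin Record isCoalgebra (k : fieldType) C of GRing.Lmodule k C := {
  comul : {linear C -> tensor C C};
  counit : {scalar C};
  comulA : forall c : C,
    tassoc (tmap comul idfun (comul c)) = tmap idfun comul (comul c);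
  comul1l : forall c : C, tlift (fun x y => counit x *: y) (comul c) = c;
  comul1r : forall c : C, tlift (fun x y => counit y *: x) (comul c) = c
}.

#[short(type="coalgType")]
HB.structure Definition Coalgebra (k : fieldType) :=
  {C of isCoalgebra k C & GRing.Lmodule k C}.

HB.mixin Record isHopfAlgebra (k : fieldType) H of GRing.Algebra k H & Coalgebra k H := {
  antipode : {linear H -> H};
  comul_one : comul (1 : H) = 1 \ox 1;
  comulM : forall g h : H, comul (g * h) = tmul (comul g) (comul h);
  counit_one : counit (1 : H) = 1;
  counitM : forall g h : H, counit (g * h) = counit g * counit h;
  antipodeV : forall h : H, tlift (fun x y => antipode x * y) (comul h) = counit h *: 1;
  antipodeVr : forall h : H, tlift (fun x y => x * antipode y) (comul h) = counit h *: 1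
}.

#[short(type="hopfAlgType")]
HB.structure Definition HopfAlgebra (k : fieldType) :=
  {H of isHopfAlgebra k H & GRing.Algebra k H & Coalgebra k H}.

Section Coradical.
Variables (k : fieldType).

(* The span of the tensors u (x) v with P u v; for P u v := u \in D /\ v \in E
   this is D (x) E, for P u v := u \in D \/ v \in E it is D (x) V + U (x) E. *)
Definition tspan (U V : lmodType k) (P : U -> V -> Prop) : {pred tensor U V} :=
  span (fun t => exists u v, P u v /\ t = u \ox v).

Variable C : coalgType k.

Definition subcoalgebra (D : {pred C}) :=
  forall c, c \in D -> comul c \in tspan (fun u v => u \in D /\ v \in D).

Definition simple_subcoalgebra (D : submodClosed C) :=
  [/\ subcoalgebra D, exists2 d, d \in D & d != 0 &
      forall E : submodClosed C, subcoalgebra E -> {subset E <= D} ->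
        (exists2 e, e \in E & e != 0) -> {subset D <= E}].

Definition coradical : {pred C} :=
  span (fun c => exists2 D : submodClosed C, simple_subcoalgebra D & c \in D).

(* The coradical filtration: C_(n+1) is the preimage under comul of
   C_0 (x) C + C (x) C_n. *)
Fixpoint corad_filt (n : nat) : {pred C} :=
  if n is m.+1 then
    fun c => comul c \in tspan (fun u v => u \in coradical \/ v \in corad_filt m)
  else coradical.

Lemma corad_filt_closed n : GRing.subsemimod_closed (corad_filt n).
Proof.
case: n => [|n]; first exact: span_subsemimod.
rewrite /=; set S := tspan _.
have [[S0 SD] SZ] : GRing.subsemimod_closed S by exact: span_subsemimod.
split; first split; rewrite ?unfold_in.
- by rewrite linear0.
- by move=> u v Su Sv; rewrite unfold_in linearD; apply: SD.
- by move=> c v Sv; rewrite unfold_in linearZ; apply: SZ.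
Qed.
HB.instance Definition _ n :=
  GRing.isSubmodClosed.Build k C (corad_filt n) (corad_filt_closed n).

Definition pointed :=
  forall D : submodClosed C, simple_subcoalgebra D -> has_dim (submod D) 1.

End Coradical.

Arguments coradical {k} C.
Arguments corad_filt {k} C n.

Section GroupLike.
Variables (k : fieldType) (H : hopfAlgType k).

Definition is_grouplike : {pred H} :=
  fun g => `[< comul g = g \ox g /\ counit g = 1 >].

Lemma is_grouplikeP g : reflect (comul g = g \ox g /\ counit g = 1) (g \in is_grouplike).
Proof. exact: asboolP. Qed.

Definition grouplike : Type := {g : H | g \in is_grouplike}.
HB.instance Definition _ := [isSub of grouplike for @sval H _].
HB.instance Definition _ := [Choice of grouplike by <:].

Lemma grouplike1_subproof : 1 \in is_grouplike.
Proof. by apply/is_grouplikeP; rewrite comul_one counit_one. Qed.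

Lemma grouplikeM_subproof (g h : grouplike) : val g * val h \in is_grouplike.
Proof.
apply/is_grouplikeP; rewrite comulM counitM.
have /is_grouplikeP[-> ->] := valP g; have /is_grouplikeP[-> ->] := valP h.
by rewrite tmulE mulr1.
Qed.

Lemma antipodeV_bilinear : bilinear_for *:%R *:%R (fun x y : H => antipode x * y).
Proof.
split=> [y|x] c u v; first by rewrite linearP mulrDl -scalerAl.
by rewrite mulrDr -scalerAr.
Qed.
Lemma antipodeVr_bilinear : bilinear_for *:%R *:%R (fun x y : H => x * antipode y).
Proof.
split=> [y|x] c u v; last by rewrite linearP mulrDr -scalerAr.
by rewrite mulrDl -scalerAl.
Qed.

Lemma grouplikeV (g : grouplike) : antipode (val g) * val g = 1.
Proof.
have := antipodeV (val g); have /is_grouplikeP[-> ->] := valP g.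
by rewrite (tliftE antipodeV_bilinear) scale1r.
Qed.
Lemma grouplikeVr (g : grouplike) : val g * antipode (val g) = 1.
Proof.
have := antipodeVr (val g); have /is_grouplikeP[-> ->] := valP g.
by rewrite (tliftE antipodeVr_bilinear) scale1r.
Qed.

Lemma grouplikeV_subproof (g : grouplike) : antipode (val g) \in is_grouplike.
Proof.
have /is_grouplikeP[Dg eg] := valP g.
apply/is_grouplikeP; split; last first.
  by have := counitM (antipode (val g)) (val g); rewrite grouplikeV counit_one eg mulr1.
rewrite -[LHS]tmul1 -(grouplikeVr g) -tmulE tmulA -Dg -comulM grouplikeV.
by rewrite comul_one tmul1l.
Qed.

Definition grouplike_one : grouplike := Sub 1 grouplike1_subproof.
Definition grouplike_mul (g h : grouplike) : grouplike :=
  Sub (val g * val h) (grouplikeM_subproof g h).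
Definition grouplike_inv (g : grouplike) : grouplike :=
  Sub (antipode (val g)) (grouplikeV_subproof g).

Fact grouplike_mulA : associative grouplike_mul.
Proof. by move=> f g h; apply: val_inj; rewrite /= mulrA. Qed.
Fact grouplike_mul1g : left_id grouplike_one grouplike_mul.
Proof. by move=> g; apply: val_inj; rewrite /= mul1r. Qed.
Fact grouplike_mulg1 : right_id grouplike_one grouplike_mul.
Proof. by move=> g; apply: val_inj; rewrite /= mulr1. Qed.
Fact grouplike_mulVg : left_inverse grouplike_one grouplike_inv grouplike_mul.
Proof. by move=> g; apply: val_inj; exact: grouplikeV. Qed.
Fact grouplike_mulgV : right_inverse grouplike_one grouplike_inv grouplike_mul.
Proof. by move=> g; apply: val_inj; exact: grouplikeVr. Qed.
HB.instance Definition _ := isGroup.Build grouplike grouplike_mulA grouplike_mul1g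
  grouplike_mulg1 grouplike_mulVg grouplike_mulgV.

End GroupLike.

Section Rank.
Variables (k : fieldType) (H : hopfAlgType k).

Definition hopf_subalgebra (B : {pred H}) :=
  [/\ GRing.subalg_closed B, subcoalgebra B & forall b, b \in B -> antipode b \in B].

Definition generated_by (P : {pred H}) :=
  forall B : subalgClosed H, {subset P <= B} -> forall h, h \in B.

(* The balancing relations in k (x) H_1 that present k (x)_{H_0} H_1, where
   h \in H_0 acts on k by counit h and on H_1 by left multiplication. *)
Definition balanced_rel (t : tensor k^o (submod (corad_filt H 1))) : Prop :=
  exists (c : k^o) (h : H) (x hx : submod (corad_filt H 1)),
    [/\ h \in corad_filt H 0, val hx = h * val x &
        t = ((c * counit h : k^o) \ox x) - (c \ox hx)].

Definition has_rank (n : nat) :=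
  [/\ hopf_subalgebra (corad_filt H 0), generated_by (corad_filt H 1) &
      has_dim (quotmod (span balanced_rel)) n.+1].

End Rank.

Section HopfQuotient.
Variable k : fieldType.

Definition two_sided_ideal (A : algType k) (I : {pred A}) :=
  forall a b, b \in I -> a * b \in I /\ b * a \in I.

Definition ideal_gen (A : algType k) (y : A) : {pred A} :=
  fun z => `[< forall J : submodClosed A, two_sided_ideal J -> y \in J -> z \in J >].

End HopfQuotient.

HB.mixin Record isHopfIdeal (k : fieldType) (A : hopfAlgType k) (I : A -> bool) := {
  hopf_ideal_mul : two_sided_ideal (I : {pred A});
  hopf_ideal_comul : forall b, b \in (I : {pred A}) ->
    comul b \in tspan (fun u v : A => u \in (I : {pred A}) \/ v \in (I : {pred A}));
  hopf_ideal_counit : forall b, b \in (I : {pred A}) -> counit b = 0;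
  hopf_ideal_antipode : forall b, b \in (I : {pred A}) -> antipode b \in (I : {pred A})
}.

#[short(type="hopfIdeal")]
HB.structure Definition HopfIdeal (k : fieldType) (A : hopfAlgType k) :=
  {I of @GRing.SubmodClosed k A I & isHopfIdeal k A I}.

Definition hopf_quot (k : fieldType) (A : hopfAlgType k) (I : hopfIdeal A) : Type :=
  quotmod I.
HB.instance Definition _ (k : fieldType) (A : hopfAlgType k) (I : hopfIdeal A) :=
  GRing.Lmodule.on (hopf_quot I).

Definition hproj (k : fieldType) (A : hopfAlgType k) (I : hopfIdeal A) :
  A -> hopf_quot I := qproj I.
HB.instance Definition _ (k : fieldType) (A : hopfAlgType k) (I : hopfIdeal A) :=
  GRing.isLinear.Build k A (hopf_quot I) _ (hproj I) (qproj_linear I).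

(* The quotient Hopf algebra A / I: all operations are computed on representatives. *)
HB.lock Definition hq_mul (k : fieldType) (A : hopfAlgType k) (I : hopfIdeal A)
  (p q : hopf_quot I) : hopf_quot I := hproj I (qrepr p * qrepr q).
HB.lock Definition hq_comul (k : fieldType) (A : hopfAlgType k) (I : hopfIdeal A)
  (q : hopf_quot I) : tensor (hopf_quot I) (hopf_quot I) :=
  tmap (hproj I) (hproj I) (comul (qrepr q)).
HB.lock Definition hq_counit (k : fieldType) (A : hopfAlgType k) (I : hopfIdeal A)
  (q : hopf_quot I) : k := counit (qrepr q).
HB.lock Definition hq_antipode (k : fieldType) (A : hopfAlgType k) (I : hopfIdeal A)
  (q : hopf_quot I) : hopf_quot I := hproj I (antipode (qrepr q)).

Section HopfQuotientTheory.
Variables (k : fieldType) (A : hopfAlgType k) (I : hopfIdeal A).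
Implicit Types (a b c : A) (p q : hopf_quot I).
Local Notation Q := (hopf_quot I).
Local Notation pi := (hproj I).

Lemma hind (P : Q -> Prop) : (forall a, P (pi a)) -> forall q, P q.
Proof. exact: qind. Qed.

Lemma hprojP a b : reflect (pi a = pi b) (a - b \in I).
Proof. exact: qprojP. Qed.

Lemma hprojK a : qrepr (pi a) - a \in I.
Proof. exact: qprojK. Qed.

Lemma hproj0 a : a \in I -> pi a = 0.
Proof. by move=> Ia; rewrite -(linear0 pi); apply/hprojP; rewrite subr0. Qed.

Lemma hq_mulE a b : hq_mul (pi a) (pi b) = pi (a * b).
Proof.
rewrite hq_mul.unlock; apply/hprojP.
set a' := qrepr _; set b' := qrepr _.
have -> : a' * b' - a * b = (a' - a) * b' + a * (b' - b).
  by rewrite mulrBl mulrBr addrA subrK.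
apply: rpredD; first exact: (hopf_ideal_mul b' _ (hprojK a)).2.
exact: (hopf_ideal_mul a _ (hprojK b)).1.
Qed.

Fact hq_mulA : associative (@hq_mul k A I).
Proof. by elim/hind=> a; elim/hind=> b; elim/hind=> c; rewrite !hq_mulE mulrA. Qed.
Fact hq_mul1l : left_id (pi 1) (@hq_mul k A I).
Proof. by elim/hind=> a; rewrite hq_mulE mul1r. Qed.
Fact hq_mul1r : right_id (pi 1) (@hq_mul k A I).
Proof. by elim/hind=> a; rewrite hq_mulE mulr1. Qed.
Fact hq_mulDl : left_distributive (@hq_mul k A I) +%R.
Proof.
elim/hind=> a; elim/hind=> b; elim/hind=> c.
by rewrite -linearD !hq_mulE -linearD mulrDl.
Qed.
Fact hq_mulDr : right_distributive (@hq_mul k A I) +%R.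
Proof.
elim/hind=> a; elim/hind=> b; elim/hind=> c.
by rewrite -linearD !hq_mulE -linearD mulrDr.
Qed.
Fact hq_oner_neq0 : pi 1 != 0.
Proof.
apply/eqP; rewrite -(linear0 pi) => /hprojP; rewrite subr0.
by move/hopf_ideal_counit/eqP; rewrite counit_one oner_eq0.
Qed.
HB.instance Definition _ := GRing.Zmodule_isNzRing.Build Q
  hq_mulA hq_mul1l hq_mul1r hq_mulDl hq_mulDr hq_oner_neq0.

Lemma hprojM a b : pi (a * b) = pi a * pi b.
Proof. by rewrite -hq_mulE. Qed.

Fact hq_scaleAl (c : k) p q : c *: (p * q) = (c *: p) * q.
Proof.
elim/hind: p => a; elim/hind: q => b.
by rewrite -hprojM -!linearZ -hprojM scalerAl.
Qed.
HB.instance Definition _ := GRing.Lmodule_isLalgebra.Build k Q hq_scaleAl.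
Fact hq_scaleAr (c : k) p q : c *: (p * q) = p * (c *: q).
Proof.
elim/hind: p => a; elim/hind: q => b.
by rewrite -hprojM -!linearZ -hprojM scalerAr.
Qed.
HB.instance Definition _ := GRing.Lalgebra_isAlgebra.Build k Q hq_scaleAr.

Local Notation pi2 := (tmap pi pi).

Lemma hq_comulE a : hq_comul (pi a) = pi2 (comul a).
Proof.
rewrite hq_comul.unlock; apply/eqP; rewrite -subr_eq0 -!linearB /=.
pose K : {pred tensor A A} := fun t => pi2 t == 0.
have KC : GRing.subsemimod_closed K.
  split; first split.
  - by rewrite unfold_in /K linear0.
  - by move=> x y /eqP gx /eqP gy; apply/eqP; rewrite linearD /= gx gy addr0.
  - by move=> c x /eqP gx; apply/eqP; rewrite linearZ /= gx scaler0.
pose M := GRing.isSubmodClosed.Build k _ K KC.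
pose KS : submodClosed (tensor A A) := HB.pack K M.
have := hopf_ideal_comul _ (hprojK a).
apply: (@span_min _ _ _ KS) => w [u [v [uv ->]]].
rewrite unfold_in /K tmapE /=.
by case: uv => /hproj0 ->; rewrite ?tensor0l ?tensor0r.
Qed.

Lemma hq_counitE a : hq_counit (pi a) = counit a.
Proof.
rewrite hq_counit.unlock; apply/eqP; rewrite -subr_eq0 -linearB.
exact/eqP/hopf_ideal_counit/hprojK.
Qed.

Lemma hq_antipodeE a : hq_antipode (pi a) = pi (antipode a).
Proof.
rewrite hq_antipode.unlock; apply/hprojP; rewrite -linearB.
exact/hopf_ideal_antipode/hprojK.
Qed.

Fact hq_comul_linear : linear (@hq_comul k A I).
Proof.
move=> c; elim/hind=> a; elim/hind=> b.
by rewrite -linearP !hq_comulE !linearP.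
Qed.
HB.instance Definition _ :=
  GRing.isLinear.Build k Q (tensor Q Q) _ (@hq_comul k A I) hq_comul_linear.
Fact hq_counit_linear : scalar (@hq_counit k A I).
Proof.
move=> c; elim/hind=> a; elim/hind=> b.
by rewrite -linearP !hq_counitE linearP.
Qed.
HB.instance Definition _ :=
  GRing.isLinear.Build k Q k _ (@hq_counit k A I) hq_counit_linear.
Fact hq_antipode_linear : linear (@hq_antipode k A I).
Proof.
move=> c; elim/hind=> a; elim/hind=> b.
by rewrite -linearP !hq_antipodeE !linearP.
Qed.
HB.instance Definition _ :=
  GRing.isLinear.Build k Q Q _ (@hq_antipode k A I) hq_antipode_linear.

Lemma tmap_comull (t : tensor A A) :
  tmap (@hq_comul k A I) idfun (pi2 t) = tmap pi2 pi (tmap comul idfun t).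
Proof.
elim/tensor_ind: t => [u v|c s t IHs IHt]; last by rewrite !tmapP IHs IHt.
by rewrite !tmapE /= hq_comulE.
Qed.
Lemma tmap_comulr (t : tensor A A) :
  tmap idfun (@hq_comul k A I) (pi2 t) = tmap pi pi2 (tmap idfun comul t).
Proof.
elim/tensor_ind: t => [u v|c s t IHs IHt]; last by rewrite !tmapP IHs IHt.
by rewrite !tmapE /= hq_comulE.
Qed.
Lemma tassoc_pi (t : tensor (tensor A A) A) :
  tassoc (tmap pi2 pi t) = tmap pi pi2 (tassoc t).
Proof.
elim/tensor_ind: t => [s w|c s t IHs IHt]; last first.
  by rewrite tmapP !tassocP tmapP IHs IHt.
elim/tensor_ind: s => [u v|c s t IHs IHt]; first by rewrite tmapE /= tmapE /= !tassocE !tmapE /= tmapE.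
by rewrite tensorDl tensorZl tmapP !tassocP tmapP IHs IHt.
Qed.

Lemma tlift_pi (W X : lmodType k) (h : {linear W -> X}) (f : Q -> Q -> X)
    (g : A -> A -> W) (t : tensor A A) :
  bilinear_for *:%R *:%R f -> bilinear_for *:%R *:%R g ->
  (forall u v, f (pi u) (pi v) = h (g u v)) -> tlift f (pi2 t) = h (tlift g t).
Proof.
move=> bf bg E; elim/tensor_ind: t => [u v|c s t IHs IHt].
  by rewrite tmapE (tliftE bf) (tliftE bg) E.
by rewrite tmapP (tliftP bf) (tliftP bg) linearP IHs IHt.
Qed.

Lemma counitl_bilinear (D : lmodType k) (e : {scalar D}) :
  bilinear_for *:%R *:%R (fun x y : D => e x *: y).
Proof.
split=> [y|x] c u v; first by rewrite /= linearP scalerDl scalerA.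
by rewrite /= scalerDr !scalerA mulrC.
Qed.
Lemma counitr_bilinear (D : lmodType k) (e : {scalar D}) :
  bilinear_for *:%R *:%R (fun x y : D => e y *: x).
Proof.
split=> [y|x] c u v; last by rewrite /= linearP scalerDl scalerA.
by rewrite /= scalerDr !scalerA mulrC.
Qed.

Fact hq_comulA q : tassoc (tmap (@hq_comul k A I) idfun (hq_comul q)) =
  tmap idfun (@hq_comul k A I) (hq_comul q).
Proof.
by elim/hind: q => a; rewrite hq_comulE tmap_comull tmap_comulr tassoc_pi comulA.
Qed.
Fact hq_comul1l q : tlift (fun x y => hq_counit x *: y) (hq_comul q) = q.
Proof.
elim/hind: q => a; rewrite hq_comulE.
rewrite (tlift_pi (h := pi) _ (counitl_bilinear _) (counitl_bilinear (@counit k A))).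
  by rewrite comul1l.
by move=> u v; rewrite /= hq_counitE linearZ.
Qed.
Fact hq_comul1r q : tlift (fun x y => hq_counit y *: x) (hq_comul q) = q.
Proof.
elim/hind: q => a; rewrite hq_comulE.
rewrite (tlift_pi (h := pi) _ (counitr_bilinear _) (counitr_bilinear (@counit k A))).
  by rewrite comul1r.
by move=> u v; rewrite /= hq_counitE linearZ.
Qed.
HB.instance Definition _ := isCoalgebra.Build k Q hq_comulA hq_comul1l hq_comul1r.

Fact hq_comul_one : hq_comul (1 : Q) = 1 \ox 1.
Proof. by rewrite -[1]/(pi 1) hq_comulE comul_one tmapE. Qed.
Fact hq_comulM p q : hq_comul (p * q) = tmul (hq_comul p) (hq_comul q).
Proof.
elim/hind: p => a; elim/hind: q => b; rewrite -hprojM !hq_comulE comulM.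
elim/tensor_ind: (comul a) => [u v|c s t IHs IHt]; last first.
  by rewrite !(tmulPl, tmapP) IHs IHt.
elim/tensor_ind: (comul b) => [x y|c s t IHs IHt]; last first.
  by rewrite !(tmulPr, tmapP) IHs IHt.
by rewrite tmulE !tmapE tmulE -!hprojM.
Qed.
Fact hq_counit_one : hq_counit (1 : Q) = 1.
Proof. by rewrite -[1]/(pi 1) hq_counitE counit_one. Qed.
Fact hq_counitM p q : hq_counit (p * q) = hq_counit p * hq_counit q.
Proof. by elim/hind: p => a; elim/hind: q => b; rewrite -hprojM !hq_counitE counitM. Qed.
Fact hq_antipodeV q :
  tlift (fun x y => hq_antipode x * y) (hq_comul q) = hq_counit q *: 1.
Proof.
elim/hind: q => a; rewrite hq_comulE hq_counitE.
rewrite (tlift_pi (h := pi) _ _ (antipodeV_bilinear A)).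
- by rewrite antipodeV linearZ.
- by split=> [y|x] c u v; rewrite /= ?linearP ?mulrDl ?mulrDr -?scalerAl -?scalerAr.
- by move=> u v; rewrite /= hq_antipodeE hprojM.
Qed.
Fact hq_antipodeVr q :
  tlift (fun x y => x * hq_antipode y) (hq_comul q) = hq_counit q *: 1.
Proof.
elim/hind: q => a; rewrite hq_comulE hq_counitE.
rewrite (tlift_pi (h := pi) _ _ (antipodeVr_bilinear A)).
- by rewrite antipodeVr linearZ.
- by split=> [y|x] c u v; rewrite /= ?linearP ?mulrDl ?mulrDr -?scalerAl -?scalerAr.
- by move=> u v; rewrite /= hq_antipodeE hprojM.
Qed.
HB.instance Definition _ := isHopfAlgebra.Build k Q hq_comul_one hq_comulM
  hq_counit_one hq_counitM hq_antipodeV hq_antipodeVr.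

End HopfQuotientTheory.

Definition hopf_isomorphic (k : fieldType) (H K : hopfAlgType k) :=
  exists f : {lrmorphism H -> K},
    [/\ bijective f,
        forall h, comul (f h) = tmap f f (comul h),
        forall h, counit (f h) = counit h &
        forall h, f (antipode h) = antipode (f h)].

Section HopfOre.
Variables (k : fieldType) (G : groupType).

(* Characters are valued in k^x. *)
Definition is_character (chi : G -> k) :=
  (forall g, chi g != 0) /\ forall g h, chi (g * h)%g = chi g * chi h.

(* alpha : kG -> k, where {malg k[G]} is the vector space kG with basis << g >> *)
Definition is_cocycle (chi : G -> k) (alpha : {scalar {malg k[G]}}) :=
  forall g h, alpha << (g * h)%g >> = alpha << g >> + chi g * alpha << h >>.

Variable A : hopfAlgType k.

(* A is the Hopf-Ore extension kG(chi, a, delta), delta g = alpha(g) g (1 - a),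
   with iota the inclusion of G and x the variable. As the elements g x^i form a
   basis of A, the relations hopf_ore_rel are defining relations. *)
Record is_hopf_ore (chi : G -> k) (a : G) (alpha : {scalar {malg k[G]}})
    (iota : G -> A) (x : A) : Prop := IsHopfOre {
  hopf_ore_one : iota 1%g = 1;
  hopf_ore_mul : forall g h, iota (g * h)%g = iota g * iota h;
  hopf_ore_comul : forall g, comul (iota g) = iota g \ox iota g;
  hopf_ore_counit : forall g, counit (iota g) = 1;
  hopf_ore_antipode : forall g, antipode (iota g) = iota (g^-1)%g;
  hopf_ore_basis : is_basis (fun m : G * nat => iota m.1 * x ^+ m.2);
  hopf_ore_rel : forall g, x * iota g =
    chi g *: (iota g * x) + alpha << g >> *: (iota g * (1 - iota a));
  hopf_ore_comulx : comul x = x \ox iota a + 1 \ox x;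
  hopf_ore_counitx : counit x = 0;
  hopf_ore_antipodex : antipode x = - x * iota (a^-1)%g
}.

End HopfOre.

(* Main.v *)
Require Import Defs.
From HB Require Import structures.
From mathcomp Require Import all_boot all_algebra.
From mathcomp Require Import finmap.
From mathcomp Require Import boolp.
From mathcomp Require Import monalg.
From mathcomp Require classical_sets.
From mathcomp Require Import ring.

Set Implicit Arguments.
Unset Strict Implicit.
Unset Printing Implicit Defensive.

Import GRing.Theory Defs.

Local Open Scope ring_scope.

(** Let H be pointed of rank one, with coradical kG and next filtration term H_1.

    The variable. By the Taft-Wilson theorem in degree one ([taft_wilson]), H_1 is spanned
    by the g and the g u, where g is group-like and u is (b,1)-primitive, that is
    Delta(u) = u (x) b + 1 (x) u. A linear functional f that kills kG becomes invariant under
    left multiplication by G when it is replaced by c |-> f(S(E c_1) c_2), with E a projection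
    onto kG; so skew primitive elements that are independent modulo kG stay independent in
    k (x)_{kG} H_1. As this space has dimension two, H_1 = kG + kG x for a single
    (a,1)-primitive x ([sprim_decomp]). An element g^-1 x g is again skew primitive, and
    the skew primitive elements of kG + kG x are few ([sprim_form]): this forces a to be
    central and gives the commutation rule x g = chi(g) g x + alpha(g) g (1 - a).
    Substituting s x + d (1 - a) for x makes alpha(a) equal to 0 or 1, and equal to 0 as soon
    as chi(a) <> 1 ([normalized_exists]).

    Falling powers. Put q = chi(a), l = alpha(a), (n)_q = 1 + q + ... + q^(n-1) and
    x^(n) = (x - l (n-1)_q) ... (x - l (1)_q) x. These elements satisfy the q-binomial formula
    Delta(x^(n)) = sum_j [n,j]_q x^(j) (x) a^j x^(n-j) for all values of q and l
    ([comul_ffpow]), which makes a case distinction on q unnecessary. Two consequences follow.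
    If (1)_q, ..., (N-1)_q are nonzero, then x^(0), ..., x^(N-1) are independent over kG
    ([ff_freeP]); if moreover (N)_q = 0, all inner q-binomial coefficients [N,j]_q vanish, so
    x^(N) is (a^N,1)-primitive and hence x^(N) = beta x + gamma (1 - a^N), with a^N = a
    unless beta = 0.

    The Hopf-Ore extension A = kG(chi,a,delta) is built on the vector space with basis
    g x^i. It is free of rank one among the spaces on which G and a variable act by the
    commutation rule ([ore_lift]); its product, coproduct, counit and antipode, and the
    projection of A onto H, all come from this one universal property.

    The kernel I of A -> H. If no (N)_q vanishes, independence gives I = 0. If N is the least
    positive integer with (N)_q = 0, then z = x^(N) - beta x - gamma (1 - a^N) lies in I, and
    modulo z every element of A is a combination of x^(0), ..., x^(N-1), which are independent
    in H; so I is generated by z ([cover_kernel], [kernel_gen]). When q is a primitive n-th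
    root of unity with n >= 2, N = n, l = 0 and x^(n) = x^n; here beta = 0 because a^n = a
    would give q = q^n = 1. When q = 1 in characteristic p, N = p and x^(p) is x^p for l = 0,
    and x^p - x for l = 1; in the last case beta = 0 because a^p = a would give
    1 = alpha(a) = p alpha(a) = 0. *)

(** * Linear algebra over a field: projections, functionals, tensors *)

Definition mklin (k : fieldType) (V W : lmodType k) (f : V -> W) (fl : linear f) :
  {linear V -> W} := HB.pack f (GRing.isLinear.Build k V W *:%R f fl).
Definition mkscalar (k : fieldType) (V : lmodType k) (f : V -> k) (fl : scalar f) :
  {scalar V} := HB.pack f (GRing.isLinear.Build k V k *%R f fl).

Definition mksubmod (k : fieldType) (V : lmodType k) (P : V -> Prop)
    (P0 : P 0) (PP : forall c u v, P u -> P v -> P (c *: u + v)) :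
  {S : submodClosed V | forall v, (v \in S) <-> P v}.
Proof.
pose S : {pred V} := fun v => `[< P v >].
have SC : GRing.subsemimod_closed S.
  split; first split.
  - exact/asboolP.
  - by move=> u v /asboolP Pu /asboolP Pv; apply/asboolP; rewrite -[u]scale1r; apply: PP.
  - move=> c v /asboolP Pv; apply/asboolP.
    by rewrite -[c *: v]addr0; apply: PP.
pose M := GRing.isSubmodClosed.Build k V S SC.
pose S' : submodClosed V := HB.pack S M.
exists S' => v; split; [by move/asboolP | by move=> ?; apply/asboolP].
Qed.

Lemma rpredP (k : fieldType) (V : lmodType k) (S : submodClosed V) c u v :
  u \in S -> v \in S -> c *: u + v \in S.
Proof. by move=> Su Sv; apply: rpredD => //; apply: rpredZ. Qed.

Lemma submodB (k : fieldType) (V : lmodType k) (S : submodClosed V) u v :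
  u \in S -> v \in S -> u - v \in S.
Proof. by move=> Su Sv; rewrite -scaleN1r addrC; apply: rpredP. Qed.

Lemma span_ind (k : fieldType) (V : lmodType k) (B P : V -> Prop) :
  (forall v, B v -> P v) -> P 0 -> (forall c u v, P u -> P v -> P (c *: u + v)) ->
  forall v, v \in span B -> P v.
Proof.
move=> BP P0 PP v; have [S SP] := mksubmod P0 PP.
by move=> /(span_min (S := S)) Sv; apply/SP/Sv => w /BP /SP.
Qed.

Lemma scalarP (k : fieldType) (V : lmodType k) (f : {scalar V}) c u v :
  f (c *: u + v) = c * f u + f v.
Proof. exact: linearP. Qed.
Lemma scalarZ (k : fieldType) (V : lmodType k) (f : {scalar V}) c u :
  f (c *: u) = c * f u.
Proof. exact: linearZ. Qed.

Lemma lin_scale (k : fieldType) (U V : lmodType k) (f : {linear U -> V}) c u :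
  f (c *: u) = c *: f u.
Proof. exact: linearZ. Qed.

Section Projection.
Variables (k : fieldType) (V : lmodType k).

(** Zorn's lemma for the sets closed under linear combinations that meet S at most in 0. The
    empty set is admitted, so that the union of an empty chain is allowed. *)
Lemma complement_exists (S : submodClosed V) : exists A : V -> Prop,
  [/\ forall c u v, A u -> A v -> A (c *: u + v),
      forall v, A v -> v \in S -> v = 0 &
      forall v, exists s m, [/\ s \in S, A m & v = s + m]].
Proof.
pose P (A : classical_sets.set V) :=
  (forall c u v, A u -> A v -> A (c *: u + v)) /\ (forall v, A v -> v \in S -> v = 0).
have [|A [[Al AS] Amax]] := @classical_sets.Zorn_bigcup V P.
  move=> F FP Ftot; split=> [c u v [X FX Xu] [Y FY Yv]|v [X FX Xv]]; last exact: (FP _ FX).2.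
  have [XY|YX] := Ftot _ _ FX FY.
    by exists Y => //; apply: (FP _ FY).1 => //; apply: XY.
  by exists X => //; apply: (FP _ FX).1 => //; apply: YX.
(* A maximal set is not empty, since the empty set is contained in the set with element 0. *)
have A0 : A 0.
  have [//|nA0] := pselect (A 0); exfalso.
  apply: (Amax (fun v => v = 0)); last first.
    split=> [c u v -> ->|v -> //]; by rewrite scaler0 addr0.
  split=> [v Av|/(_ _ erefl)//]; exfalso; apply: nA0.
  by have := Al (-1) _ _ Av Av; rewrite scaleN1r addNr.
exists A; split => // v.
have [//|nSA] := pselect (exists s m, [/\ s \in S, A m & v = s + m]); exfalso.
have Sc c u : A u -> c *: v + u \in S -> c = 0.
  move=> Au Scu; apply/eqP; apply: contraPT nSA => c0 [].
  exists (c^-1 *: (c *: v + u)), (- c^-1 *: u + 0); split.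
  - exact: rpredZ.
  - exact: Al.
  - by rewrite addr0 scalerDr scalerA mulVf // scale1r scaleNr addrK.
apply: (Amax (fun w => exists c u, A u /\ w = c *: v + u)).
  split=> [u Au|BA]; first by exists 0, u; rewrite scale0r add0r.
  apply: nSA; exists 0, v; split; rewrite ?add0r ?rpred0 //.
  by apply: BA; exists 1, 0; rewrite scale1r addr0.
split=> [c _ _ [d [u [Au ->]]] [e [w [Aw ->]]]|_ [c [u [Au ->]]] Scu].
  exists (c * d + e), (c *: u + w); split; first exact: Al.
  by rewrite scalerDr scalerA scalerDl addrACA.
have c0 := Sc _ _ Au Scu; move: Scu; rewrite c0 scale0r add0r; exact: AS.
Qed.

Lemma projection_exists (S : submodClosed V) : exists E : {linear V -> V},
  (forall v, E v \in S) /\ (forall v, v \in S -> E v = v).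
Proof.
have [A [Al AS Asum]] := complement_exists S.
have uniq s s' m m' : s \in S -> s' \in S -> A m -> A m' -> s + m = s' + m' -> s = s'.
  move=> Ss Ss' Am Am' e; apply/esym/eqP; rewrite -subr_eq0; apply/eqP.
  have e' : s' - s = (-1) *: m' + m.
    by apply/eqP; rewrite scaleN1r subr_eq -addrA [m + s]addrC e addrCA addNr addr0.
  apply: AS; first by rewrite e'; apply: Al.
  exact: submodB.
have /choice[E EP] v : exists s, s \in S /\ exists m, A m /\ v = s + m.
  by have [s [m [Ss Am ->]]] := Asum v; exists s; split=> //; exists m.
have El : linear E.
  move=> c u v; have [Su [mu [Au eu]]] := EP u; have [Sv [mv [Av ev]]] := EP v.
  have [Sw [mw [Aw ew]]] := EP (c *: u + v).
  apply: (uniq _ _ mw (c *: mu + mv)); rewrite ?rpredP //; first exact: Al.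
  by rewrite -ew {1}eu {1}ev scalerDr addrACA.
exists (mklin El); split=> v /=; first by have [] := EP v.
move=> Sv; have [Sw [m [Am ev]]] := EP v.
apply: (uniq _ _ m 0) => //; last by rewrite addr0.
have : A ((-1) *: m + m) by exact: Al.
by rewrite scaleN1r addNr.
Qed.

(** Projecting along S onto a complement, and then onto the line through the image of v. *)
Lemma separation (S : submodClosed V) v : v \notin S ->
  exists f : {scalar V}, (forall s, s \in S -> f s = 0) /\ f v = 1.
Proof.
move=> Sv; have [E [ES Eid]] := projection_exists S.
pose w := v - E v; have w0 : w != 0.
  by apply: contraNneq Sv => /eqP; rewrite subr_eq0 => /eqP ->.
have [L LP] : {L : submodClosed V | forall u, u \in L <-> exists c, u = c *: w}.
  apply: mksubmod => [|c _ _ [d ->] [e ->]]; first by exists 0; rewrite scale0r.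
  by exists (c * d + e); rewrite scalerDl scalerA.
have [D [DL Did]] := projection_exists L.
have /choice[f fP] u : exists c, D (u - E u) = c *: w by exact/LP.
have inj c d : c *: w = d *: w -> c = d.
  move=> /eqP; rewrite -subr_eq0 -scalerBl scaler_eq0 (negPf w0) orbF subr_eq0.
  by move/eqP.
have fl : scalar f.
  move=> c x y; apply: inj; rewrite -fP [RHS]scalerDl -scalerA -!fP -!linearP.
  by rewrite linearP scalerBr opprD addrACA.
exists (mkscalar fl); split=> [s Ss|] /=; apply: inj; rewrite -fP.
  by rewrite Eid // subrr linear0 scale0r.
by rewrite Did ?scale1r //; apply/LP; exists 1; rewrite scale1r.
Qed.

End Projection.

Lemma linear_retract (k : fieldType) (U V : lmodType k) (f : {linear U -> V}) :
  injective f -> exists r : {linear V -> U}, cancel f r.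
Proof.
move=> finj; have [S SP] : {S : submodClosed V | forall v, v \in S <-> exists u, v = f u}.
  apply: mksubmod => [|c _ _ [u ->] [v ->]]; first by exists 0; rewrite linear0.
  by exists (c *: u + v); rewrite linearP.
have [E [ES Eid]] := projection_exists S.
have /choice[r rP] v : exists u, E v = f u by exact/SP.
have rl : linear r by move=> c u v; apply: finj; rewrite linearP -!rP linearP.
by exists (mklin rl) => u; apply: finj; rewrite -rP Eid //; apply/SP; exists u.
Qed.

Section Contraction.
Variables (k : fieldType) (U V : lmodType k).

Lemma ctl_bilinear (f : {scalar U}) : bilinear_for *:%R *:%R (fun (u : U) (v : V) => f u *: v).
Proof.
split=> [v|u] c x y; first by rewrite /= linearP scalerDl scalerA.
by rewrite /= scalerDr !scalerA mulrC.
Qed.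
Lemma ctr_bilinear (f : {scalar V}) : bilinear_for *:%R *:%R (fun (u : U) (v : V) => f v *: u).
Proof.
split=> [v|u] c x y; last by rewrite /= linearP scalerDl scalerA.
by rewrite /= scalerDr !scalerA mulrC.
Qed.

Definition ctl (f : {scalar U}) : tensor U V -> V := tlift (fun u v => f u *: v).
Definition ctr (f : {scalar V}) : tensor U V -> U := tlift (fun u v => f v *: u).
HB.instance Definition _ f := GRing.isLinear.Build k (tensor U V) V _ (ctl f)
  (tlift_linear (ctl_bilinear f)).
HB.instance Definition _ f := GRing.isLinear.Build k (tensor U V) U _ (ctr f)
  (tlift_linear (ctr_bilinear f)).
Lemma ctlE f u v : ctl f (u \ox v) = f u *: v.
Proof. exact: (tliftE (ctl_bilinear f)). Qed.
Lemma ctrE f u v : ctr f (u \ox v) = f v *: u.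
Proof. exact: (tliftE (ctr_bilinear f)). Qed.
Lemma ctlP f c s t : ctl f (c *: s + t) = c *: ctl f s + ctl f t.
Proof. exact: linearP. Qed.
Lemma ctrP f c s t : ctr f (c *: s + t) = c *: ctr f s + ctr f t.
Proof. exact: linearP. Qed.

End Contraction.

Section TensorEq.
Variables (k : fieldType).
Implicit Types U V W X : lmodType k.

Lemma tmap_comp U U' U'' V V' V'' (f : {linear U -> U'}) (g : {linear V -> V'})
    (f' : {linear U' -> U''}) (g' : {linear V' -> V''}) (t : tensor U V) :
  tmap f' g' (tmap f g t) = tmap (f' \o f) (g' \o g) t.
Proof.
by elim/tensor_ind: t => [u v|c s t IHs IHt]; rewrite ?tmapE // !tmapP IHs IHt.
Qed.

Lemma eq_tmap U U' V V' (f f' : {linear U -> U'}) (g g' : {linear V -> V'}) :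
  f =1 f' -> g =1 g' -> tmap f g =1 tmap f' g'.
Proof.
by move=> ff gg t; elim/tensor_ind: t => [u v|c s t IHs IHt];
  rewrite ?tmapE ?ff ?gg // !tmapP IHs IHt.
Qed.

(** Contracting the outer leg of a triple tensor does not see the parenthesization; in this
    form coassociativity is used below without ever inverting [tassoc]. *)
Lemma ctl_tassoc U V W (f : {scalar U}) (t : tensor (tensor U V) W) :
  ctl f (tassoc t) = tmap (ctl f) idfun t.
Proof.
elim/tensor_ind: t => [s w|c s t IHs IHt]; last by rewrite tassocP ctlP tmapP IHs IHt.
elim/tensor_ind: s => [u v|c s t IHs IHt].
  by rewrite tassocE tmapE /= !ctlE tensorZl.
by rewrite tensorDl tensorZl tassocP ctlP tmapP IHs IHt.
Qed.

Lemma ctr_tassoc U V W (f : {scalar W}) (t : tensor (tensor U V) W) :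
  tmap idfun (ctr f) (tassoc t) = ctr f t.
Proof.
elim/tensor_ind: t => [s w|c s t IHs IHt]; last by rewrite tassocP ctrP tmapP IHs IHt.
elim/tensor_ind: s => [u v|c s t IHs IHt].
  by rewrite tassocE tmapE /= !ctrE tensorZr.
by rewrite tensorDl tensorZl tassocP ctrP tmapP IHs IHt.
Qed.

Lemma linear_ctl U V W (f : {scalar U}) (g : {linear V -> W}) t :
  g (ctl f t) = ctl f (tmap idfun g t).
Proof.
elim/tensor_ind: t => [u v|c s t IHs IHt]; first by rewrite tmapE !ctlE linearZ.
by rewrite ctlP tmapP ctlP linearP IHs IHt.
Qed.
Lemma linear_ctr U V W (f : {scalar V}) (g : {linear U -> W}) t :
  g (ctr f t) = ctr f (tmap g idfun t).
Proof.
elim/tensor_ind: t => [u v|c s t IHs IHt]; first by rewrite tmapE !ctrE linearZ.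
by rewrite ctrP tmapP ctrP linearP IHs IHt.
Qed.

Lemma malg_ind (I : choiceType) (P : {malg k[I]} -> Prop) :
  (forall i, P << i >>) -> P 0 -> (forall c u v, P u -> P v -> P (c *: u + v)) ->
  forall c, P c.
Proof.
move=> P1 P0 PZ c; rewrite [c]malg_lincomb; elim: (enum_fset (msupp c)) => [|i s IH].
  by rewrite big_nil.
by rewrite big_cons; apply: PZ.
Qed.

End TensorEq.

Section Dimension.
Variables (k : fieldType) (V : lmodType k).

Lemma has_dim_dependent n (v : 'I_n.+1 -> V) : has_dim V n ->
  exists2 c : 'I_n.+1 -> k, exists i, c i != 0 & \sum_i c i *: v i = 0.
Proof.
move=> [b [cb cbK bK]].
pose M := \matrix_(i < n.+1, j < n) (cb (v i))@_j.
have kn0 : kermx M != 0.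
  by rewrite -mxrank_eq0 mxrank_ker subn_eq0 -ltnNge ltnS rank_leq_col.
have [i [j /= ij]] : exists i j, kermx M i j != 0.
  apply: contrapT => nij; case/eqP: kn0; apply/matrixP => i j; rewrite [RHS]mxE.
  by apply/eqP; apply: contraT => ij; exfalso; apply: nij; exists i, j.
exists (fun j => kermx M i j); first by exists j.
have -> : \sum_j0 kermx M i j0 *: v j0 = lincomb b (\sum_j0 kermx M i j0 *: cb (v j0)).
  by rewrite linear_sum; apply: eq_bigr => l _; rewrite linearZ /= bK.
suff -> : \sum_j0 kermx M i j0 *: cb (v j0) = 0 by rewrite linear0.
apply/malgP => l; rewrite mcoeff0.
have /matrixP/(_ i l) : kermx M *m M = 0 by exact: mulmx_ker.
rewrite [in RHS]mxE mxE => <-; rewrite (big_morph (mcoeff l) (mcoeffD l) (mcoeff0 l)).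
by apply: eq_bigr => m _; rewrite mcoeffZ [M _ _]mxE.
Qed.

Lemma has_dim2_dependent (u v w : V) : has_dim V 2 -> exists c d e,
  c *: u + (d *: v + e *: w) = 0 /\ ~ (c = 0 /\ d = 0 /\ e = 0).
Proof.
pose vs (i : 'I_3) := nth 0 [:: u; v; w] i.
move=> /(has_dim_dependent vs)[e [i ei]]; rewrite !big_ord_recl big_ord0 addr0 /= => e0.
exists (e ord0), (e (lift ord0 ord0)), (e (lift ord0 (lift ord0 ord0))); split=> //.
move=> [c0 [c1 c2]]; move/eqP: ei; apply.
case: i => [[|[|[|//]]] ?]; [rewrite -[RHS]c0|rewrite -[RHS]c1|rewrite -[RHS]c2];
  by congr e; apply: val_inj.
Qed.

Lemma basis_not_line (I : choiceType) (b : I -> V) (i j : I) (v : V) : i != j ->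
  is_basis b -> exists w, forall c, w <> c *: v.
Proof.
move=> ij /bij_inj binj; apply: contrapT => vV.
have {vV}vV w : exists c, w = c *: v.
  by apply: contrapT => nc; apply: vV; exists w => c wc; apply: nc; exists c.
have [s sE] := vV (b i); have [t tE] := vV (b j).
have inj0 c : lincomb b c = 0 -> c = 0 by move=> c0; apply: binj; rewrite c0 linear0.
have s0 : s = 0.
  have /inj0 /(congr1 (mcoeff j)) : lincomb b (s *: << j >> + ((- t) *: << i >> + 0)) = 0.
    rewrite !(linearP (lincomb b)) (linear0 (lincomb b)) /= !lincombU sE tE addr0.
    by rewrite !scalerA mulNr mulrC scaleNr subrr.
  by rewrite mcoeff0 addr0 mcoeffD !mcoeffZ mcoeffUU mcoeffU (negPf ij) mulr0 addr0 mulr1.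
have /inj0 /(congr1 (mcoeff i)) : lincomb b << i >> = 0.
  by rewrite lincombU sE s0 scale0r.
by rewrite mcoeffUU mcoeff0 => /eqP; rewrite oner_eq0.
Qed.

End Dimension.

Lemma tliftD (k : fieldType) (U V W : lmodType k) (f : U -> V -> W) :
  bilinear_for *:%R *:%R f -> forall s t, tlift f (s + t) = tlift f s + tlift f t.
Proof. by move=> bf s t; rewrite -[s in LHS]scale1r (tliftP bf) scale1r. Qed.

Lemma tensorNl (k : fieldType) (U V : lmodType k) (u : U) (v : V) : (- u) \ox v = - (u \ox v).
Proof. by rewrite -scaleN1r tensorZl scaleN1r. Qed.
Lemma tensorNr (k : fieldType) (U V : lmodType k) (u : U) (v : V) : u \ox (- v) = - (u \ox v).
Proof. by rewrite -scaleN1r tensorZr scaleN1r. Qed.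

Section TmulLinear.
Variables (k : fieldType) (A B : algType k).
Implicit Types (c : k) (r s t : tensor A B).
Lemma tmulDl r s t : tmul (r + s) t = tmul r t + tmul s t.
Proof. by rewrite -[r in LHS]scale1r tmulPl scale1r. Qed.
Lemma tmulDr r s t : tmul r (s + t) = tmul r s + tmul r t.
Proof. by rewrite -[s in LHS]scale1r tmulPr scale1r. Qed.
Lemma tmul0l t : tmul 0 t = 0.
Proof. by apply: (@addrI _ (tmul 0 t)); rewrite -tmulDl !addr0. Qed.
Lemma tmul0r t : tmul t 0 = 0.
Proof. by apply: (@addrI _ (tmul t 0)); rewrite -tmulDr !addr0. Qed.
Lemma tmulZl c s t : tmul (c *: s) t = c *: tmul s t.
Proof. by rewrite -[c *: s]addr0 tmulPl tmul0l addr0. Qed.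
Lemma tmulZr c s t : tmul s (c *: t) = c *: tmul s t.
Proof. by rewrite -[c *: t]addr0 tmulPr tmul0r addr0. Qed.
Lemma tmul_linear s : linear (tmul s).
Proof. by move=> c u v; rewrite tmulPr. Qed.
Lemma mul_linear (b : A) : linear ( *%R b).
Proof. by move=> c u v; rewrite mulrDr scalerAr. Qed.
Lemma mulr_linear (b : A) : linear (fun u => u * b).
Proof. by move=> c u v; rewrite mulrDl scalerAl. Qed.
End TmulLinear.

(** * Group-like elements and coordinates on kG *)

Section GroupLikes.
Variables (k : fieldType) (H : hopfAlgType k).
Local Notation G := (grouplike H).

Lemma comulP c (u v : H) : comul (c *: u + v) = c *: comul u + comul v.
Proof. exact: linearP. Qed.

Lemma glD (g : G) : comul (val g) = val g \ox val g.
Proof. by have /is_grouplikeP[] := valP g. Qed.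
Lemma glE (g : G) : counit (val g) = 1.
Proof. by have /is_grouplikeP[] := valP g. Qed.
Lemma gl_neq0 (g : G) : val g != 0.
Proof. by apply: contra_eq_neq (glE g) => ->; rewrite linear0 eq_sym oner_eq0. Qed.
Lemma glVK (g : G) : val (g^-1)%g * val g = 1.
Proof. exact: grouplikeV. Qed.
Lemma glKV (g : G) : val g * val (g^-1)%g = 1.
Proof. exact: grouplikeVr. Qed.

Local Notation gsum := (lincomb (fun g : G => val g)).

(** Suppose g is the combination sum_h d_h h of independent group-like elements other than g,
    and let f be a functional dual to one of them, h. Then f (x) id sends Delta(g) both to
    f(g) g = d_h g and to d_h h; hence d_h = 0 for every h, and g = 0. *)
Lemma gl_independent (s : seq G) (c : G -> k) : uniq s ->
  \sum_(g <- s) c g *: val g = 0 -> forall g, g \in s -> c g = 0.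
Proof.
elim: s c => //= g s IH c /andP[gs us]; rewrite big_cons => c0.
suff cg0 : c g = 0.
  move=> h; rewrite in_cons => /orP[/eqP -> //|hs]; apply: IH => //.
  by move: c0; rewrite cg0 scale0r add0r.
apply/eqP; apply: contraT => cg0.
pose d h := - (c g)^-1 * c h.
have gE : val g = \sum_(h <- s) d h *: val h.
  move/eqP: c0; rewrite addr_eq0 => /eqP /(congr1 ( *:%R (c g)^-1)).
  rewrite scalerA mulVf // scale1r => gE; apply: (etrans gE); rewrite scalerN -scaleNr scaler_sumr.
  by apply: eq_bigr => h _; rewrite scalerA.
suff d0 h : h \in s -> d h = 0.
  have := gl_neq0 g; rewrite gE big_seq big1 ?eqxx // => h hs.
  by rewrite d0 // scale0r.
move=> hs.
pose S := span (fun v => exists h', [/\ h' \in s, h' != h & v = val h']).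
have hS : val h \notin S.
  apply/negP => hsp.
  have [e eh he] : exists2 e : G -> k, e h = 0 & val h = \sum_(h' <- s) e h' *: val h'.
    apply: (span_ind (P := fun v => exists2 e : G -> k,
      e h = 0 & v = \sum_(h' <- s) e h' *: val h')) hsp
      => [_ [h' [h's h'h ->]]||a u v [e e0 ->] [e' e'0 ->]].
    - exists (fun x => (x == h')%:R); first by rewrite eq_sym (negPf h'h).
      rewrite (bigD1_seq h') //= eqxx scale1r big1 ?addr0 // => i /negPf ->.
      by rewrite scale0r.
    - by exists (fun=> 0) => //; rewrite big1 // => i _; rewrite scale0r.
    - exists (fun x => a * e x + e' x); first by rewrite e0 e'0 mulr0 addr0.
      rewrite scaler_sumr -big_split; apply: eq_bigr => i _.
      by rewrite scalerA scalerDl.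
  have /(IH (fun x => e x - (x == h)%:R) us) /(_ h hs) :
      \sum_(i <- s) (e i - (i == h)%:R) *: val i = 0.
    under eq_bigr do rewrite scalerBl; rewrite sumrB -he.
    rewrite (bigD1_seq h) //= eqxx scale1r big1 ?addr0 ?subrr // => i /negPf ->.
    by rewrite scale0r.
  by rewrite eqxx eh sub0r => /eqP; rewrite oppr_eq0 oner_eq0.
have [f [fs fh]] := separation hS.
have fE h' : h' \in s -> f (val h') = (h' == h)%:R.
  move=> h's; case: eqP => [-> //|/eqP h'h]; apply/fs/mem_span; by exists h'.
have fsum (F : G -> H) : \sum_(h' <- s) (d h' * f (val h')) *: F h' = d h *: F h.
  rewrite (bigD1_seq h) //= fh mulr1 big_seq_cond big1 ?addr0 // => i /andP[si ih].
  by rewrite fE // (negPf ih) mulr0 scale0r.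
have fg : f (val g) = d h.
  rewrite gE linear_sum (bigD1_seq h) //= linearZ /= fh mulr1 big_seq_cond.
  rewrite big1 ?addr0 // => i /andP[si ih].
  by rewrite linearZ /= fE // (negPf ih) mulr0.
have : ctl f (comul (val g)) = d h *: val h.
  rewrite gE !linear_sum -fsum; apply: eq_bigr => i _.
  by rewrite !linearZ /= glD ctlE scalerA.
rewrite glD ctlE fg => /eqP; rewrite -subr_eq0 -scalerBr scaler_eq0 => /orP[/eqP //|].
by rewrite subr_eq0 val_eqE => /eqP gh; rewrite gh hs in gs.
Qed.

Lemma gsum_inj : injective gsum.
Proof.
move=> c d /eqP; rewrite -subr_eq0 -linearB /=; set e := c - d => /eqP e0.
apply/eqP; rewrite -subr_eq0 -/e; apply/eqP; apply/malgP => g; rewrite mcoeff0.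
have [gs|] := boolP (g \in msupp e); last exact: mcoeff_outdom.
exact: (gl_independent (c := fun g => e@_g) (fset_uniq (msupp e)) e0).
Qed.

Definition gspan := span (fun h : H => h \in @is_grouplike k H).
Lemma gspan_val (g : G) : val g \in gspan.
Proof. exact/mem_span/(valP g). Qed.
Lemma gspan1 : 1 \in gspan.
Proof. exact: (gspan_val 1%g). Qed.

Lemma gspan_ind (P : H -> Prop) : (forall g : G, P (val g)) -> P 0 ->
  (forall c u v, P u -> P v -> P (c *: u + v)) -> forall v, v \in gspan -> P v.
Proof.
move=> Pg P0 PP; apply: (span_ind (P := P)) => // h hg; exact: (Pg (Sub h hg)).
Qed.

Lemma gspanP v : v \in gspan <-> exists c, v = gsum c.
Proof.
split=> [|[c ->]]; last first.
  elim/malg_ind: c => [g||a c d Sc Sd]; rewrite ?linear0 ?rpred0 //.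
    by rewrite lincombU gspan_val.
  by rewrite linearP; apply: rpredP.
apply: (gspan_ind (P := fun v => exists c, v = gsum c)) => [g||c _ _ [d ->] [e ->]].
- by exists << g >>; rewrite lincombU.
- by exists 0; rewrite linear0.
- by exists (c *: d + e); rewrite linearP.
Qed.

Lemma gspanM u v : u \in gspan -> v \in gspan -> u * v \in gspan.
Proof.
move=> Su; elim/gspan_ind => [g||c x y Sx Sy]; rewrite ?mulr0 ?rpred0 //; last first.
  by rewrite mulrDr -scalerAr; apply: rpredP.
elim/gspan_ind: Su => [h||c x y Sx Sy]; rewrite ?mul0r ?rpred0 //.
  exact: (gspan_val (h * g)%g).
by rewrite mulrDl -scalerAl; apply: rpredP.
Qed.

Lemma gcoord_exists : exists C : {linear H -> {malg k[G]}}, cancel gsum C.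
Proof. exact/linear_retract/gsum_inj. Qed.
Definition gcoord : {linear H -> {malg k[G]}} := projT1 (cid gcoord_exists).
Lemma gsumK : cancel gsum gcoord.
Proof. exact: (projT2 (cid gcoord_exists)). Qed.

Lemma gcoef_exists (g : G) : exists f : {scalar H}, forall h, f h = (gcoord h)@_g.
Proof.
have fl : scalar (fun h : H => (gcoord h)@_g).
  by move=> c u v; rewrite linearP mcoeffD mcoeffZ.
by exists (mkscalar fl).
Qed.
Definition gcoef g : {scalar H} := projT1 (cid (gcoef_exists g)).
Lemma gcoefE g h : gcoef g h = (gcoord h)@_g.
Proof. exact: (projT2 (cid (gcoef_exists g))). Qed.

Lemma gproj_exists : exists E : {linear H -> H}, forall h, E h = gsum (gcoord h).
Proof. by exists (gsum \o gcoord). Qed.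
Definition gproj : {linear H -> H} := projT1 (cid gproj_exists).
Lemma gprojE h : gproj h = gsum (gcoord h).
Proof. exact: (projT2 (cid gproj_exists)). Qed.

Lemma gcoef_val g h : gcoef g (val h) = (h == g)%:R.
Proof. by rewrite gcoefE -(lincombU (fun g : G => val g)) gsumK mcoeffU. Qed.
Lemma gproj_in v : gproj v \in gspan.
Proof. by apply/gspanP; exists (gcoord v); exact: gprojE. Qed.
Lemma gproj_id v : v \in gspan -> gproj v = v.
Proof. by move=> /gspanP[c ->]; rewrite gprojE gsumK. Qed.
Lemma gprojK v : gproj (gproj v) = gproj v.
Proof. exact/gproj_id/gproj_in. Qed.
Lemma gcoef_proj g v : gcoef g (gproj v) = gcoef g v.
Proof. by rewrite !gcoefE gprojE gsumK. Qed.

(** Any finite set that contains the support may be used: this lets the supports of several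
    elements be merged. *)
Lemma gspan_sum v : v \in gspan -> exists F : {fset G}, forall F' : {fset G}, (F `<=` F')%fset ->
  v = \sum_(g <- F') gcoef g v *: val g.
Proof.
move=> /gproj_id <-; exists (msupp (gcoord v)) => F' sub.
under eq_bigr do rewrite gcoef_proj gcoefE; rewrite gprojE; exact: lincombEw.
Qed.

Lemma gcoef_eq0 v : v \in gspan -> (forall g, gcoef g v = 0) -> v = 0.
Proof.
move=> Sv v0; have [F /(_ F (fsubset_refl _)) ->] := gspan_sum Sv; apply: big1 => g _.
by rewrite v0 scale0r.
Qed.

End GroupLikes.
Arguments gspan {k H}.
Arguments gproj {k H}.
Arguments gcoef {k H} g.
Arguments gcoord {k H}.

(** * The Taft-Wilson theorem in degree one *)

Section TaftWilson.
Variables (k : fieldType) (H : hopfAlgType k).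
Local Notation G := (grouplike H).
Hypothesis Hp : pointed H.

(** A simple subcoalgebra of dimension one is spanned by some d with Delta(d) = l (d (x) d), and
    then l d is group-like. *)
Lemma coradical_gspan v : (v \in coradical H) = (v \in @gspan k H).
Proof.
apply/idP/idP; last first.
  apply: (gspan_ind (P := fun v => v \in coradical H)) => [g||c x y]; first 1 last.
  - exact: rpred0.
  - exact: rpredP.
  apply: mem_span.
  have [D DP] : {D : submodClosed H | forall v, v \in D <-> exists c, v = c *: val g}.
    apply: mksubmod => [|c _ _ [d ->] [e ->]]; first by exists 0; rewrite scale0r.
    by exists (c * d + e); rewrite scalerDl scalerA.
  have Dg : val g \in D by apply/DP; exists 1; rewrite scale1r.
  exists D => //; split.
  - move=> _ /DP[c ->]; rewrite linearZ /= glD -tensorZl; apply: mem_span.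
    by exists (c *: val g), (val g); split=> //; split=> //; apply/DP; exists c.
  - by exists (val g) => //; exact: gl_neq0.
  move=> E _ ED [e Ee e0] _ /DP[c ->]; have [d ed] := (DP e).1 (ED _ Ee).
  have d0 : d != 0 by apply: contra_neq e0 => d0; rewrite ed d0 scale0r.
  have -> : val g = d^-1 *: e by rewrite ed scalerA mulVf // scale1r.
  by rewrite scalerA; apply: rpredZ.
apply: (span_ind (P := fun v => v \in @gspan k H)) => [c [D Ds Dc]||c x y]; first 1 last.
- exact: rpred0.
- exact: rpredP.
have [b bb] := Hp Ds; case: Ds => [Dsub [d Dd d0] _].
pose b0 : H := val (b ord0).
have Db v' : v' \in D -> exists c, v' = c *: b0.
  move=> Dv; have [i _ ib] := bb; pose w : submod D := Sub v' Dv.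
  exists ((i w)@_ord0); rewrite -[v']/(val w) -{1}(ib w).
  rewrite (lincombEw b (d := [fset ord0]%fset)) ?big_seq_fset1 //.
  by apply/fsubsetP => j _; rewrite inE ord1.
have Db0 : b0 \in D by exact: valP.
have [l lb] : exists l, comul b0 = l *: (b0 \ox b0).
  apply: (span_ind (P := fun t => exists l, t = l *: (b0 \ox b0))) (Dsub _ Db0).
  - by move=> _ [u [w [[/Db[e ->] /Db[f ->]] ->]]]; exists (e * f);
    rewrite tensorZl tensorZr scalerA.
  - by exists 0; rewrite scale0r.
  - by move=> e _ _ [l ->] [m ->]; exists (e * l + m); rewrite scalerDl scalerA.
(* The counit axiom reads counit(b0) l b0 = b0. *)
have b0E : l * counit b0 = 1.
  have b0n : b0 != 0.
    by apply: contra_neq d0 => b00; have [e ->] := Db _ Dd; rewrite b00 scaler0.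
  have : ctl counit (comul b0) = b0 := comul1l b0.
  rewrite lb linearZ /= ctlE scalerA => /eqP; rewrite -subr_eq0 -[X in _ - X]scale1r -scalerBl.
  by rewrite scaler_eq0 (negPf b0n) orbF subr_eq0 => /eqP.
have gl : l *: b0 \in @is_grouplike k H.
  apply/is_grouplikeP; rewrite !linearZ /= lb.
  by rewrite tensorZl tensorZr !scalerA.
have l0 : l != 0 by apply: contra_eq_neq b0E => ->; rewrite mul0r eq_sym oner_eq0.
have [e ->] := Db _ Dc.
have -> : e *: b0 = (e / l) *: (l *: b0) by rewrite scalerA divfK.
by apply/rpredZ/mem_span.
Qed.


Lemma ctl_comul_proj (g : G) (v : H) : ctl (gcoef g) (comul (gproj v)) = gcoef g v *: val g.
Proof.
rewrite -gcoef_proj; apply: (@gspan_ind k H (fun w : H =>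
  ctl (gcoef g) (comul w) = gcoef g w *: val g)) (gproj_in v) => [h||c x y IHx IHy].
- by rewrite glD ctlE gcoef_val; case: eqP => [->|_] //; rewrite !scale0r.
- by rewrite !linear0 scale0r.
- by rewrite linearP /= linearP ctlP IHx IHy scalerDl scalerA.
Qed.
Lemma ctr_comul_proj (g : G) (v : H) : ctr (gcoef g) (comul (gproj v)) = gcoef g v *: val g.
Proof.
rewrite -gcoef_proj; apply: (@gspan_ind k H (fun w : H =>
  ctr (gcoef g) (comul w) = gcoef g w *: val g)) (gproj_in v) => [h||c x y IHx IHy].
- by rewrite glD ctrE gcoef_val; case: eqP => [->|_] //; rewrite !scale0r.
- by rewrite !linear0 scale0r.
- by rewrite linearP /= linearP ctrP IHx IHy scalerDl scalerA.
Qed.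

Lemma counit_proj_sum (v : H) : exists F : {fset G}, forall F' : {fset G}, (F `<=` F')%fset ->
  counit (gproj v) = \sum_(g <- F') gcoef g v.
Proof.
have [F FP] := gspan_sum (gproj_in v); exists F => F' /FP ->.
rewrite linear_sum; apply: eq_bigr => g _.
by rewrite linearZ /= glE mulr1 gcoef_proj.
Qed.

Lemma ctr_counit_proj (V : lmodType k) (t : tensor V H) : exists F : {fset G},
  forall F' : {fset G}, (F `<=` F')%fset ->
  ctr counit (tmap idfun (@gproj k H) t) = \sum_(g <- F') ctr (gcoef g) t.
Proof.
elim/tensor_ind: t => [u v|c s t [F1 IHs] [F2 IHt]].
  have [F FP] := counit_proj_sum v; exists F => F' /FP e.
  rewrite tmapE ctrE [counit _]e scaler_suml; apply: eq_bigr => g _.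
  by rewrite ctrE.
exists (F1 `|` F2)%fset => F'; rewrite fsubUset => /andP[/IHs e1 /IHt e2].
rewrite tmapP ctrP e1 e2 scaler_sumr -big_split; apply: eq_bigr => g _.
by rewrite ctrP.
Qed.
Lemma ctl_counit_proj (V : lmodType k) (t : tensor H V) : exists F : {fset G},
  forall F' : {fset G}, (F `<=` F')%fset ->
  ctl counit (tmap (@gproj k H) idfun t) = \sum_(g <- F') ctl (gcoef g) t.
Proof.
elim/tensor_ind: t => [u v|c s t [F1 IHs] [F2 IHt]].
  have [F FP] := counit_proj_sum u; exists F => F' /FP e.
  rewrite tmapE ctlE [counit _]e scaler_suml; apply: eq_bigr => g _.
  by rewrite ctlE.
exists (F1 `|` F2)%fset => F'; rewrite fsubUset => /andP[/IHs e1 /IHt e2].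
rewrite tmapP ctlP e1 e2 scaler_sumr -big_split; apply: eq_bigr => g _.
by rewrite ctlP.
Qed.

Lemma ctr_comul_tproj (V : lmodType k) (h : G) (t : tensor V H) :
  tmap idfun (ctr (gcoef h)) (tmap idfun comul (tmap idfun gproj t)) =
  ctr (gcoef h) t \ox val h.
Proof.
elim/tensor_ind: t => [u v|c s t IHs IHt].
  by rewrite !tmapE /= ctr_comul_proj ctrE tensorZr tensorZl.
by rewrite !tmapP ctrP IHs IHt tensorDl tensorZl.
Qed.
Lemma ctl_comul_tproj (V : lmodType k) (g : G) (t : tensor H V) :
  tmap (ctl (gcoef g)) idfun (tmap comul idfun (tmap gproj idfun t)) =
  val g \ox ctl (gcoef g) t.
Proof.
elim/tensor_ind: t => [u v|c s t IHs IHt].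
  by rewrite !tmapE /= ctl_comul_proj ctlE tensorZr tensorZl.
by rewrite !tmapP ctlP IHs IHt tensorDr tensorZr.
Qed.

Definition skew (g h : G) (u : H) := comul u = u \ox val h + val g \ox u.

Definition skew_span := span (fun v : H => v \in @is_grouplike k H \/ exists g h, skew g h v).

(** Write r = sum_h w_h (x) h. Comparing the coefficients of the last leg h in the two sides of
    coassociativity at u gives Delta(w_h) = g (x) w_h + w_h (x) h, and the counit gives
    u = counit(u) g + sum_h w_h. *)
Lemma taft_wilson_coef (g : G) (u : H) (r : tensor H H) :
  comul u = val g \ox u + r -> tmap idfun gproj r = r -> u \in skew_span.
Proof.
move=> uE rE.
have w_skew h : skew g h (ctr (gcoef h) r).
  have rE' : r = (-1) *: (val g \ox u) + comul u by rewrite uE scaleN1r addrA addNr add0r.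
  have aE : tassoc (tmap comul idfun (comul u)) =
      val g \ox comul u + tmap idfun comul r.
    rewrite comulA {1}uE -[val g \ox u]scale1r tmapP scale1r tmapE.
    by [].
  rewrite /skew linear_ctr -ctr_tassoc.
  have -> : tassoc (tmap comul idfun r) = 1 *: (val g \ox r) + tmap idfun comul r.
    rewrite {1}rE' tmapP tassocP aE tmapE glD tassocE addrA; congr (_ + _).
    by rewrite scale1r rE' tensorDr tensorZr.
  by rewrite tmapP scale1r tmapE -{2}rE ctr_comul_tproj addrC.
have [F /(_ F (fsubset_refl _)) FP] := ctr_counit_proj r.
have -> : u = counit u *: val g + \sum_(h <- F) ctr (gcoef h) r.
  have cu : ctr counit (comul u) = u := comul1r u.
  by rewrite -FP rE -{1}cu uE -[val g \ox u]scale1r ctrP scale1r ctrE.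
apply: rpredP; first by apply: mem_span; left; exact: valP.
by apply: rpred_sum => h _; apply: mem_span; right; exists g, h.
Qed.

(** Split Delta(c) into a part with left leg in kG and a part whose left leg has no component in
    kG and whose right leg is in kG. The coordinate u_g of the first part along g satisfies the
    hypotheses of [taft_wilson_coef], and c is the sum of the u_g up to an element of kG. *)
Lemma taft_wilson c : c \in corad_filt H 1 -> c \in skew_span.
Proof.
move=> Hc; pose e := (fun v : H => v - gproj v).
have el : linear e by move=> a x y; rewrite /e linearP scalerBr opprD addrACA.
pose E' : {linear H -> H} := mklin el; set t := comul c.
have tE : t = 1 *: tmap gproj idfun t + tmap E' gproj t.
  move: Hc; apply: (span_ind (P := fun t : tensor H H =>
    t = 1 *: tmap gproj idfun t + tmap E' gproj t)).
  - move=> _ [u [v [uv ->]]]; rewrite scale1r !tmapE /= /e.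
    case: uv => /=; rewrite coradical_gspan => /gproj_id ->.
      by rewrite subrr tensor0l addr0.
    by rewrite -tensorDl addrC subrK.
  - by rewrite !linear0 addr0.
  - by move=> a s s' es es'; rewrite {1}es {1}es' !tmapP !scale1r scalerDr addrACA.
have uS (g : G) : ctl (gcoef g) t \in skew_span.
  apply: (@taft_wilson_coef g _
    (tmap (ctl (gcoef g)) idfun (tmap comul idfun (tmap E' gproj t)))).
    rewrite linear_ctl -comulA ctl_tassoc -/t [in LHS]tE 2!tmapP scale1r.
    by rewrite ctl_comul_tproj.
  elim/tensor_ind: t {tE} => [u v|a s s' es es']; last by rewrite !tmapP es es'.
  by rewrite !tmapE gprojK.
have cE : ctl counit t = c := comul1l c.
rewrite -cE tE ctlP scale1r; apply: rpredD.
  have [F /(_ F (fsubset_refl _)) ->] := ctl_counit_proj t.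
  exact: rpred_sum.
have : ctl counit (tmap E' gproj t) \in gspan.
  elim/tensor_ind: t {tE uS cE} => [u v|a s s' es es']; last first.
    by rewrite tmapP ctlP; apply: rpredP.
  by rewrite tmapE ctlE; apply/rpredZ/gproj_in.
apply: (gspan_ind (P := fun v => v \in skew_span)) => [g||a x y]; first 1 last.
- exact: rpred0.
- exact: rpredP.
by apply: mem_span; left; exact: valP.
Qed.

End TaftWilson.

(** * Skew primitive elements *)

Section SkewPrimitive.
Variables (k : fieldType) (H : hopfAlgType k).
Local Notation G := (grouplike H).
Implicit Types (c : k) (a b g h : G) (u v w x y : H).

(** With this order of the legs, the variable of a Hopf-Ore extension is (a,1)-primitive. *)
Definition sprim b u := comul u = u \ox val b + 1 \ox u.

Lemma comul_gl g u : comul (val g * u) = tmul (val g \ox val g) (comul u).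
Proof. by rewrite comulM glD. Qed.
Lemma comul_glr g u : comul (u * val g) = tmul (comul u) (val g \ox val g).
Proof. by rewrite comulM glD. Qed.

Lemma gcoef_one g : gcoef g 1 = (1%g == g)%:R.
Proof. exact: (gcoef_val g 1%g). Qed.

Lemma gl_mulKr g u : val g * (val (g^-1)%g * u) = u.
Proof. by rewrite mulrA glKV mul1r. Qed.
Lemma gl_mulVKr g u : val (g^-1)%g * (val g * u) = u.
Proof. by rewrite mulrA glVK mul1r. Qed.

Lemma skew_sprim g h u : skew g h u -> sprim (g^-1 * h)%g (val (g^-1)%g * u).
Proof.
rewrite /skew /sprim comul_gl => ->.
by rewrite tmulDr !tmulE glVK.
Qed.

Lemma sprim_counit b u : sprim b u -> counit u = 0.
Proof.
move=> bu; have : ctl counit (comul u) = u := comul1l u.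
rewrite bu linearD /= !ctlE counit_one scale1r => /eqP.
rewrite -subr_eq0 addrK scaler_eq0 (negPf (gl_neq0 b)) orbF; exact/eqP.
Qed.

Lemma sprimP b c u v : sprim b u -> sprim b v -> sprim b (c *: u + v).
Proof.
rewrite /sprim linearP => -> ->.
by rewrite tensorDl tensorDr tensorZl tensorZr scalerDr addrACA.
Qed.

Lemma sprim_1B b : sprim b (1 - val b).
Proof.
rewrite /sprim linearB /= comul_one glD tensorDl tensorDr tensorNl tensorNr.
by rewrite [RHS]addrC addrA subrK.
Qed.

Lemma gcompl_exists : exists E : {linear H -> H}, forall u, E u = u - gproj u.
Proof.
have el : linear (fun h : H => h - gproj h).
  by move=> c x y; rewrite linearP scalerBr opprD addrACA.
by exists (mklin el).
Qed.
Definition gcompl : {linear H -> H} := projT1 (cid gcompl_exists).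
Lemma gcomplE u : gcompl u = u - gproj u.
Proof. exact: (projT2 (cid gcompl_exists)). Qed.
Lemma gcompl_eq0 u : gcompl u = 0 <-> u \in gspan.
Proof.
rewrite gcomplE; split=> [/eqP|/gproj_id -> //]; last by rewrite subrr.
by rewrite subr_eq0 => /eqP ->; exact: gproj_in.
Qed.

Lemma gspan_gl g u : val g * u \in gspan -> u \in gspan.
Proof. by move=> gu; rewrite -(gl_mulVKr g u); apply: gspanM => //; exact: gspan_val. Qed.

Variables (a : G) (x : H).
Hypotheses (xa : sprim a x) (xH0 : x \notin gspan).

Lemma gcompl_glx g : gcompl (val g * x) != 0.
Proof. by apply: contra xH0 => /eqP/gcompl_eq0; exact: gspan_gl. Qed.

Lemma comul_gspan_mulx w : comul (w * x) =
  tmul (comul w) (x \ox val a + 1 \ox x).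
Proof. by rewrite comulM xa. Qed.

Lemma ctl_comul_gspan g v : v \in gspan -> ctl (gcoef g) (comul v) = gcoef g v *: val g.
Proof. by move=> /gproj_id ve; rewrite -{1}ve ctl_comul_proj. Qed.

(** The component of Delta(v + w x) with left leg in kG and right leg outside kG comes only
    from the terms w_g (g (x) g x), which isolates the coefficient w_g. *)
Lemma leg_coef g v w : v \in gspan -> w \in gspan ->
  ctl (gcoef g) (tmap gproj gcompl (comul (v + w * x))) = gcoef g w *: gcompl (val g * x).
Proof.
move=> Sv Sw; rewrite linearD /= comul_gspan_mulx linearD linearD /=.
have -> : tmap gproj gcompl (comul v) = 0.
  apply: (gspan_ind (P := fun v : H => tmap gproj gcompl (comul v) = 0)) Sv => [h||c s t IHs IHt].
  - by rewrite glD tmapE ((gcompl_eq0 _).2 (gspan_val h)) tensor0r.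
  - by rewrite !linear0.
  - by rewrite linearP tmapP IHs IHt scaler0 addr0.
rewrite linear0 add0r.
apply: (gspan_ind (P := fun w : H =>
  ctl (gcoef g) (tmap gproj gcompl (tmul (comul w) (x \ox val a + 1 \ox x))) = gcoef g w *: gcompl (val g * x))) Sw => [h||c s t IHs IHt].
- rewrite glD tmulDr !tmulE linearD /= !tmapE mulr1.
  rewrite ((gcompl_eq0 _).2 (gspanM (gspan_val h) (gspan_val a))) tensor0r add0r.
  rewrite ctlE gcoef_proj gcoef_val; case: eqP => [->|] //; by rewrite !scale0r.
- by rewrite !linear0 tmul0l !linear0 scale0r.
- by rewrite comulP tmulPl tmapP ctlP IHs IHt linearP scalerDl scalerA.
Qed.

Lemma gspan_mulx_eq0 v w : v \in gspan -> w \in gspan -> v + w * x = 0 -> w = 0.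
Proof.
move=> Sv Sw vw0; apply: gcoef_eq0 => // g.
have := leg_coef g Sv Sw; rewrite vw0 !linear0 => /esym/eqP.
by rewrite scaler_eq0 (negPf (gcompl_glx g)) orbF => /eqP.
Qed.

Lemma sprim_gspan b v : v \in gspan -> sprim b v -> exists c, v = c *: (1 - val b).
Proof.
move=> Sv bv; have := ctl_comul_gspan 1%g Sv; rewrite bv linearD /= !ctlE.
rewrite gcoef_one eqxx scale1r => e; exists (gcoef 1%g v).
by rewrite scalerBr; apply/eqP; rewrite eq_sym subr_eq addrC; apply/eqP.
Qed.

(** For u = v + w x that is (b,1)-primitive, the component of Delta(u) with left leg in kG is
    concentrated at 1, so w is a scalar; comparing right legs in the component with left leg
    outside kG gives a = b when this scalar is nonzero. What remains is (b,1)-primitive in kG,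
    hence a multiple of 1 - b. *)
Lemma sprim_form b v w : v \in gspan -> w \in gspan -> sprim b (v + w * x) ->
  exists c d, v + w * x = c *: x + d *: (1 - val b) /\ (c != 0 -> b = a).
Proof.
move=> Sv Sw bu; set u := v + w * x in bu *; pose c := gcoef 1%g w.
have wE : w = c *: 1.
  apply/eqP; rewrite -subr_eq0; apply/eqP/gcoef_eq0 => [|g].
    by apply: submodB => //; apply/rpredZ/gspan1.
  rewrite linearB linearZ /= gcoef_one.
  case: eqP => [<-|/eqP g1]; first by rewrite mulr1 subrr.
  have := leg_coef g Sv Sw; rewrite -/u bu linearD /= !tmapE.
  rewrite ((gcompl_eq0 _).2 (gspan_val b)) tensor0r add0r ctlE gcoef_proj.
  rewrite gcoef_one (negPf g1) scale0r => /esym/eqP.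
  by rewrite scaler_eq0 (negPf (gcompl_glx g)) orbF => /eqP ->; rewrite mulr0 subrr.
have uE : u = c *: x + v by rewrite /u {1}wE -scalerAl mul1r addrC.
have cab : c != 0 -> b = a.
  move=> c0; have := congr1 (ctr (gcoef a)) (congr1 (tmap gcompl gproj) bu).
  have gv : tmap gcompl gproj (comul v) = 0.
    apply: (gspan_ind (P := fun v : H => tmap gcompl gproj (comul v) = 0)) Sv => [h||e s t IHs IHt].
    - by rewrite glD tmapE ((gcompl_eq0 _).2 (gspan_val h)) tensor0l.
    - by rewrite !linear0.
    - by rewrite linearP tmapP IHs IHt scaler0 addr0.
  have c1 : gcompl 1 = 0 by apply/gcompl_eq0/gspan1.
  have gx : gcompl u = c *: gcompl x by rewrite uE linearP ((gcompl_eq0 v).2 Sv) addr0.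
  have tx y b' : comul y = y \ox val b' + 1 \ox y ->
      tmap gcompl gproj (comul y) = gcompl y \ox gproj (val b').
    by move=> ->; rewrite linearD /= !tmapE c1 tensor0l addr0.
  rewrite {1}uE comulP tmapP gv addr0 (tx _ _ xa) -bu (tx _ _ bu) gx linearZ /= !ctrE.
  rewrite !gcoef_proj !gcoef_val eqxx scale1r.
  case: eqP => // _; rewrite scale0r => /eqP; rewrite scaler_eq0 (negPf c0) /=.
  by have := gcompl_glx 1%g; rewrite mul1r => /negPf ->.
have bv : sprim b v.
  have -> : v = (- c) *: x + u by rewrite uE scaleNr addrA addNr add0r.
  have [->|c0] := eqVneq c 0; first by rewrite oppr0 scale0r add0r.
  by apply: sprimP => //; rewrite cab.
have [d vE] := sprim_gspan Sv bv.
by exists c, d; rewrite uE {1}vE.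
Qed.

End SkewPrimitive.

(** * The single variable of a Hopf algebra of rank one *)

Section RankOne.
Variables (k : fieldType) (H : hopfAlgType k).
Local Notation G := (grouplike H).
Implicit Types (c d : k) (a b g h : G) (u v w x y : H).
Hypothesis Hp : pointed H.
Local Notation H1 := (submod (corad_filt H 1)).
Local Notation Q := (quotmod (span (@balanced_rel k H))).

Lemma sprim_corad b u : sprim b u -> u \in corad_filt H 1.
Proof.
move=> bu; rewrite unfold_in bu.
by apply: rpredD; apply: mem_span; [exists u, (val b)|exists 1, u]; split=> //;
  [right|left]; rewrite (coradical_gspan Hp) ?gspan1 ?gspan_val.
Qed.

Lemma gspan_corad v : v \in gspan -> v \in corad_filt H 1.
Proof.
apply: (gspan_ind (P := fun v => v \in corad_filt H 1)) => [g||c s t].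
- rewrite unfold_in glD; apply: mem_span; exists (val g), (val g); split=> //.
  by left; rewrite (coradical_gspan Hp) gspan_val.
- exact: rpred0.
- exact: rpredP.
Qed.

Lemma gl_sprim_corad g b u : sprim b u -> val g * u \in corad_filt H 1.
Proof.
move=> bu; rewrite unfold_in comul_gl bu tmulDr !tmulE mulr1.
apply: rpredD; apply: mem_span;
  [exists (val g * u), (val g * val b)|exists (val g), (val g * u)]; split=> //;
  [right|left]; rewrite (coradical_gspan Hp); first exact: (gspanM (gspan_val g) (gspan_val b)).
exact: gspan_val.
Qed.

(** H_1 is spanned by the g and the g u with u skew primitive: a (g,h)-primitive element is
    g times a (g^-1 h,1)-primitive one. *)
Lemma corad1_ind (P : H -> Prop) : (forall g, P (val g)) ->
  (forall g b u, sprim b u -> P (val g * u)) ->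
  (forall c u v, P u -> P v -> P (c *: u + v)) ->
  forall v, v \in corad_filt H 1 -> P v.
Proof.
move=> Pg Ps PP v /(taft_wilson Hp); apply: (span_ind (P := P)) => //.
- move=> w [wg|[g [h wgh]]]; first exact: (Pg (Sub w wg)).
  rewrite -(gl_mulKr g w); apply: Ps; exact: skew_sprim wgh.
- by have := PP (-1) _ _ (Pg 1%g) (Pg 1%g); rewrite scaleN1r addNr.
Qed.

(** The class of c in the tensor product over H_0 of the trivial module k with H_1. *)
Let cls (c : H1) : Q := qproj (span (@balanced_rel k H)) ((1 : k^o) \ox c).
Let clsP c (s t : H1) : cls (c *: s + t) = c *: cls s + cls t.
Proof. by rewrite /cls tensorDr tensorZr linearP. Qed.

Let cls0 : cls 0 = 0.
Proof. by rewrite /cls tensor0r linear0. Qed.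
Let clsZ c (s : H1) : cls (c *: s) = c *: cls s.
Proof. by rewrite -[c *: s]addr0 clsP cls0 addr0. Qed.

(** Contraction of the right leg with F kills the balancing relations. *)
Let cls_kernel (F : {scalar H}) :
  (forall u v, u \in gspan -> v \in corad_filt H 1 -> F (u * v) = counit u * F v) ->
  forall s : H1, cls s = 0 -> F (val s) = 0.
Proof.
move=> Finv s s0.
have fl : scalar (fun s : H1 => F (val s)) by move=> c u v; rewrite /= linearP.
pose f := mkscalar fl.
have : (1 : k^o) \ox s \in span (@balanced_rel k H).
  by rewrite -[_ \ox _]subr0; apply/qprojP; rewrite linear0 -[LHS]/(cls s) s0.
move=> s1; have : ctr f ((1 : k^o) \ox s) = 0.
  apply: (span_ind (P := fun t => ctr f t = 0)) s1 => [_ [c [h [u [hu [hH huE ->]]]]]||c u v u0 v0].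
  - rewrite linearB /= !ctrE /= huE Finv; last exact: valP.
      apply/eqP; rewrite subr_eq0; apply/eqP.
      rewrite -[LHS]/(F (val u) * (c * counit h)) -[RHS]/(counit h * F (val u) * c).
      by rewrite [c * _]mulrC mulrA [_ * counit h]mulrC.
    by rewrite -(coradical_gspan Hp).
  - exact: linear0.
  - by rewrite ctrP u0 v0 scaler0 addr0.
by rewrite ctrE /= -[_ *: _]/(_ * _) mulr1.
Qed.

Let cls_gl g (s t : H1) : val t = val g * val s -> cls t = cls s.
Proof.
move=> ts; apply/esym/qprojP/mem_span; exists 1, (val g), s, t; split=> //.
  by rewrite [_ \in _](coradical_gspan Hp) gspan_val.
by rewrite glE mulr1.
Qed.

Let cls_surj (q : Q) : exists s, q = cls s.
Proof.
elim/qind: q; elim/tensor_ind => [c s|c s t [s' es] [t' et]].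
  by exists (c *: s); rewrite /cls tensorZr -tensorZl -[_ *: _]/(c * 1) mulr1.
by exists (c *: s' + t'); rewrite clsP -es -et; exact: linearP.
Qed.

Let one1 : H1 := Sub 1 (gspan_corad (gspan1 H)).

Let counit_kernel (s : H1) : cls s = 0 -> counit (val s) = 0.
Proof. by apply: cls_kernel => h c _ _; rewrite counitM. Qed.

Hypothesis Hr : has_rank H 1.

(** Otherwise all classes of skew primitive elements, and hence all classes, would lie on the
    line spanned by the class of 1, which is too small for dimension two. *)
Lemma skew_generator_exists : exists a (x : H) (s : H1),
  [/\ sprim a x, val s = x & forall c, cls s <> c *: cls one1].
Proof.
case: Hr => _ _ [b bb].
have [q qn] := @basis_not_line _ _ _ b ord0 ord_max (cls one1) isT bb.
apply: contrapT => nx; have [s qs] := cls_surj q.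
have : exists2 t : H1, val t = val s & exists c, cls t = c *: cls one1.
  apply: (corad1_ind (P := fun v => exists2 t : H1, val t = v & exists c, cls t = c *: cls one1))
    (valP s) => [g|g a u au|c u v [t <- [d td]] [t' <- [d' td']]].
  - pose t : H1 := Sub (val g) (gspan_corad (gspan_val g)).
    exists t => //; exists 1; rewrite scale1r; apply: (cls_gl (g := g)).
    by rewrite /= mulr1.
  - pose t : H1 := Sub (val g * u) (gl_sprim_corad g au).
    pose t' : H1 := Sub u (sprim_corad au).
    exists t => //; rewrite (@cls_gl g t' t) //; apply: contrapT => nc; apply: nx.
    by exists a, u, t'; split=> // c cE; apply: nc; exists c.
  - by exists (c *: t + t') => //; exists (c * d + d'); rewrite clsP td td' scalerA scalerDl.
move=> [t /val_inj -> [c tc]]; exact: (qn c (etrans qs tc)).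
Qed.

Variables (a : G) (x : H) (xs : H1).
Hypotheses (xa : sprim a x) (xsE : val xs = x) (xs1 : forall c, cls xs <> c *: cls one1).

Lemma generator_notin_gspan : x \notin gspan.
Proof.
apply/negP => xH0; suff : exists2 t : H1, val t = x & exists c, cls t = c *: cls one1.
  move=> [t tx [c tc]]; apply: (xs1 (c := c)); rewrite -tc.
  by congr cls; apply: val_inj; rewrite tx.
apply: (gspan_ind (P := fun v => exists2 t : H1, val t = v & exists c, cls t = c *: cls one1))
  xH0 => [g||c u v [t <- [d td]] [t' <- [d' td']]].
- pose t : H1 := Sub (val g) (gspan_corad (gspan_val g)).
  exists t => //; exists 1; rewrite scale1r; apply: (cls_gl (g := g)).
  by rewrite /= mulr1.
- by exists 0 => //; exists 0; rewrite scale0r cls0.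
- by exists (c *: t + t') => //; exists (c * d + d'); rewrite clsP td td' scalerA scalerDl.
Qed.

(** If u is not in kG + kG x, let f be a functional that kills kG + kG x with f(u) = 1. The
    functional F(c) = f(S(E c_1) c_2), with E a projection onto kG, satisfies F(g y) = f(y) for
    y skew primitive, since Delta(g y) = g y (x) g b + g (x) g y and the first term contributes
    an element of kG. So F, together with the counit, separates the classes of 1, x and u, and
    these three vectors of a space of dimension two would be independent. *)
Lemma sprim_decomp b u : sprim b u ->
  exists v w, [/\ v \in gspan, w \in gspan & u = v + w * x].
Proof.
move=> bu; have [S SP] : {S : submodClosed H | forall u, u \in S <->
    exists v w, [/\ v \in gspan, w \in gspan & u = v + w * x]}.
  apply: mksubmod => [|c _ _ [v [w [Sv Sw ->]]] [v' [w' [Sv' Sw' ->]]]].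
    by exists 0, 0; rewrite mul0r addr0 rpred0.
  exists (c *: v + v'), (c *: w + w'); rewrite !rpredP //; split=> //.
  by rewrite scalerDr mulrDl scalerAl addrACA.
apply/SP; apply: contraT => /separation[f [fS fu]].
have fg v : v \in gspan -> f v = 0.
  by move=> Sv; apply/fS/SP; exists v, 0; rewrite mul0r addr0 rpred0.
have fx : f x = 0 by apply/fS/SP; exists 0, 1; rewrite mul1r add0r rpred0 gspan1.
pose m := fun y z : H => antipode (gproj y) * z.
have mb : bilinear_for *:%R *:%R m.
  by split=> [z|y] c s t; rewrite /m ?linearP ?mulrDl ?mulrDr -?scalerAl -?scalerAr.
have Fl : scalar (fun c : H => f (tlift m (comul c))).
  by move=> c s t; rewrite comulP (tliftP mb) linearP.
pose F := mkscalar Fl.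
have Fg g : F (val g) = 0.
  rewrite /= glD (tliftE mb) /m gproj_id ?gspan_val // grouplikeV.
  exact/fg/gspan1.
have Fs g b' y : sprim b' y -> F (val g * y) = f y.
  move=> b'y; rewrite /= comul_gl b'y tmulDr !tmulE mulr1.
  rewrite (tliftD mb) !(tliftE mb) linearD /= [X in X + _]fg ?add0r.
    by rewrite /m gproj_id ?gspan_val // mulrA grouplikeV mul1r.
  rewrite /m; apply: gspanM; last exact: (gspan_val (g * b')%g).
  apply: (gspan_ind (P := fun v => antipode v \in gspan)) (gproj_in (val g * y))
    => [h||c s t Ss St].
  - exact: (gspan_val (h^-1)%g).
  - by rewrite linear0 rpred0.
  - by rewrite linearP; apply: rpredP.
have Finv (h c : H) : h \in gspan -> c \in corad_filt H 1 -> F (h * c) = counit h * F c.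
  move=> hH cH; apply: (gspan_ind (P := fun h : H => F (h * c) = counit h * F c)) hH
    => [g||e s t es et].
  - rewrite glE mul1r; apply: (corad1_ind (P := fun c : H => F (val g * c) = F c)) cH =>
      [g'|g' b' y by'|e s t es et].
    + by rewrite Fg -[LHS]/(F (val (g * g')%g)) Fg.
    + by rewrite mulrA (Fs g' _ _ by') -[val g * val g']/(val (g * g')%g) (Fs _ _ _ by').
    + by rewrite mulrDr -scalerAr !(linearP F) es et.
  - by rewrite mul0r !linear0 mul0r.
  - by rewrite mulrDl -scalerAl !(linearP F) es et (linearP counit) mulrDl mulrA.
have Fker := cls_kernel Finv.
pose us : H1 := Sub u (sprim_corad bu).
case: Hr => _ _ /(has_dim2_dependent (cls one1) (cls xs) (cls us))[e0 [e1 [e2 []]]].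
rewrite -(clsZ e2) -!clsP; set t := (_ + _) => t0; case.
have tE : val t = e0 *: 1 + (e1 *: x + e2 *: u) by rewrite -xsE.
have F1 : F 1 = 0 := Fg 1%g.
have Fx : F x = 0 by rewrite -[x]mul1r (Fs 1%g _ _ xa).
have Fu : F u = 1 by rewrite -[u]mul1r (Fs 1%g _ _ bu).
have e00 : e0 = 0.
  have := counit_kernel t0; rewrite tE !scalarP scalarZ counit_one.
  by rewrite (sprim_counit bu) (sprim_counit xa) !mulr0 !addr0 mulr1.
have e20 : e2 = 0.
  have := Fker _ t0; rewrite tE !scalarP scalarZ F1 Fx Fu.
  by rewrite !mulr0 !add0r mulr1.
have e10 : e1 = 0.
  apply/eqP; apply: contraT => e1n.
  have := xs1 (c := 0); rewrite scale0r; case.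
  have -> : xs = e1^-1 *: t.
    by rewrite /t e00 e20 !scale0r add0r addr0 scalerA mulVf // scale1r.
  by rewrite clsZ t0 scaler0.
by [].
Qed.

End RankOne.

(** * The commutation rule and its normalization *)

Section Structure.
Variables (k : fieldType) (H : hopfAlgType k).
Local Notation G := (grouplike H).
Implicit Types (c d s : k) (a b g h : G) (u v w x y : H).

Record rank_one_var a x : Prop := RankOneVar {
  rv_sprim : sprim a x;
  rv_notin : x \notin gspan;
  rv_form : forall b u, sprim b u ->
    exists c d, u = c *: x + d *: (1 - val b) /\ (c != 0 -> b = a);
  rv_gen : forall B : subalgClosed H, (forall g, val g \in B) -> x \in B -> forall u, u \in B
}.

(** For a = 1 the commutation rule does not determine alpha; the last condition then makes it
    zero, which guarantees the cocycle identity. *)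
Record ore_rel a x (chi alpha : G -> k) : Prop := OreRel {
  or_central : forall g, commute a g;
  or_chi0 : forall g, chi g != 0;
  or_chiM : forall g h, chi (g * h)%g = chi g * chi h;
  or_alphaM : forall g h, alpha (g * h)%g = alpha g + chi g * alpha h;
  or_comm : forall g, x * val g = chi g *: (val g * x) + alpha g *: (val g * (1 - val a));
  or_alpha0 : a = 1%g -> forall g, alpha g = 0
}.

Lemma rank_one_var_exists : pointed H -> has_rank H 1 -> exists a x, rank_one_var a x.
Proof.
move=> Hp Hr; have [a [x [s [ax sx sn]]]] := skew_generator_exists Hp Hr.
have xH0 := generator_notin_gspan sx sn.
exists a, x; split=> // [b u bu|B Bg Bx].
  have [v [w [Sv Sw uE]]] := sprim_decomp Hr ax sx sn bu.
  by rewrite uE in bu *; apply: sprim_form bu.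
have [_ gen _] := Hr; apply: gen; apply: (corad1_ind Hp) => [g|g b u bu|c u v].
- exact: Bg.
- have [v [w [Sv Sw ->]]] := sprim_decomp Hr ax sx sn bu.
  have BS y : y \in gspan -> y \in B.
    apply: (gspan_ind (P := fun y => y \in B)) => [h||c y' z By Bz]; rewrite ?rpred0 //.
    by apply: rpredD => //; apply: rpredZ.
  by apply: rpredM => //; apply: rpredD; [exact: BS|apply: rpredM => //; exact: BS].
- by move=> Bu Bv; apply: rpredD => //; apply: rpredZ.
Qed.

Lemma sprim_conj a x g : sprim a x -> sprim (g^-1 * a * g)%g (val (g^-1)%g * x * val g).
Proof.
rewrite /sprim comul_glr comul_gl => ->.
by rewrite tmulDr tmulDl !tmulE mulr1 glVK.
Qed.

(** Since g^-1 x g is (g^-1 a g,1)-primitive, [rv_form] expresses it as chi(g) x plus a multiple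
    of 1 - g^-1 a g. Here chi(g) is nonzero because x is not in kG, and this forces
    g^-1 a g = a. Comparing the two ways of moving x across g h gives the character and cocycle
    identities. *)
Lemma ore_rel_exists a x : rank_one_var a x -> exists chi alpha, ore_rel a x chi alpha.
Proof.
move=> [xa xH0 xform _].
have /choice[f fP] g : exists p : k * k,
    [/\ x * val g = p.1 *: (val g * x) + p.2 *: (val g * (1 - val a)), p.1 != 0,
      commute a g & a = 1%g -> p.2 = 0].
  have [c [d [e ca]]] := xform _ _ (sprim_conj g xa).
  have c0 : c != 0.
    apply: contra xH0 => /eqP c0; rewrite c0 scale0r add0r in e.
    have -> : x = val g * (val (g^-1)%g * x * val g) * val (g^-1)%g.
      by rewrite -!mulrA glKV mulr1 gl_mulKr.
    rewrite e; apply: gspanM (gspan_val _); apply: (gspanM (gspan_val _)); apply: rpredZ.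
    by apply: submodB; rewrite ?gspan1 ?gspan_val.
  have cag : commute a g.
    rewrite /commute -[in RHS](ca c0) -!mulgA mulVKg //.
  have gag : (g^-1 * a * g)%g = a by rewrite ca.
  rewrite gag in e.
  have xg : x * val g = c *: (val g * x) + d *: (val g * (1 - val a)).
    by rewrite -[LHS](gl_mulKr g) [_ * (x * _)]mulrA e mulrDr !scalerAr.
  have [a1|a1] := pselect (a = 1%g); last by exists (c, d).
  exists (c, 0); split=> //=; rewrite xg a1; congr (_ + _).
  by rewrite subrr mulr0 !scaler0.
pose chi g := (f g).1; pose alpha g := (f g).2.
have fM g h : chi (g * h)%g *: x + alpha (g * h)%g *: (1 - val a) =
    (chi g * chi h) *: x + (alpha g + chi g * alpha h) *: (1 - val a).
  have gu z : val (g * h)%g * z = 0 -> z = 0.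
    by move=> e; rewrite -(gl_mulVKr (g * h)%g z) e mulr0.
  apply/eqP; rewrite -subr_eq0; apply/eqP/gu; apply/eqP.
  have [e _ _ _] := fP (g * h)%g; have [eg _ _ _] := fP g; have [eh _ _ _] := fP h.
  rewrite -/(chi _) -/(alpha _) in e eg eh.
  rewrite mulrBr subr_eq0 !mulrDr -!scalerAr -e.
  rewrite -[val (g * h)%g]/(val g * val h) mulrA eg.
  have aC : (1 - val a) * val h = val h * (1 - val a).
    have [_ _ ah _] := fP h.
    by rewrite mulrBl mulrBr mul1r mulr1 -[val a * val h]/(val (a * h)%g) ah.
  rewrite mulrDl -!scalerAl -!mulrA eh aC mulrDr -!scalerAr scalerDr !scalerA.
  by rewrite -addrA -scalerDl [alpha g + _]addrC.
have inj c d c' d' : c *: x + d *: (1 - val a) = c' *: x + d' *: (1 - val a) ->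
    c = c' /\ (a <> 1%g -> d = d').
  move=> /eqP; rewrite -subr_eq0 opprD addrACA -!scalerBl => /eqP e.
  have Sa c1 : c1 *: (1 - val a) \in gspan.
    by apply/rpredZ/submodB; rewrite ?gspan1 ?gspan_val.
  have cc : c = c'.
    apply/eqP; apply: contraNT xH0 => cc; rewrite -subr_eq0 in cc.
    have -> : x = (c - c')^-1 *: (- ((d - d') *: (1 - val a))).
      move/eqP: e; rewrite addr_eq0 => /eqP <-.
      by rewrite scalerA mulVf // scale1r.
    by apply: rpredZ; rewrite -scaleNr.
  split=> // a1; apply/eqP; rewrite -subr_eq0; move: e; rewrite cc subrr scale0r add0r.
  move=> /eqP; rewrite scaler_eq0 => /orP[// |a1'].
  by case: a1; apply: val_inj; apply/eqP; rewrite eq_sym -subr_eq0.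
exists chi, alpha; split=> [g|g|g h|g h|g|a1 g].
- by have [] := fP g.
- by have [] := fP g.
- by have [] := inj _ _ _ _ (fM g h).
- have [a1|a1] := pselect (a = 1%g); last by apply: (inj _ _ _ _ (fM g h)).2.
  have al0 g' : alpha g' = 0 by have [_ _ _] := fP g'; apply.
  by rewrite !al0 mulr0 addr0.
- by have [] := fP g.
- by have [_ _ _] := fP g; apply.
Qed.

Lemma rank_one_var_change a x s d : s != 0 -> rank_one_var a x ->
  rank_one_var a (s *: x + d *: (1 - val a)).
Proof.
move=> s0 [xa xH0 xform xgen]; set x' := _ + _.
have xE : x = s^-1 *: x' + (- (s^-1 * d)) *: (1 - val a).
  by rewrite /x' scalerDr !scalerA mulVf // scale1r scaleNr addrK.
have Sa c1 : c1 *: (1 - val a) \in gspan.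
  by apply/rpredZ/submodB; rewrite ?gspan1 ?gspan_val.
split.
- by apply: sprimP => //; rewrite -[_ *: _]addr0; apply: sprimP; [exact: sprim_1B|
    rewrite /sprim linear0 tensor0l tensor0r addr0].
- by apply: contra xH0 => x'H; rewrite xE; apply: rpredP.
- move=> b u /xform[c [e [-> ca]]].
  have [->|c0] := eqVneq c 0; first by exists 0, e; rewrite !scale0r eqxx.
  exists (c / s), (- (c * (s^-1 * d)) + e); split; last by move=> _; exact: ca.
  by rewrite {1}xE (ca c0) scalerDr !scalerA mulrN scalerDl addrA.
- move=> B Bg Bx'; apply: xgen => //; rewrite xE; apply: rpredD; first exact: rpredZ.
  apply: rpredZ; rewrite -scaleN1r; apply: rpredD; first exact: rpred1.
  exact/rpredZ/Bg.
Qed.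

(** The term d (1 - chi(g)) is the coboundary by which the cocycle of an affine change of
    variable differs from s alpha. *)
Lemma ore_rel_change a x chi alpha s d : (a = 1%g -> d = 0) -> ore_rel a x chi alpha ->
  ore_rel a (s *: x + d *: (1 - val a)) chi (fun g => s * alpha g + d * (1 - chi g)).
Proof.
move=> d0 [aC chi0 chiM alM xg al0]; split=> // [g h|g|a1 g].
- by rewrite alM chiM; ring.
- have aCg : (1 - val a) * val g = val g * (1 - val a).
    by rewrite mulrBl mulrBr mul1r mulr1 -[val a * val g]/(val (a * g)%g) aC.
  rewrite mulrDl -!scalerAl xg aCg [val g * (_ *: _ + _)]mulrDr -!scalerAr.
  rewrite !scalerDr !scalerA -!addrA.
  rewrite [chi g * s]mulrC; congr (_ + _).
  by rewrite -!scalerDl; congr (_ *: _); ring.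
- by rewrite al0 // d0 // mulr0 mul0r addr0.
Qed.

Lemma normalized_exists : pointed H -> has_rank H 1 ->
  exists a x chi alpha, [/\ rank_one_var a x, ore_rel a x chi alpha,
    chi a != 1 -> alpha a = 0 & chi a = 1 -> alpha a != 0 -> alpha a = 1].
Proof.
move=> Hp Hr; have [a [x xv]] := rank_one_var_exists Hp Hr.
have [chi [alpha xr]] := ore_rel_exists xv.
have [chi1|chi1] := eqVneq (chi a) 1.
  have [al0|al0] := eqVneq (alpha a) 0.
    by exists a, x, chi, alpha; split=> // _; rewrite al0 eqxx.
  exists a, ((alpha a)^-1 *: x + 0 *: (1 - val a)), chi,
    (fun g => (alpha a)^-1 * alpha g + 0 * (1 - chi g)); split.
  - by apply: rank_one_var_change; rewrite ?invr_eq0.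
  - exact: ore_rel_change.
  - by rewrite chi1 eqxx.
  - by rewrite mulVf // mul0r addr0.
have c10 : 1 - chi a != 0 by rewrite subr_eq0 eq_sym.
(* The solution of alpha(a) + d (1 - chi(a)) = 0. *)
pose d := - (alpha a / (1 - chi a)).
exists a, (1 *: x + d *: (1 - val a)), chi, (fun g => 1 * alpha g + d * (1 - chi g)); split.
- by apply: rank_one_var_change; rewrite ?oner_eq0.
- apply: ore_rel_change => // a1; exfalso; move/eqP: chi1; apply.
  have e : chi a * chi a = chi a * 1 by rewrite -(or_chiM xr) mulr1 a1 mulg1.
  exact: mulfI (or_chi0 xr a) _ _ e.
- by rewrite mul1r mulNr divfK // subrr.
- by move/eqP; rewrite (negPf chi1).
Qed.

End Structure.

(** * Falling powers and the q-binomial formula *)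

Section QNumbers.
Variables (k : fieldType) (q : k).

Definition qint n : k := \sum_(i < n) q ^+ i.
Lemma qint0 : qint 0 = 0. Proof. exact: big_ord0. Qed.
Lemma qint1 : qint 1 = 1. Proof. by rewrite /qint big_ord1. Qed.
Lemma qintS n : qint n.+1 = qint n + q ^+ n. Proof. exact: big_ord_recr. Qed.
Lemma qintD m n : qint (m + n) = qint m + q ^+ m * qint n.
Proof.
elim: n => [|n IH]; first by rewrite qint0 addn0 mulr0 addr0.
by rewrite addnS !qintS IH exprD; ring.
Qed.

Lemma qintSl n : qint n.+1 = 1 + q * qint n.
Proof. by rewrite -add1n qintD qint1 expr1. Qed.

(** Gaussian binomial coefficients through Pascal's rule: no division by q-factorials, so q may
    be a root of unity. *)
Fixpoint qbin n m : k :=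
  match n, m with
  | _, 0 => 1
  | 0, _.+1 => 0
  | n'.+1, m'.+1 => qbin n' m' + q ^+ m'.+1 * qbin n' m'.+1
  end.
Lemma qbin0 n : qbin n 0 = 1. Proof. by case: n. Qed.
Lemma qbinS n m : qbin n.+1 m.+1 = qbin n m + q ^+ m.+1 * qbin n m.+1. Proof. by []. Qed.
Lemma qbin_small n m : (n < m)%N -> qbin n m = 0.
Proof.
elim: n m => [|n IH] [|m] //; rewrite ltnS => nm.
by rewrite qbinS !IH ?mulr0 ?addr0 // ltnW.
Qed.
Lemma qbinn n : qbin n n = 1.
Proof. by elim: n => // n IH; rewrite qbinS IH qbin_small // mulr0 addr0. Qed.
Lemma qbin1 n : qbin n 1 = qint n.
Proof.
elim: n => [|n IH]; first by rewrite qint0.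
by rewrite qbinS qbin0 IH qintSl expr1.
Qed.
Lemma mul_qint_qbin n m : qint m.+1 * qbin n.+1 m.+1 = qint n.+1 * qbin n m.
Proof.
elim: n m => [|n IH] [|m].
- by rewrite qbinS qint1 qbin0 /=; ring.
- by rewrite qbin_small // [qbin 0 _]qbin_small // !mulr0.
- by rewrite qbin1 qint1 qbin0 mul1r mulr1.
rewrite [in LHS]qbinS mulrDr mulrCA IH.
have -> : qint m.+2 * qbin n.+1 m.+1 = qbin n.+1 m.+1 + q * (qint n.+1 * qbin n m).
  by rewrite qintSl mulrDl mul1r -mulrA IH.
by rewrite [qint n.+2]qintSl !qbinS [q ^+ m.+2]exprS; ring.
Qed.

End QNumbers.

Section FallingPowers.
Variables (k : fieldType) (A : algType k) (q l : k).

(** The usual falling factorial for q = l = 1, and the power x^n for l = 0; the shifts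
    l (m)_q are those for which [comul_ffpow] has no correction terms. *)
Fixpoint ffpow (x : A) n : A :=
  if n is m.+1 then (x - (l * qint q m) *: 1) * ffpow x m else 1.
Lemma ffpowS x n : x * ffpow x n = ffpow x n.+1 + (l * qint q n) *: ffpow x n.
Proof. by rewrite /= mulrBl -scalerAl mul1r subrK. Qed.
Lemma ffpow1 x : ffpow x 1 = x.
Proof. by rewrite /= qint0 mulr0 scale0r subr0 mulr1. Qed.

End FallingPowers.

Lemma ffpow_morph (k : fieldType) (A B : algType k) (f : {lrmorphism A -> B}) q l x n :
  f (ffpow q l x n) = ffpow q l (f x) n.
Proof.
by elim: n => [|n IH] /=; rewrite ?rmorph1 // rmorphM /= IH linearB linearZ /= rmorph1.
Qed.

Arguments ffpow : simpl never.
Arguments qbin : simpl never.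

Lemma addr_cancel2 (V : zmodType) (p b r c d : V) :
  p + b + (r + c + (d - b)) + (- d - c) = p + r.
Proof.
rewrite -[p + b + _]addrA [r + c + _]addrA [b + _]addrC subrK.
by rewrite -opprD [d + c]addrC -[r + c + d]addrA addrA addrK.
Qed.

Section FallingComul.
Variables (k : fieldType) (H : hopfAlgType k).
Local Notation G := (grouplike H).
Implicit Types (c d s : k) (b g h : G) (u v w y : H).
Variables (a : G) (x : H) (chi alpha : G -> k).
Hypotheses (xv : rank_one_var a x) (xr : ore_rel a x chi alpha).
Local Notation q := (chi a).
Local Notation l := (alpha a).
Local Notation ff := (ffpow q l x).
Local Notation A := (val a).

Lemma comm_x_expa j : x * A ^+ j = q ^+ j *: (A ^+ j * x) + (l * qint q j) *: (A ^+ j - A ^+ j.+1).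
Proof.
elim: j => [|j IH].
  by rewrite !expr0 mulr1 mul1r scale1r qint0 mulr0 scale0r addr0.
rewrite [in LHS]exprSr mulrA IH mulrDl -!scalerAl -mulrA (or_comm xr) mulrBl -!exprSr.
rewrite mulrDr -!scalerAr mulrA -exprSr scalerDr !scalerA -exprSr.
rewrite mulrBr mulr1 mulrBr mulrA -!exprSr -addrA -scalerDl; congr (_ + _ *: _).
by rewrite qintS; ring.
Qed.

Let T j i := ff j \ox (A ^+ j * ff i).

(** The shift l (j + i)_q = l (j)_q + q^j l (i)_q splits into the two shifts that turn x times
    the j-th and the i-th falling power into the next ones. *)
Let comul_step j i :
  tmul (comul (x - (l * qint q (j + i)) *: 1)) (T j i) = T j.+1 i + q ^+ j *: T j i.+1.
Proof.
rewrite linearB linearZ /= comul_one (rv_sprim xv) -scaleNr tmulDl.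
rewrite tmulZl tmul1l tmulDl !tmulE mul1r.
rewrite !ffpowS mulrA -exprS mulrA comm_x_expa mulrDl -!scalerAl.
rewrite -[A ^+ j * x * _]mulrA ffpowS mulrDr -scalerAr mulrBl.
rewrite /T !tensorDl !tensorDr !tensorZr !tensorDr !tensorZl tensorNr !tensorZr.
set P := _ \ox _; set Q := _ \ox _; set R := _ \ox _; set S := _ \ox _.
have -> : - (l * qint q (j + i)) = - (l * qint q j) - q ^+ j * (l * qint q i).
  by rewrite qintD; ring.
by rewrite scalerDr scalerA scalerBr scalerBl scaleNr addr_cancel2.
Qed.

(** Multiply the formula for n by Delta(x - l (n)_q): [comul_step] turns each term into two, and
    Pascal's rule collects them. *)
Lemma comul_ffpow n : comul (ff n) =
  \sum_(j < n.+1) qbin q n j *: (ff j \ox (A ^+ j * ff (n - j))).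
Proof.
elim: n => [|n IH].
  by rewrite big_ord1 scale1r expr0 mul1r subn0 comul_one.
rewrite comulM IH (big_morph _ (tmulDr _) (tmul0r _)).
have -> : \sum_(j < n.+1) tmul (comul (x - (l * qint q n) *: 1))
      (qbin q n j *: (ff j \ox (A ^+ j * ff (n - j)))) =
    \sum_(j < n.+1) qbin q n j *: T j.+1 (n - j) +
    \sum_(j < n.+1) (q ^+ j * qbin q n j) *: T j (n.+1 - j).
  rewrite -big_split; apply: eq_bigr => j _; rewrite tmulZr.
  have jn : (j + (n - j))%N = n by rewrite subnKC // -ltnS.
  rewrite -/(T j (n - j)) -[X in qint _ X]jn comul_step scalerDr scalerA mulrC.
  by rewrite subSn // -ltnS.
rewrite [in RHS]big_ord_recl qbin0 scale1r subn0 [X in _ + X]big_ord_recl expr0 qbin0 mulr1 scale1r.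
rewrite subn0 addrCA; congr (_ + _).
transitivity (\sum_(j < n.+1) qbin q n j *: T j.+1 (n - j) +
    \sum_(j < n.+1) (q ^+ j.+1 * qbin q n j.+1) *: T j.+1 (n - j)).
  congr (_ + _); rewrite [RHS]big_ord_recr /= qbin_small // mulr0 scale0r addr0.
  by apply: eq_bigr => j _; rewrite /= /bump /= add1n subSS.
rewrite -big_split /=; apply: eq_bigr => j _.
by rewrite -scalerDl /bump /= add1n subSS.
Qed.

(** As (j+1)_q [n,j+1]_q = (n)_q [n-1,j]_q, all inner coefficients vanish. *)
Lemma comul_ffpow_last n : qint q n = 0 -> (0 < n)%N ->
  (forall m, (0 < m < n)%N -> qint q m != 0) -> sprim (a ^+ n)%g (ff n).
Proof.
case: n => // n n0 _ nz; have expv m : val (a ^+ m)%g = A ^+ m.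
  by elim: m => [|m IH]; rewrite ?expgS ?exprS ?expr0 //= -IH.
rewrite /sprim expv comul_ffpow big_ord_recl big_ord_recr /= !qbinn qbin0 !scale1r.
rewrite big1 => [|j _]; last first.
  have := mul_qint_qbin q n j; rewrite n0 mul0r => /eqP; rewrite mulf_eq0.
  by rewrite (negPf (nz j.+1 _)) ?ltnS //= /bump /= add1n => /eqP ->; rewrite scale0r.
by rewrite add0r /bump /= add1n subnn subn0 expr0 mul1r mulr1 addrC.
Qed.

End FallingComul.

(** * Independence of the falling powers over kG *)

Section Independence.
Variables (k : fieldType) (H : hopfAlgType k).
Local Notation G := (grouplike H).
Implicit Types (c d s : k) (b g h : G) (u v w y : H).
Variables (a : G) (x : H) (chi alpha : G -> k).
Hypotheses (xv : rank_one_var a x) (xr : ore_rel a x chi alpha).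
Local Notation q := (chi a).
Local Notation l := (alpha a).
Local Notation ff := (ffpow q l x).

Definition ff_free n := forall w : nat -> H, (forall i, w i \in gspan) ->
  \sum_(i < n) w i * ff i = 0 -> forall i, (i < n)%N -> w i = 0.

Lemma ff_free2 n : (n <= 2)%N -> ff_free n.
Proof.
have xa := rv_sprim xv; have xH0 := rv_notin xv.
case: n => [|[|[|//]]] _ w Sw.
- by [].
- by rewrite big_ord1 mulr1 => w0 [|].
rewrite 2!big_ord_recl big_ord0 addr0 mulr1 ffpow1 => e.
have w1 := gspan_mulx_eq0 xa xH0 (Sw _) (Sw _) e.
by move=> [|[|//]] _ //; move: e; rewrite w1 mul0r addr0.
Qed.

Lemma ctl_comul_gl_ff (f : {scalar H}) g n : ctl f (comul (val g * ff n)) =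
  \sum_(j < n.+1) (qbin q n j * f (val g * ff j)) *: (val g * val a ^+ j * ff (n - j)).
Proof.
rewrite comul_gl (comul_ffpow xv xr).
rewrite (big_morph _ (tmulDr _) (tmul0r _)) linear_sum; apply: eq_bigr => j _.
by rewrite tmulZr tmulE linearZ /= ctlE scalerA mulrA.
Qed.

(** Separates g0 x from the span of the other products h x^(j) with j < n. *)
Lemma ff_dual n g0 : (1 < n)%N -> ff_free n -> exists f : {scalar H},
  forall g j, (j < n)%N -> f (val g * ff j) = ((j == 1%N) && (g == g0))%:R.
Proof.
move=> n1 free.
have [S SP] : {S : submodClosed H | forall u, u \in S <-> exists w : nat -> H,
    [/\ forall i, w i \in gspan, gcoef g0 (w 1%N) = 0 & u = \sum_(i < n) w i * ff i]}.
  apply: mksubmod => [|c _ _ [w [Sw w0 ->]] [w' [Sw' w0' ->]]].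
    exists (fun=> 0); split=> [i||]; rewrite ?rpred0 ?linear0 //.
    by rewrite big1 // => i _; rewrite mul0r.
  exists (fun i => c *: w i + w' i); split=> [i||]; first exact: rpredP.
    by rewrite scalarP w0 w0' mulr0 addr0.
  rewrite scaler_sumr -big_split; apply: eq_bigr => i _ /=.
  by rewrite mulrDl -scalerAl.
have sum1 (v : H) j : (j < n)%N -> v * ff j = \sum_(i < n) (if val i == j then v else 0) * ff i.
  move=> jn; rewrite (bigD1 (Ordinal jn)) //= eqxx big1 ?addr0 // => i ij.
  by rewrite -val_eqE in ij; rewrite (negPf ij) mul0r.
have gS : val g0 * ff 1 \notin S.
  apply/negP => /SP[w [Sw w0]]; rewrite (sum1 _ _ n1) => /eqP.
  rewrite -subr_eq0 -sumrB; under eq_bigr do rewrite -mulrBl.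
  pose w' i := (if i == 1%N then val g0 else 0) - w i.
  have Sw' i : w' i \in gspan.
    by apply: submodB => //; case: eqP => _; rewrite ?rpred0 ?gspan_val.
  move=> /eqP e; have := free w' Sw' e 1%N n1; rewrite /w'.
  move=> /eqP; rewrite eqxx subr_eq0 => /eqP ge; move: w0; rewrite -ge gcoef_val eqxx.
  by move/eqP; rewrite oner_eq0.
have [f [fS f1]] := separation gS.
exists f => g j jn; case: eqP => [->|j1] /=; last first.
  apply/fS/SP; exists (fun i => if i == j then val g else 0); split=> [i||].
  - by case: eqP => _; rewrite ?rpred0 ?gspan_val.
  - by case: eqP => [j1'|_]; [case: j1|rewrite linear0].
  - exact: sum1.
case: (eqVneq g g0) => [->//|gg0]; apply/fS/SP.
exists (fun i => if i == 1%N then val g else 0); split=> [i||].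
- by case: eqP => _; rewrite ?rpred0 ?gspan_val.
- by rewrite eqxx gcoef_val (negPf gg0).
- exact: sum1.
Qed.

(** Contract Delta of a relation of degree n with a functional dual to g0 x. The terms of degree
    n - 1 of the result are (n)_q times the g0-coordinate of the top coefficient; the other
    terms have lower degree or, where the value of the functional is unknown, degree zero. By
    induction on n the result is a trivial relation, so the top coefficient vanishes. *)
Lemma ff_freeP N : (forall m, (0 < m < N)%N -> qint q m != 0) -> ff_free N.
Proof.
elim: N => [|n IH] nz; first exact: ff_free2.
have [n1|n1] := leqP n 1; first exact: ff_free2.
have free : ff_free n by apply: IH => m /andP[m0 mn]; rewrite nz // m0 ltnW.
have expv m : val a ^+ m \in gspan.
  by elim: m => [|m IHm]; rewrite ?expr0 ?gspan1 // exprS gspanM ?gspan_val.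
move=> w Sw e.
suff wn0 : w n = 0.
  move=> i; rewrite ltnS leq_eqVlt => /orP[/eqP -> //|]; apply: free => //.
  by move: e; rewrite big_ord_recr /= wn0 mul0r addr0.
apply: gcoef_eq0 => // g0; have [f fE] := ff_dual g0 n1 free.
have contr i v : (i <= n)%N -> v \in gspan -> exists2 r, r \in gspan &
    ctl f (comul (v * ff i)) = (qint q i * gcoef g0 v) *: (val g0 * val a * ff i.-1) + r.
  move=> le_in; apply: (gspan_ind (P := fun v => exists2 r, r \in gspan &
    ctl f (comul (v * ff i)) = (qint q i * gcoef g0 v) *: (val g0 * val a * ff i.-1) + r)).
  - move=> g; rewrite ctl_comul_gl_ff gcoef_val.
    case: i le_in => [|i] le_in.
      rewrite big_ord1 (fE g 0%N (ltnW n1)) mulr0 scale0r qint0 mul0r scale0r.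
      by exists 0; rewrite ?rpred0 ?addr0.
    rewrite big_ord_recl (fE g 0%N (ltnW n1)) mulr0 scale0r add0r.
    rewrite big_ord_recl (fE g 1%N n1) qbin1 subn1 /= expr1.
    rewrite (_ : (qint q i.+1 * (g == g0)%:R) *: (val g * val a * ff i) =
      (qint q i.+1 * (g == g0)%:R) *: (val g0 * val a * ff i)); last first.
      by case: eqP => [->//|_]; rewrite mulr0 !scale0r.
    eexists; last by []; apply: rpred_sum => j _.
    rewrite /bump /=; have [jn|nj] := ltnP j.+2 n.
      by rewrite fE // mulr0 scale0r rpred0.
    apply: rpredZ; rewrite (_ : (i.+1 - j.+2)%N = 0%N); last first.
      by apply/eqP; rewrite subn_eq0 (leq_trans le_in).
    by rewrite mulr1; apply: gspanM => //; exact: gspan_val.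
  - by exists 0; rewrite ?rpred0 // mul0r !linear0 mulr0 scale0r addr0.
  - move=> c s t [r Sr er] [r' Sr' er']; exists (c *: r + r'); first exact: rpredP.
    rewrite mulrDl -scalerAl comulP ctlP er er' scalarP mulrDr scalerDl scalerDr.
    by rewrite scalerA mulrCA addrACA.
have /choice[r rP] i : exists r, r \in gspan /\ ((i <= n)%N -> ctl f (comul (w i * ff i)) =
    (qint q i * gcoef g0 (w i)) *: (val g0 * val a * ff i.-1) + r).
  have [le_in|] := leqP i n; last by exists 0; rewrite rpred0.
  by have [r Sr er] := contr i _ le_in (Sw i); exists r.
pose w' i := (qint q i.+1 * gcoef g0 (w i.+1)) *: (val g0 * val a) +
  (if i == 0%N then \sum_(j < n.+1) r j else 0).
have Sw' i : w' i \in gspan.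
  apply: rpredD; first by apply/rpredZ/gspanM; exact: gspan_val.
  case: eqP => _; rewrite ?rpred0 //; apply: rpred_sum => j _; exact: (rP _).1.
have e' : \sum_(i < n) w' i * ff i = 0.
  have e0 := congr1 (fun y => ctl f (comul y)) e; rewrite !linear0 !linear_sum /= in e0.
  apply: etrans e0.
  transitivity (\sum_(i < n.+1)
    ((qint q i * gcoef g0 (w i)) *: (val g0 * val a * ff i.-1) + r i)); last first.
    by apply: eq_bigr => i _; rewrite (rP i).2 // -ltnS.
  rewrite big_split /= big_ord_recl /= qint0 mul0r scale0r add0r.
  under eq_bigr do rewrite mulrDl; rewrite big_split /=; congr (_ + _).
    by apply: eq_bigr => i _; rewrite /bump /= add1n -scalerAl.
  have n0 : (0 < n)%N by exact: ltnW.
  rewrite [LHS](bigD1 (Ordinal n0)) //= mulr1 [X in _ + X]big1 ?addr0 // => i i0.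
  by rewrite -val_eqE /= in i0; rewrite (negPf i0) mul0r.
have n10 : (n.-1 == 0)%N = false by case: n n1 {IH nz free e contr r rP w' Sw' e' fE} => [|[]].
have := free w' Sw' e' n.-1; rewrite /w' n10 addr0 (prednK (ltnW n1)) => /(_ (leqnn _)) /eqP.
have qn0 : qint q n != 0 by rewrite nz // ltnSn andbT ltnW.
rewrite scaler_eq0 mulf_eq0 (negPf qn0) /= => /orP[/eqP //|].
by rewrite -[val g0 * val a]/(val (g0 * a)%g) (negPf (gl_neq0 _)).
Qed.

End Independence.

(** * Construction of the Hopf-Ore extension *)

Record ore_data (k : fieldType) (G : groupType) := OreData {
  od_a : G;
  od_chi : G -> k;
  od_alpha : G -> k;
  od_central : forall g, commute od_a g;
  od_chi0 : forall g, od_chi g != 0;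
  od_chiM : forall g h, od_chi (g * h)%g = od_chi g * od_chi h;
  od_alphaM : forall g h, od_alpha (g * h)%g = od_alpha g + od_chi g * od_alpha h
}.

(** The underlying space, where the basis vector (g, i) stands for g x^i; the data appear as a
    parameter because the product depends on them. *)
Definition hore (k : fieldType) (G : groupType) (d : ore_data k G) : Type :=
  {malg k[(G * nat)%type]}.
HB.instance Definition _ (k : fieldType) (G : groupType) (d : ore_data k G) :=
  GRing.Lmodule.on (hore d).

Section OreModule.
Variables (k : fieldType) (G : groupType) (d : ore_data k G).
Local Notation a := (od_a d).
Local Notation chi := (od_chi d).
Local Notation alpha := (od_alpha d).

Lemma od_chi1 : chi 1%g = 1.
Proof.
apply: (mulfI (od_chi0 d 1%g)); by rewrite -od_chiM mulg1 mulr1.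
Qed.
Lemma od_alpha1 : alpha 1%g = 0.
Proof.
apply: (@addrI _ (alpha 1%g)); rewrite addr0.
by rewrite -{3}[1%g](mulg1 (1%g : G)) od_alphaM od_chi1 mul1r.
Qed.

Definition ore_e (g : G) (i : nat) : hore d := << (g, i) >>.

(** Spaces on which G and a variable X act by the commutation rule, i.e. the modules over the
    algebra under construction. *)
Record ore_module (W : lmodType k) := OreModule {
  om_L : G -> {linear W -> W};
  om_X : {linear W -> W};
  om_L1 : forall w, om_L 1%g w = w;
  om_LM : forall g h w, om_L (g * h)%g w = om_L g (om_L h w);
  om_XL : forall g w, om_X (om_L g w) =
    chi g *: om_L g (om_X w) + alpha g *: (om_L g w - om_L (g * a)%g w)
}.

Definition ore_L (g : G) : {linear hore d -> hore d} :=
  lincomb (fun m : G * nat => ore_e (g * m.1)%g m.2).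
(** Left multiplication by x, as the commutation rule prescribes it on the vectors h x^i. *)
Definition ore_X : {linear hore d -> hore d} :=
  lincomb (fun m : G * nat =>
    chi m.1 *: ore_e m.1 m.2.+1 + alpha m.1 *: (ore_e m.1 m.2 - ore_e (m.1 * a)%g m.2)).

Lemma ore_LE g h i : ore_L g (ore_e h i) = ore_e (g * h)%g i.
Proof. exact: lincombU. Qed.
Lemma ore_XE h i : ore_X (ore_e h i) =
  chi h *: ore_e h i.+1 + alpha h *: (ore_e h i - ore_e (h * a)%g i).
Proof. exact: lincombU. Qed.

Lemma ore_eind (P : hore d -> Prop) : (forall g i, P (ore_e g i)) -> P 0 ->
  (forall c u v, P u -> P v -> P (c *: u + v)) -> forall u, P u.
Proof. by move=> Pe P0 PP; apply: malg_ind => // -[g i]; apply: Pe. Qed.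

Lemma ore_ext (W : lmodType k) (F F' : {linear hore d -> W}) :
  (forall g i, F (ore_e g i) = F' (ore_e g i)) -> forall u, F u = F' u.
Proof.
move=> e; apply: ore_eind => [//||c u v IHu IHv]; first by rewrite (linear0 F) (linear0 F').
by rewrite (linearP F) (linearP F') IHu IHv.
Qed.

Section Lift.
Variables (W : lmodType k) (M : ore_module W) (w0 : W).

Definition ore_lift : {linear hore d -> W} :=
  lincomb (fun m : G * nat => om_L M m.1 (iter m.2 (om_X M) w0)).
Lemma ore_liftE g i : ore_lift (ore_e g i) = om_L M g (iter i (om_X M) w0).
Proof. exact: lincombU. Qed.
(** With the next lemma: the lift is the morphism of modules that sends 1 to w0. *)
Lemma ore_lift_L g u : ore_lift (ore_L g u) = om_L M g (ore_lift u).
Proof.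
apply: (ore_ext (F := ore_lift \o ore_L g) (F' := om_L M g \o ore_lift)) => h i /=.
by rewrite ore_LE !ore_liftE om_LM.
Qed.
Lemma ore_lift_X u : ore_lift (ore_X u) = om_X M (ore_lift u).
Proof.
apply: (ore_ext (F := ore_lift \o ore_X) (F' := om_X M \o ore_lift)) => h i /=.
by rewrite ore_XE (linearP ore_lift) (lin_scale ore_lift) (linearB ore_lift) /= !ore_liftE om_XL.
Qed.
Lemma ore_lift1 : ore_lift (ore_e 1%g 0) = w0.
Proof. by rewrite ore_liftE om_L1. Qed.
End Lift.

Lemma ore_L1 u : ore_L 1%g u = u.
Proof. by apply: (ore_ext (F' := idfun)) => h i /=; rewrite ore_LE mul1g. Qed.
Lemma ore_LM g h u : ore_L (g * h)%g u = ore_L g (ore_L h u).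
Proof.
apply: (ore_ext (F' := ore_L g \o ore_L h)) => f i /=.
by rewrite !ore_LE mulgA.
Qed.
Lemma ore_XL g u : ore_X (ore_L g u) =
  chi g *: ore_L g (ore_X u) + alpha g *: (ore_L g u - ore_L (g * a)%g u).
Proof.
apply: (ore_ext (F := ore_X \o ore_L g) (F' := (chi g \*: (ore_L g \o ore_X)) \+
  (alpha g \*: (ore_L g \- ore_L (g * a)%g)))) => h i /=.
rewrite !ore_LE !ore_XE (linearP (ore_L g)) (lin_scale (ore_L g)) (linearB (ore_L g)) /= !ore_LE.
have -> : (g * a * h = g * h * a)%g by rewrite -!mulgA (od_central d h).
rewrite od_chiM od_alphaM mulgA [chi g *: (_ *: _ + _)]scalerDr !scalerA -addrA; congr (_ + _).
by rewrite -scalerDl addrC.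
Qed.
Definition ore_regular : ore_module (hore d) := OreModule ore_L1 ore_LM ore_XL.

End OreModule.

(** Right multiplication by v is the endomorphism of the regular module that sends 1 to v;
    associativity then says that the composite of two such endomorphisms is determined by the
    image of 1. *)
HB.lock Definition ore_mul (k : fieldType) (G : groupType) (d : ore_data k G)
  (u v : hore d) : hore d :=
  ore_lift (ore_regular d) v u.
HB.lock Definition ore_iota (k : fieldType) (G : groupType) (d : ore_data k G) (g : G) : hore d :=
  ore_e d g 0.
HB.lock Definition ore_x (k : fieldType) (G : groupType) (d : ore_data k G) : hore d :=
  ore_e d 1%g 1.

Section OreAlgebra.
Variables (k : fieldType) (G : groupType) (d : ore_data k G).
Local Notation a := (od_a d).
Local Notation chi := (od_chi d).
Local Notation alpha := (od_alpha d).
Local Notation A := (hore d).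
Local Notation mul := (@ore_mul k G d).

Lemma ore_mulPl v c u u' : mul (c *: u + u') v = c *: mul u v + mul u' v.
Proof. rewrite ore_mul.unlock; exact: linearP. Qed.
Lemma ore_mul0l v : mul 0 v = 0.
Proof. rewrite ore_mul.unlock; exact: linear0. Qed.
Lemma ore_mul_L g u v : mul (ore_L d g u) v = ore_L d g (mul u v).
Proof. by rewrite ore_mul.unlock ore_lift_L. Qed.
Lemma ore_mul_X u v : mul (ore_X d u) v = ore_X d (mul u v).
Proof. by rewrite ore_mul.unlock ore_lift_X. Qed.
Lemma ore_mulE g i v : mul (ore_e d g i) v = ore_L d g (iter i (ore_X d) v).
Proof. by rewrite ore_mul.unlock ore_liftE. Qed.
Lemma ore_mulPr u c v v' : mul u (c *: v + v') = c *: mul u v + mul u v'.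
Proof.
elim/ore_eind: u => [g i||e u u' IHu IHu'].
- rewrite !ore_mulE -linearP; congr (ore_L _ _ _).
  by elim: i => //= i ->; rewrite linearP.
- by rewrite !ore_mul0l scaler0 addr0.
- by rewrite !ore_mulPl IHu IHu' linear_swap.
Qed.
Fact ore_mulA : associative mul.
Proof.
move=> u v w; elim/ore_eind: u => [g i||e u u' IHu IHu'].
- rewrite !ore_mulE ore_mul_L; congr (ore_L _ _ _).
  by elim: i => //= i ->; rewrite ore_mul_X.
- by rewrite !ore_mul0l.
- by rewrite !ore_mulPl IHu IHu'.
Qed.
Fact ore_mul1l : left_id (ore_iota d 1%g) mul.
Proof. by move=> u; rewrite ore_iota.unlock ore_mulE ore_L1. Qed.
Lemma ore_iterX i : iter i (ore_X d) (ore_e d 1%g 0) = ore_e d 1%g i.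
Proof.
elim: i => //= i ->; rewrite ore_XE od_chi1 od_alpha1 scale0r addr0; exact: scale1r.
Qed.
Fact ore_mul1r : right_id (ore_iota d 1%g) mul.
Proof.
rewrite ore_iota.unlock => u; elim/ore_eind: u => [g i||e u u' IHu IHu'].
- by rewrite ore_mulE ore_iterX ore_LE mulg1.
- by rewrite ore_mul0l.
- by rewrite ore_mulPl IHu IHu'.
Qed.
Fact ore_mulDl : left_distributive mul +%R.
Proof. by move=> u v w; rewrite -[u in LHS]scale1r ore_mulPl scale1r. Qed.
Fact ore_mulDr : right_distributive mul +%R.
Proof. by move=> w u v; rewrite -[u in LHS]scale1r ore_mulPr scale1r. Qed.
Fact ore_oner_neq0 : ore_iota d 1%g != 0.
Proof.
rewrite ore_iota.unlock; apply/eqP => /(congr1 (mcoeff (1%g, 0%N))) /eqP.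
by rewrite mcoeffUU mcoeff0 oner_eq0.
Qed.
HB.instance Definition _ := GRing.Zmodule_isNzRing.Build A
  ore_mulA ore_mul1l ore_mul1r ore_mulDl ore_mulDr ore_oner_neq0.
Fact ore_scaleAl (c : k) (u v : A) : c *: (u * v) = (c *: u) * v.
Proof. by rewrite -[c *: u]addr0 [RHS]ore_mulPl [mul 0 v]ore_mul0l addr0. Qed.
HB.instance Definition _ := GRing.Lmodule_isLalgebra.Build k A ore_scaleAl.
Fact ore_scaleAr (c : k) (u v : A) : c *: (u * v) = u * (c *: v).
Proof. by rewrite -[c *: v]addr0 [RHS]ore_mulPr -[mul u 0]/(u * 0) mulr0 addr0. Qed.
HB.instance Definition _ := GRing.Lalgebra_isAlgebra.Build k A ore_scaleAr.

Local Notation iota := (ore_iota d).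
Local Notation x := (ore_x d).

Lemma ore_iota1 : iota 1%g = 1. Proof. by []. Qed.
Lemma ore_iotaE g u : iota g * u = ore_L d g u.
Proof. by rewrite ore_iota.unlock [LHS]ore_mulE. Qed.
Lemma ore_xE u : x * u = ore_X d u.
Proof. by rewrite ore_x.unlock [LHS]ore_mulE ore_L1. Qed.
Lemma ore_iotaM g h : iota (g * h)%g = iota g * iota h.
Proof. by rewrite ore_iotaE ore_iota.unlock ore_LE. Qed.
Lemma ore_eE g i : ore_e d g i = iota g * x ^+ i.
Proof.
have -> : x ^+ i = ore_e d 1%g i.
  elim: i => [|i IH]; first by rewrite expr0 -ore_iota1 ore_iota.unlock.
  by rewrite exprS IH ore_xE ore_XE od_chi1 od_alpha1 scale0r addr0 scale1r.
by rewrite ore_iotaE ore_LE mulg1.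
Qed.
Lemma ore_basis : is_basis (fun m : G * nat => iota m.1 * x ^+ m.2).
Proof.
exists id => c; rewrite /lincomb; last first.
  by rewrite [RHS]malg_lincomb; apply: eq_bigr => -[g i] _; rewrite -ore_eE.
by rewrite [RHS]malg_lincomb; apply: eq_bigr => -[g i] _; rewrite -ore_eE.
Qed.
Lemma ore_relation g : x * iota g = chi g *: (iota g * x) + alpha g *: (iota g * (1 - iota a)).
Proof.
rewrite ore_xE mulrBr mulr1 -ore_iotaM -[iota g * x]/(iota g * x ^+ 1) -ore_eE.
by rewrite ore_iota.unlock ore_XE.
Qed.

End OreAlgebra.

(** A description of the Hopf-Ore extension as an algebra by its basis, its relations and its
    universal property; the Hopf structure is deduced from these alone. *)
Record ore_algebra (k : fieldType) (G : groupType) (d : ore_data k G)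
    (A : algType k) (iota : G -> A) (x : A) : Prop := OreAlgebra {
  oa_1 : iota 1%g = 1;
  oa_M : forall g h, iota (g * h)%g = iota g * iota h;
  oa_rel : forall g, x * iota g =
    od_chi d g *: (iota g * x) + od_alpha d g *: (iota g * (1 - iota (od_a d)));
  oa_basis : is_basis (fun m : G * nat => iota m.1 * x ^+ m.2);
  oa_lift : forall (W : lmodType k) (M : ore_module d W) (w : W), exists F : {linear A -> W},
    [/\ F 1 = w, forall g u, F (iota g * u) = om_L M g (F u) &
        forall u, F (x * u) = om_X M (F u)]
}.

Lemma ore_algebra_exists (k : fieldType) (G : groupType) (d : ore_data k G) :
  exists (A : algType k) (iota : G -> A) (x : A), ore_algebra d iota x.
Proof.
exists (hore d), (ore_iota d), (ore_x d); split.
- exact: ore_iota1.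
- exact: ore_iotaM.
- exact: ore_relation.
- exact: ore_basis.
move=> W M w; exists (ore_lift M w); split=> [|g u|u].
- rewrite -[X in ore_lift M w X](ore_iota1 d) ore_iota.unlock; exact: ore_lift1.
- by rewrite ore_iotaE ore_lift_L.
- by rewrite ore_xE ore_lift_X.
Qed.

Section OreHopf.
Variables (k : fieldType) (G : groupType) (d : ore_data k G).
Variables (A : algType k) (iota : G -> A) (x : A).
Hypothesis oa : ore_algebra d iota x.
Local Notation a := (od_a d).
Local Notation chi := (od_chi d).
Local Notation alpha := (od_alpha d).
Local Notation dx := (x \ox iota a + 1 \ox x).

Lemma oa_ind (P : A -> Prop) : P 1 -> P 0 -> (forall c u v, P u -> P v -> P (c *: u + v)) ->
  (forall g u, P u -> P (iota g * u)) -> (forall u, P u -> P (x * u)) -> forall u, P u.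
Proof.
move=> P1 P0 PP Pg Px u; have [c _ cK] := oa_basis oa; rewrite -(cK u).
apply: (malg_ind (P := fun c => P (lincomb _ c))) => [[g i]||e v w Pv Pw].
- rewrite lincombU; apply: Pg.
  by elim: i => [|i IH]; rewrite ?expr0 ?exprS //; apply: Px.
- by rewrite linear0.
- by rewrite linearP; apply: PP.
Qed.

(** The element x (x) a + 1 (x) x satisfies the commutation rule with the g (x) g, so that
    A (x) A becomes an [ore_module] and Delta is the lift of 1 (x) 1. *)
Lemma oa_dx_comm g : tmul dx (iota g \ox iota g) =
  chi g *: tmul (iota g \ox iota g) dx +
  alpha g *: (iota g \ox iota g - iota (g * a)%g \ox iota (g * a)%g).
Proof.
rewrite tmulDl -[dx in RHS]scale1r scalerDr tmulPr !tmulE !scale1r tmulE mul1r mulr1.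
have ag : iota a * iota g = iota g * iota a by rewrite -!(oa_M oa) od_central.
rewrite ag (oa_rel oa) mulrBr mulr1 -!(oa_M oa).
set ga := iota (g * a)%g; set gx := iota g * x.
rewrite tensorDl tensorDr !tensorZl !tensorZr tensorDl tensorDr tensorNl tensorNr.
rewrite addrACA -scalerDr -scalerDr; congr (_ + _ *: _).
by rewrite addrC addrA subrK.
Qed.

Fact oa_comul_L1 w : mklin (tmul_linear (iota 1%g \ox iota 1%g)) w = w.
Proof. by rewrite /= (oa_1 oa) tmul1l. Qed.
Fact oa_comul_LM g h w : mklin (tmul_linear (iota (g * h)%g \ox iota (g * h)%g)) w =
  mklin (tmul_linear (iota g \ox iota g)) (mklin (tmul_linear (iota h \ox iota h)) w).
Proof. by rewrite /= tmulA tmulE -!(oa_M oa). Qed.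
Fact oa_comul_XL g w : mklin (tmul_linear dx) (mklin (tmul_linear (iota g \ox iota g)) w) =
  chi g *: mklin (tmul_linear (iota g \ox iota g)) (mklin (tmul_linear dx) w) +
  alpha g *: (mklin (tmul_linear (iota g \ox iota g)) w -
    mklin (tmul_linear (iota (g * a)%g \ox iota (g * a)%g)) w).
Proof.
rewrite /= !tmulA oa_dx_comm tmulPl; congr (_ + _).
rewrite tmulZl; congr (_ *: _).
by rewrite tmulDl -[in LHS]scaleN1r tmulZl scaleN1r.
Qed.
Definition oa_comul_module : ore_module d (tensor A A) :=
  OreModule (om_L := fun g => mklin (tmul_linear (iota g \ox iota g)))
    oa_comul_L1 oa_comul_LM oa_comul_XL.

Let ecomul := cid (oa_lift oa oa_comul_module (1 \ox 1)).
Definition oa_comul : {linear A -> tensor A A} := projT1 ecomul.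
Lemma oa_comul1 : oa_comul 1 = 1 \ox 1.
Proof. by have [] := projT2 ecomul. Qed.
Lemma oa_comul_g g u : oa_comul (iota g * u) = tmul (iota g \ox iota g) (oa_comul u).
Proof. by have [_ e _] := projT2 ecomul; apply: e. Qed.
Lemma oa_comul_x u : oa_comul (x * u) = tmul dx (oa_comul u).
Proof. by have [_ _ e] := projT2 ecomul; apply: e. Qed.

Fact oa_zero_linear : linear (fun _ : k^o => 0 : k^o).
Proof. by move=> c u v; rewrite scaler0 addr0. Qed.
Fact oa_counit_rel g (w : k^o) : 0 = chi g *: (0 : k^o) + alpha g *: (w - w).
Proof. by rewrite subrr !scaler0 addr0. Qed.
Definition oa_counit_module : ore_module d (k^o : lmodType k) :=
  @OreModule _ _ _ k^o (fun g => idfun) (mklin oa_zero_linear)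
    (fun _ => erefl) (fun _ _ _ => erefl) oa_counit_rel.
Let ecounit : exists f : {scalar A}, [/\ f 1 = 1, forall g u, f (iota g * u) = f u &
  forall u, f (x * u) = 0].
Proof.
have [F [F1 Fg Fx]] := oa_lift oa oa_counit_module (1 : k^o).
have Fs : scalar (fun u => F u : k) by move=> c u v; rewrite linearP.
by exists (mkscalar Fs).
Qed.
Definition oa_counit : {scalar A} := projT1 (cid ecounit).
Lemma oa_counit1 : oa_counit 1 = 1.
Proof. by have [] := projT2 (cid ecounit). Qed.
Lemma oa_counit_g g u : oa_counit (iota g * u) = oa_counit u.
Proof. by have [_ e _] := projT2 (cid ecounit); apply: e. Qed.
Lemma oa_counit_x u : oa_counit (x * u) = 0.
Proof. by have [_ _ e] := projT2 (cid ecounit); apply: e. Qed.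

Lemma iotaVK g : iota (g^-1)%g * iota g = 1. Proof. by rewrite -(oa_M oa) mulVg (oa_1 oa). Qed.
Lemma iotaKV g : iota g * iota (g^-1)%g = 1. Proof. by rewrite -(oa_M oa) mulgV (oa_1 oa). Qed.
Lemma iotaVKl g u : iota (g^-1)%g * (iota g * u) = u.
Proof. by rewrite mulrA iotaVK mul1r. Qed.

Lemma iotaV_x g : iota (g^-1)%g * x = chi g *: (x * iota (g^-1)%g) +
  alpha g *: ((1 - iota a) * iota (g^-1)%g).
Proof.
rewrite -[LHS]mulr1 -[X in _ * X = _](iotaKV g) mulrA -[_ * x * _]mulrA (oa_rel oa).
rewrite mulrDr -!scalerAr.
by rewrite !iotaVKl mulrDl -!scalerAl.
Qed.

Local Notation sL g := (mklin (mulr_linear (iota (g^-1)%g))).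
Local Notation sX := (mklin (mulr_linear (- x * iota (a^-1)%g))).
Fact oa_antipode_L1 w : sL 1%g w = w.
Proof. by rewrite /= invg1 (oa_1 oa) mulr1. Qed.
Fact oa_antipode_LM g h w : sL (g * h)%g w = sL g (sL h w).
Proof. by rewrite /= invgM (oa_M oa) mulrA. Qed.
Fact oa_antipode_XL g w : sX (sL g w) =
  chi g *: sL g (sX w) + alpha g *: (sL g w - sL (g * a)%g w).
Proof.
rewrite /=.
have aV : iota (a^-1)%g * iota (g^-1)%g = iota (g^-1)%g * iota (a^-1)%g.
  by rewrite -!(oa_M oa) -!invgM od_central.
have gaV : iota ((g * a)^-1)%g = iota (a^-1)%g * iota (g^-1)%g by rewrite invgM (oa_M oa).
suff key : iota (g^-1)%g * (- x * iota (a^-1)%g) =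
    chi g *: (- x * iota (a^-1)%g * iota (g^-1)%g) +
    alpha g *: (iota (g^-1)%g - iota ((g * a)^-1)%g).
  by rewrite -mulrA key mulrDr -!scalerAr mulrA mulrBr.
rewrite -[- x * _ * _]mulrA aV !mulNr mulrN mulrA iotaV_x mulrDl -!scalerAl opprD -!scalerN -mulrA.
congr (_ + _ *: _).
rewrite -mulrA -aV -gaV mulrBl mul1r gaV mulrA iotaKV mul1r.
by rewrite opprB.
Qed.
(** Here g acts by right multiplication by g^-1 and the variable by right multiplication by
    - x a^-1, which makes the lift of 1 reverse products. *)
Definition oa_antipode_module : ore_module d A :=
  OreModule (om_L := fun g => sL g) oa_antipode_L1 oa_antipode_LM oa_antipode_XL.

Let eanti := cid (oa_lift oa oa_antipode_module 1).
Definition oa_antipode : {linear A -> A} := projT1 eanti.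
Lemma oa_antipode1 : oa_antipode 1 = 1.
Proof. by have [] := projT2 eanti. Qed.
Lemma oa_antipode_g g u : oa_antipode (iota g * u) = oa_antipode u * iota (g^-1)%g.
Proof. by have [_ e _] := projT2 eanti; apply: e. Qed.
Lemma oa_antipode_x u : oa_antipode (x * u) = oa_antipode u * (- x * iota (a^-1)%g).
Proof. by have [_ _ e] := projT2 eanti; apply: e. Qed.

End OreHopf.

(** * The Hopf algebra axioms for the Hopf-Ore extension *)

(** Every axiom is linear in u, holds at 1, and is inherited by g u and x u from u, which is
    enough by [oa_ind]. *)
Section OreHopfAxioms.
Variables (k : fieldType) (G : groupType) (d : ore_data k G).
Variables (A : algType k) (iota : G -> A) (x : A).
Hypothesis oa : ore_algebra d iota x.
Local Notation a := (od_a d).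
Local Notation dx := (x \ox iota a + 1 \ox x).
Local Notation Delta := (oa_comul oa).
Local Notation eps := (oa_counit oa).
Local Notation S := (oa_antipode oa).
Local Notation mL b := (mklin (mul_linear b)).
Local Notation tL s := (mklin (tmul_linear s)).

(** Left multiplication by the threefold coproduct of g, respectively x. *)
Let Og g : tensor A (tensor A A) -> tensor A (tensor A A) :=
  tmap (mL (iota g)) (tL (iota g \ox iota g)).
Let Ox (t : tensor A (tensor A A)) : tensor A (tensor A A) :=
  tmap (mL x) (tL (iota a \ox iota a)) t + tmap idfun (tL dx) t.

Let OgP g c s t : Og g (c *: s + t) = c *: Og g s + Og g t.
Proof. exact: linearP. Qed.
Let OxP c s t : Ox (c *: s + t) = c *: Ox s + Ox t.
Proof. by rewrite /Ox !tmapP scalerDr addrACA. Qed.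

Let comulPP c u v : Delta (c *: u + v) = c *: Delta u + Delta v.
Proof. exact: linearP. Qed.
Let assoc_g1 g t : tassoc (tmap Delta idfun (tmul (iota g \ox iota g) t)) =
  Og g (tassoc (tmap Delta idfun t)).
Proof.
elim/tensor_ind: t => [u v|c s t IHs IHt]; last by rewrite tmulPr !tmapP !tassocP IHs IHt OgP.
rewrite tmulE !tmapE /= oa_comul_g.
elim/tensor_ind: (Delta u) => [p r|c s t IHs IHt].
  by rewrite tmulE !tassocE /Og !tmapE /= tmulE.
by rewrite tmulPr !tensorDl !tensorZl !tassocP IHs IHt OgP.
Qed.
Let assoc_g2 g t : tmap idfun Delta (tmul (iota g \ox iota g) t) =
  Og g (tmap idfun Delta t).
Proof.
elim/tensor_ind: t => [u v|c s t IHs IHt]; last by rewrite tmulPr !tmapP IHs IHt OgP.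
by rewrite tmulE !tmapE /= oa_comul_g /Og tmapE.
Qed.
Let tmapD (U V U' V' : lmodType k) (f : {linear U -> U'}) (g : {linear V -> V'}) s t :
  tmap f g (s + t) = tmap f g s + tmap f g t.
Proof. exact: linearD. Qed.
Let tassocD (U V W : lmodType k) (s t : tensor (tensor U V) W) :
  tassoc (s + t) = tassoc s + tassoc t.
Proof. exact: linearD. Qed.

Let assoc_x1 t : tassoc (tmap Delta idfun (tmul dx t)) =
  Ox (tassoc (tmap Delta idfun t)).
Proof.
elim/tensor_ind: t => [u v|c s t IHs IHt]; last by rewrite tmulPr !tmapP !tassocP IHs IHt OxP.
rewrite tmulDl !tmulE tmapD !tmapE /= mul1r oa_comul_x.
elim/tensor_ind: (Delta u) => [p r|c s t IHs IHt].
  rewrite tmulDl !tmulE tensorDl !tassocD !tassocE mul1r /Ox !tmapE /=.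
  by rewrite tmulDl !tmulE mul1r tensorDr addrA.
rewrite tassocD tmulPr !tensorDl !tensorZl !tassocP OxP -IHs -IHt !tassocD.
by rewrite scalerDr addrACA.
Qed.
Let assoc_x2 t : tmap idfun Delta (tmul dx t) = Ox (tmap idfun Delta t).
Proof.
elim/tensor_ind: t => [u v|c s t IHs IHt]; last by rewrite tmulPr !tmapP IHs IHt OxP.
by rewrite tmulDl !tmulE tmapD !tmapE /= mul1r oa_comul_g oa_comul_x /Ox !tmapE.
Qed.

Fact oa_comulA u : tassoc (tmap Delta idfun (Delta u)) = tmap idfun Delta (Delta u).
Proof.
elim/(oa_ind oa): u => [||c u v IHu IHv|g u IHu|u IHu].
- by rewrite oa_comul1 !tmapE /= oa_comul1 tassocE.
- by rewrite !linear0.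
- by rewrite comulPP !tmapP tassocP IHu IHv.
- by rewrite oa_comul_g assoc_g1 assoc_g2 IHu.
- by rewrite oa_comul_x assoc_x1 assoc_x2 IHu.
Qed.

Fact oa_comul1l u : ctl eps (Delta u) = u.
Proof.
have P c s t : ctl eps (c *: s + t) = c *: ctl eps s + ctl eps t by rewrite ctlP.
elim/(oa_ind oa): u => [||c u v IHu IHv|g u IHu|u IHu].
- by rewrite oa_comul1 ctlE oa_counit1 scale1r.
- by rewrite !linear0.
- by rewrite comulPP P IHu IHv.
- rewrite oa_comul_g -[in RHS]IHu; elim/tensor_ind: (Delta u) => [p r|c s t IHs IHt].
    by rewrite tmulE !ctlE oa_counit_g scalerAr.
  by rewrite tmulPr !P IHs IHt mulrDr scalerAr.
- rewrite oa_comul_x -[in RHS]IHu; elim/tensor_ind: (Delta u) => [p r|c s t IHs IHt].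
    by rewrite tmulDl !tmulE -[X in ctl _ (X + _)]scale1r P !ctlE oa_counit_x mul1r
      scale0r scaler0 add0r scalerAr.
  by rewrite tmulPr !P IHs IHt mulrDr scalerAr.
Qed.

Fact oa_comul1r u : ctr eps (Delta u) = u.
Proof.
have P c s t : ctr eps (c *: s + t) = c *: ctr eps s + ctr eps t by rewrite ctrP.
elim/(oa_ind oa): u => [||c u v IHu IHv|g u IHu|u IHu].
- by rewrite oa_comul1 ctrE oa_counit1 scale1r.
- by rewrite !linear0.
- by rewrite comulPP P IHu IHv.
- rewrite oa_comul_g -[in RHS]IHu; elim/tensor_ind: (Delta u) => [p r|c s t IHs IHt].
    by rewrite tmulE !ctrE oa_counit_g scalerAr.
  by rewrite tmulPr !P IHs IHt mulrDr scalerAr.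
- rewrite oa_comul_x -[in RHS]IHu; elim/tensor_ind: (Delta u) => [p r|c s t IHs IHt].
    by rewrite tmulDl !tmulE -[X in ctr _ (X + _)]scale1r P !ctrE oa_counit_x oa_counit_g mul1r
      scale0r scale1r addr0 scalerAr.
  by rewrite tmulPr !P IHs IHt mulrDr scalerAr.
Qed.

Fact oa_comulM u v : Delta (u * v) = tmul (Delta u) (Delta v).
Proof.
elim/(oa_ind oa): u => [||c u u' IHu IHu'|g u IHu|u IHu].
- by rewrite mul1r oa_comul1 tmul1l.
- by rewrite mul0r !linear0 tmul0l.
- by rewrite mulrDl -scalerAl !comulPP IHu IHu' tmulPl.
- by rewrite -mulrA !oa_comul_g IHu tmulA.
- by rewrite -mulrA !oa_comul_x IHu tmulA.
Qed.
Fact oa_counitM u v : eps (u * v) = eps u * eps v.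
Proof.
elim/(oa_ind oa): u => [||c u u' IHu IHu'|g u IHu|u IHu].
- by rewrite mul1r oa_counit1 mul1r.
- by rewrite mul0r !linear0 mul0r.
- by rewrite mulrDl -scalerAl !scalarP IHu IHu' mulrDl mulrA.
- by rewrite -mulrA !oa_counit_g IHu.
- by rewrite -mulrA !oa_counit_x mul0r.
Qed.

Fact oa_antipodeV u : tlift (fun u v => S u * v) (Delta u) = eps u *: 1.
Proof.
set m := fun u v => S u * v.
have mb : bilinear_for *:%R *:%R m.
  by split=> [z|y] c s t; rewrite /m ?linearP ?mulrDl ?mulrDr -?scalerAl -?scalerAr.
elim/(oa_ind oa): u => [||c u u' IHu IHu'|g u IHu|u IHu].
- by rewrite oa_comul1 (tliftE mb) /m oa_antipode1 mul1r oa_counit1 scale1r.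
- by rewrite !linear0 scale0r; exact: (linear0 (mklin (tlift_linear mb))).
- by rewrite comulPP (tliftP mb) IHu IHu' scalarP scalerDl scalerA.
- rewrite oa_comul_g oa_counit_g -IHu.
  elim/tensor_ind: (Delta u) => [p r|c s t IHs IHt]; last by rewrite tmulPr !(tliftP mb) IHs IHt.
  by rewrite tmulE !(tliftE mb) /m oa_antipode_g -mulrA (iotaVKl oa).
- rewrite oa_comul_x oa_counit_x scale0r.
  elim/tensor_ind: (Delta u) => [p r|c s t IHs IHt]; last first.
    by rewrite tmulPr (tliftP mb) IHs IHt scaler0 addr0.
  rewrite tmulDl (tliftD mb) !tmulE !(tliftE mb) /m oa_antipode_x mul1r.
  by rewrite -!mulrA (iotaVKl oa) mulNr mulrN addNr.
Qed.
Fact oa_antipodeVr u : tlift (fun u v => u * S v) (Delta u) = eps u *: 1.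
Proof.
set m := fun u v => u * S v.
have mb : bilinear_for *:%R *:%R m.
  by split=> [z|y] c s t; rewrite /m ?linearP ?mulrDl ?mulrDr -?scalerAl -?scalerAr.
elim/(oa_ind oa): u => [||c u u' IHu IHu'|g u IHu|u IHu].
- by rewrite oa_comul1 (tliftE mb) /m oa_antipode1 mul1r oa_counit1 scale1r.
- by rewrite !linear0 scale0r; exact: (linear0 (mklin (tlift_linear mb))).
- by rewrite comulPP (tliftP mb) IHu IHu' scalarP scalerDl scalerA.
- have e t : tlift m (tmul (iota g \ox iota g) t) = iota g * tlift m t * iota (g^-1)%g.
    elim/tensor_ind: t => [p r|c s t IHs IHt]; last first.
      by rewrite tmulPr !(tliftP mb) IHs IHt mulrDr mulrDl -scalerAr -scalerAl.
    by rewrite tmulE !(tliftE mb) /m oa_antipode_g !mulrA.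
  by rewrite oa_comul_g oa_counit_g e IHu -scalerAr mulr1 -scalerAl (iotaKV oa).
- have e t : tlift m (tmul dx t) = x * tlift m t * iota (a^-1)%g - tlift m t * x * iota (a^-1)%g.
    elim/tensor_ind: t => [p r|c s t IHs IHt]; last first.
      rewrite tmulPr !(tliftP mb) IHs IHt mulrDr !mulrDl -scalerAr -!scalerAl.
      by rewrite scalerBr opprD addrACA.
    rewrite tmulDl (tliftD mb) !tmulE !(tliftE mb) /m oa_antipode_g oa_antipode_x mul1r !mulrA.
    by rewrite mulrN !mulNr.
  rewrite oa_comul_x oa_counit_x e IHu -scalerAr mulr1 -!scalerAl mul1r subrr.
  by rewrite scale0r.
Qed.

End OreHopfAxioms.

(** A copy of A that carries the Hopf algebra structure. *)
Definition ore_hopf (k : fieldType) (G : groupType) (d : ore_data k G)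
  (A : algType k) (iota : G -> A) (x : A) (oa : ore_algebra d iota x) : Type := A.

Section OreHopfType.
Variables (k : fieldType) (G : groupType) (d : ore_data k G).
Variables (A : algType k) (iota : G -> A) (x : A) (oa : ore_algebra d iota x).
HB.instance Definition _ := GRing.Algebra.on (ore_hopf oa).
HB.instance Definition _ := isCoalgebra.Build k (ore_hopf oa)
  (oa_comulA oa) (oa_comul1l oa) (oa_comul1r oa).
HB.instance Definition _ := isHopfAlgebra.Build k (ore_hopf oa)
  (oa_comul1 oa) (oa_comulM oa) (oa_counit1 oa) (oa_counitM oa)
  (oa_antipodeV oa) (oa_antipodeVr oa).
End OreHopfType.

Lemma hopf_ore_exists (k : fieldType) (G : groupType) (d : ore_data k G)
    (alpha : {scalar {malg k[G]}}) : (forall g, alpha << g >> = od_alpha d g) ->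
  exists (A : hopfAlgType k) (iota : G -> A) (x : A),
    is_hopf_ore (od_chi d) (od_a d) alpha iota x /\ ore_algebra d iota x.
Proof.
move=> alE; have [A [iota [x oa]]] := ore_algebra_exists d.
exists (ore_hopf oa), iota, x; split; last by split;
  [exact: oa_1 oa|exact: oa_M oa|exact: oa_rel oa|exact: oa_basis oa|exact: oa_lift oa].
split.
- exact: oa_1 oa.
- exact: oa_M oa.
- by move=> g; have := oa_comul_g oa g 1; rewrite mulr1 oa_comul1 tmul1.
- by move=> g; have := oa_counit_g oa g 1; rewrite mulr1 oa_counit1.
- by move=> g; have := oa_antipode_g oa g 1; rewrite mulr1 oa_antipode1 mul1r.
- exact: oa_basis oa.
- by move=> g; rewrite alE; apply: (oa_rel oa).
- by have := oa_comul_x oa 1; rewrite mulr1 oa_comul1 tmul1.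
- by have := oa_counit_x oa 1; rewrite mulr1.
- by have := oa_antipode_x oa 1; rewrite mulr1 oa_antipode1 mul1r.
Qed.

(** * The quotient of a Hopf algebra by the kernel of a surjection *)

Section FirstIsomorphism.
Variables (k : fieldType) (A H : hopfAlgType k) (f : {lrmorphism A -> H}).
Hypotheses (fS : forall h, exists u, h = f u)
  (fD : forall u, comul (f u) = tmap f f (comul u))
  (fE : forall u, counit (f u) = counit u).

(** The maps f S and S f are both convolution inverses of f: both sides equal
    S(f(u_1)) f(u_2) f(S(u_3)). *)
Lemma hopf_morph_antipode u : f (antipode u) = antipode (f u).
Proof.
pose n := fun q r : A => f q * f (antipode r).
have nb : bilinear_for *:%R *:%R n.
  by split=> [z|y] c s t; rewrite /n !linearP ?mulrDl ?mulrDr -?scalerAl -?scalerAr.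
pose m := fun p q : A => antipode (f p) * f q.
have mb : bilinear_for *:%R *:%R m.
  by split=> [z|y] c s t; rewrite /m !linearP ?mulrDl ?mulrDr -?scalerAl -?scalerAr.
pose T := fun (p : A) (s : tensor A A) => antipode (f p) * tlift n s.
have Tb : bilinear_for *:%R *:%R T.
  split=> [z|y] c s t; first by rewrite /T !linearP mulrDl -scalerAl.
  by rewrite /T (tliftP nb) mulrDr -scalerAr.
have nE v : tlift n (comul v) = counit v *: 1.
  have := congr1 f (antipodeVr v); rewrite linearZ /= rmorph1 => <-.
  elim/tensor_ind: (comul v) => [q r|c s t IHs IHt].
    by rewrite (tliftE nb) (tliftE (antipodeVr_bilinear A)) rmorphM.
  by rewrite (tliftP nb) (tliftP (antipodeVr_bilinear A)) linearP IHs IHt.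
have mE v : tlift m (comul v) = counit v *: 1.
  rewrite -fE -antipodeV fD; elim/tensor_ind: (comul v) => [q r|c s t IHs IHt].
    by rewrite (tliftE mb) tmapE (tliftE (antipodeV_bilinear H)).
  by rewrite (tliftP mb) tmapP (tliftP (antipodeV_bilinear H)) IHs IHt.
have e1 : tlift T (tmap idfun comul (comul u)) = antipode (f u).
  have cu : ctr counit (comul u) = u := comul1r u.
  rewrite -[in RHS]cu; elim/tensor_ind: (comul u) => [q r|c s t IHs IHt].
    by rewrite tmapE (tliftE Tb) /T nE ctrE !linearZ -scalerAr mulr1.
  by rewrite tmapP (tliftP Tb) ctrP !linearP IHs IHt.
have e2 : tlift T (tassoc (tmap comul idfun (comul u))) = f (antipode u).
  have cu : ctl counit (comul u) = u := comul1l u.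
  rewrite -[in RHS]cu; elim/tensor_ind: (comul u) => [q r|c s t IHs IHt]; last first.
    by rewrite tmapP tassocP (tliftP Tb) ctlP !linearP IHs IHt.
  rewrite tmapE ctlE !linearZ /=.
  transitivity (tlift m (comul q) * f (antipode r)); last by rewrite mE -scalerAl mul1r.
  elim/tensor_ind: (comul q) => [p s|c s t IHs IHt].
    by rewrite tassocE (tliftE Tb) /T (tliftE nb) (tliftE mb) /n /m mulrA.
  by rewrite tensorDl tensorZl tassocP (tliftP Tb) (tliftP mb) mulrDl -scalerAl IHs IHt.
by rewrite -e2 comulA e1.
Qed.

Definition ker_pred : A -> bool := fun u => f u == 0.
Fact ker_submod : GRing.subsemimod_closed (ker_pred : {pred A}).
Proof.
split; first split; rewrite /ker_pred ?unfold_in.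
- by rewrite linear0.
- by move=> u v; rewrite !unfold_in => /eqP u0 /eqP v0; rewrite linearD /= u0 v0 addr0.
- by move=> c v; rewrite !unfold_in => /eqP v0; rewrite linearZ /= v0 scaler0.
Qed.
Definition ker_closed : submodClosed A :=
  HB.pack ker_pred (GRing.isSubmodClosed.Build k A ker_pred ker_submod).

Lemma kerP u : (u \in ker_closed) = (f u == 0). Proof. by []. Qed.

(** A projection E onto the kernel gives a linear section: C u = u - E u only depends on f u. *)
Lemma ker_section : exists (E C : {linear A -> A}) (s : {linear H -> A}),
  [/\ forall u, E u \in ker_closed, forall u, u = C u + E u,
      forall u, s (f u) = C u & forall h, f (s h) = h].
Proof.
have [E [EI Eid]] := projection_exists ker_closed.
have Cl : linear (fun u => u - E u).
  by move=> c u v; rewrite linearP scalerBr opprD addrACA.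
pose C := mklin Cl.
have C0 u : f u = 0 -> C u = 0 by move=> fu; rewrite /= Eid ?subrr // kerP fu eqxx.
have /choice[s0 s0P] := fS.
have Cf u v : f u = f v -> C u = C v.
  move=> uv; apply/eqP; rewrite -subr_eq0 -(linearB C); apply/eqP/C0.
  by rewrite linearB /= uv subrr.
have sl : linear (fun h => C (s0 h)).
  by move=> c u v; rewrite -(linearP C); apply: Cf; rewrite (linearP f) /= -(s0P u) -(s0P v) -s0P.
exists E, C, (mklin sl); split=> [//|u|u|h] /=.
- by rewrite subrK.
- by apply: (Cf (s0 (f u)) u); rewrite -s0P.
- by rewrite linearB /= -s0P (eqP (EI _)) subr0.
Qed.

(** Since C (x) C factors through f (x) f, only the terms of t = (C + E) (x) (C + E) t that
    involve E survive. *)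
Lemma ker_tmap t : tmap f f t = 0 ->
  t \in tspan (fun u v : A => u \in ker_closed \/ v \in ker_closed).
Proof.
have [E [C [s [EI CE sf fs]]]] := ker_section; move=> ft.
have : t - tmap C C t \in tspan (fun u v : A =>
    u \in ker_closed \/ v \in ker_closed).
  elim/tensor_ind: t {ft} => [u v|c t t' IHt IHt'].
    have -> : u \ox v - tmap C C (u \ox v) = E u \ox v + C u \ox E v.
      rewrite tmapE {1}(CE u) tensorDl {1}(CE v) tensorDr addrAC.
      by rewrite [_ + C u \ox E v]addrC addrK addrC.
    by apply: rpredD; apply: mem_span; [exists (E u), v|exists (C u), (E v)]; split=> //;
      [left|right].
  by rewrite tmapP opprD addrACA -scalerBr; apply: rpredP.
suff -> : tmap C C t = 0 by rewrite subr0.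
have -> : tmap C C t = tmap s s (tmap f f t).
  by rewrite tmap_comp; apply: eq_tmap => u; rewrite /= sf.
by rewrite ft linear0.
Qed.

Fact ker_ideal : two_sided_ideal ker_closed.
Proof. by move=> a b; rewrite !kerP => /eqP b0; rewrite !rmorphM /= b0 mulr0 mul0r eqxx. Qed.
Fact ker_comul b : b \in ker_closed ->
    comul b \in tspan (fun u v : A => u \in ker_closed \/ v \in ker_closed).
Proof. by rewrite kerP => /eqP b0; apply: ker_tmap; rewrite -fD b0 linear0. Qed.
Fact ker_counit b : b \in ker_closed -> counit b = 0.
Proof. by rewrite kerP => /eqP b0; rewrite -fE b0 linear0. Qed.
Fact ker_antipode b : b \in ker_closed -> antipode b \in ker_closed.
Proof. by rewrite !kerP hopf_morph_antipode => /eqP ->; rewrite linear0 eqxx. Qed.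

Lemma hopf_first_isomorphism : exists I : hopfIdeal A,
  (forall u, (u \in I) = (f u == 0)) /\ hopf_isomorphic H (hopf_quot I).
Proof.
pose M := isHopfIdeal.Build k A ker_pred ker_ideal ker_comul ker_counit ker_antipode.
pose I : hopfIdeal A := HB.pack ker_pred M (GRing.isSubmodClosed.Build k A ker_pred ker_submod).
exists I; split=> //.
have [E [C [s [EI CE sf fs]]]] := ker_section.
pose g := fun h => hproj I (s h).
have gf u : g (f u) = hproj I u.
  rewrite /g sf; apply/hprojP; rewrite {2}(CE u) opprD addrA subrr add0r -scaleN1r.
  by apply: rpredZ; exact: EI.
have gl : linear g by move=> c u v; rewrite /g !linearP.
have gm : monoid_morphism g.
  split=> [|u v]; first by rewrite -(rmorph1 f) gf.
  by rewrite -(fs u) -(fs v) -rmorphM !gf hprojM.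
pose F : {lrmorphism H -> hopf_quot I} :=
  HB.pack g (GRing.isLinear.Build k H (hopf_quot I) *:%R g gl)
    (GRing.isMonoidMorphism.Build H (hopf_quot I) g gm).
have Ff u : F (f u) = hproj I u by exact: gf.
exists F; split=> [|h|h|h].
- exists (fun q => f (qrepr q)) => [h|q].
    apply/eqP; rewrite -subr_eq0 -{2}(fs h) -linearB -kerP; exact: hprojK.
  by rewrite Ff; exact: qreprK.
- rewrite -(fs h) Ff fD tmap_comp [LHS]hq_comulE; apply: eq_tmap => u; by rewrite /= gf.
- by rewrite -(fs h) Ff fE [LHS]hq_counitE.
- by rewrite -(fs h) Ff -hopf_morph_antipode Ff [RHS]hq_antipodeE.
Qed.

End FirstIsomorphism.

(** * The projection of the Hopf-Ore extension onto H and its kernel *)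

Section Cover.
Variables (k : fieldType) (H : hopfAlgType k).
Local Notation G := (grouplike H).
Variables (a : G) (x : H) (chi alpha : G -> k).
Hypotheses (xv : rank_one_var a x) (xr : ore_rel a x chi alpha).

Definition rank_one_ore : ore_data k G :=
  OreData (or_central xr) (or_chi0 xr) (or_chiM xr) (or_alphaM xr).

Variables (A : hopfAlgType k) (al : {scalar {malg k[G]}}) (iota : G -> A) (X : A).
Hypothesis oa : ore_algebra rank_one_ore iota X.
Hypothesis ho : is_hopf_ore chi a al iota X.

Fact cover_L1 w : mklin (mul_linear (val (1%g : G))) w = w.
Proof. exact: mul1r. Qed.
Fact cover_LM g h w : mklin (mul_linear (val (g * h : G)%g)) w =
  mklin (mul_linear (val g)) (mklin (mul_linear (val h)) w).
Proof. by rewrite /= mulrA. Qed.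
Fact cover_XL g w : mklin (mul_linear x) (mklin (mul_linear (val (g : G))) w) =
  chi g *: mklin (mul_linear (val g)) (mklin (mul_linear x) w) +
  alpha g *: (mklin (mul_linear (val g)) w - mklin (mul_linear (val (g * a)%g)) w).
Proof.
by rewrite /= mulrA (or_comm xr) mulrDl -!scalerAl -!mulrA mulrBl mul1r mulrBr !mulrA.
Qed.
Definition cover_module : ore_module rank_one_ore H :=
  @OreModule _ _ rank_one_ore H (fun g => mklin (mul_linear (val g))) (mklin (mul_linear x))
    cover_L1 cover_LM cover_XL.

Lemma tmap_tmul (F : {lrmorphism A -> H}) s t :
  tmap F F (tmul s t) = tmul (tmap F F s) (tmap F F t).
Proof.
elim/tensor_ind: s => [u v|c s s' IHs IHs']; last by rewrite tmulPl !tmapP tmulPl IHs IHs'.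
elim/tensor_ind: t => [u' v'|c t t' IHt IHt']; last by rewrite tmulPr !tmapP tmulPr IHt IHt'.
by rewrite tmulE !tmapE tmulE !rmorphM.
Qed.

Lemma cover_exists : exists F : {lrmorphism A -> H},
  [/\ forall g, F (iota g) = val g, F X = x, forall h, exists u, h = F u,
      forall u, comul (F u) = tmap F F (comul u) & forall u, counit (F u) = counit u].
Proof.
have [F0 [F1 Fg Fx]] := oa_lift oa cover_module 1.
have FM : monoid_morphism F0.
  split=> // u v; elim/(oa_ind oa): u => [||c u u' IHu IHu'|g u IHu|u IHu].
  - by rewrite mul1r F1 mul1r.
  - by rewrite mul0r linear0 mul0r.
  - by rewrite mulrDl -scalerAl !linearP IHu IHu' mulrDl scalerAl.
  - by rewrite -mulrA !Fg IHu /= mulrA.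
  - by rewrite -mulrA !Fx IHu /= mulrA.
pose F : {lrmorphism A -> H} := HB.pack (F0 : A -> H)
  (GRing.isLinear.Build k A H *:%R F0 (linearP F0)) (GRing.isMonoidMorphism.Build A H F0 FM).
have FE u : F u = F0 u by [].
have FgE g : F (iota g) = val g by rewrite FE -[iota g]mulr1 Fg F1 /= mulr1.
have FxE : F X = x by rewrite FE -[X]mulr1 Fx F1 /= mulr1.
have FM' u v : F (u * v) = F u * F v := rmorphM F u v.
have tg g : tmap F F (iota g \ox iota g) = val g \ox val g.
  by rewrite tmapE -(FgE g).
have tx : tmap F F (X \ox iota a + 1 \ox X) = x \ox val a + 1 \ox x.
  by rewrite linearD /= !tmapE -(FgE a) -FxE -(rmorph1 F).
exists F; split=> // [h|u|u].
- pose B : {pred H} := fun h => `[< exists u, h = F u >].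
  have Bc : GRing.subalg_closed B.
    split; first by apply/asboolP; exists 1; rewrite rmorph1.
    - move=> c _ _ /asboolP[u ->] /asboolP[v ->]; apply/asboolP.
      by exists (c *: u + v); rewrite linearP.
    - move=> _ _ /asboolP[u ->] /asboolP[v ->]; apply/asboolP.
      by exists (u * v); rewrite rmorphM.
  pose BB : subalgClosed H := HB.pack B (GRing.isSubalgClosed.Build k H B Bc).
  suff : h \in BB by move=> /asboolP.
  apply: (rv_gen xv) => [g|]; apply/asboolP; first by exists (iota g).
  by exists X.
- elim/(oa_ind oa): u => [||c u u' IHu IHu'|g u IHu|u IHu].
  + by rewrite rmorph1 !comul_one tmapE rmorph1.
  + by rewrite !linear0.
  + by rewrite linearP !comulP tmapP IHu IHu'.
  + by rewrite FM' FgE !comulM tmap_tmul IHu (hopf_ore_comul ho) tg glD.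
  + by rewrite FM' FxE !comulM tmap_tmul IHu (hopf_ore_comulx ho) tx (rv_sprim xv).
- elim/(oa_ind oa): u => [||c u u' IHu IHu'|g u IHu|u IHu].
  + by rewrite rmorph1 !counit_one.
  + by rewrite !linear0.
  + by rewrite linearP !scalarP IHu IHu'.
  + by rewrite FM' FgE !counitM IHu (hopf_ore_counit ho) glE.
  + by rewrite FM' FxE !counitM IHu (hopf_ore_counitx ho) (sprim_counit (rv_sprim xv)).
Qed.

Variable F : {lrmorphism A -> H}.
Hypotheses (Fg : forall g, F (iota g) = val g) (Fx : F X = x).

Local Notation q := (chi a).
Local Notation l := (alpha a).
Local Notation ffA := (ffpow q l X).
Local Notation ff := (ffpow q l x).
(** The degrees i for which the falling powers up to i are known to be independent in H: all
    degrees below the first vanishing (N)_q, or all degrees. *)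
Definition regular_deg i := forall m, (0 < m <= i)%N -> qint q m != 0.

Lemma ff_free_regular n (w : nat -> H) : (forall i, w i \in gspan) ->
  (forall i, ~ regular_deg i -> w i = 0) ->
  \sum_(i < n) w i * ff i = 0 -> forall i, (i < n)%N -> w i = 0.
Proof.
move=> Sw w0; elim: n => // n IH e.
have [rn|nrn] := pselect (regular_deg n).
  by apply: (ff_freeP xv xr) Sw e => m; rewrite ltnS; apply: rn.
move: e; rewrite big_ord_recr /= (w0 n nrn) mul0r addr0 => /IH wi i.
by rewrite ltnS leq_eqVlt => /orP[/eqP -> |]; [exact: w0|exact: wi].
Qed.

Definition ispan := span (fun u : A => exists g, u = iota g).
Lemma ispan_iota g : iota g \in ispan. Proof. by apply: mem_span; exists g. Qed.
Lemma ispan1 : 1 \in ispan. Proof. by rewrite -(oa_1 oa) ispan_iota. Qed.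

Lemma ispan_ind (P : A -> Prop) : (forall g, P (iota g)) -> P 0 ->
  (forall c u v, P u -> P v -> P (c *: u + v)) -> forall u, u \in ispan -> P u.
Proof. by move=> Pg P0 PP; apply: (span_ind (P := P)) => // _ [g ->]. Qed.

Lemma ispanM u v : u \in ispan -> v \in ispan -> u * v \in ispan.
Proof.
move=> Su Sv; apply: (ispan_ind (P := fun v => u * v \in ispan)) Sv
  => [g||c y z Sy Sz]; rewrite ?mulr0 ?rpred0 //; last first.
  by rewrite mulrDr -scalerAr; apply: rpredP.
apply: (ispan_ind (P := fun u => u * iota g \in ispan)) Su => [h||c y z Sy Sz].
- by rewrite -(oa_M oa) ispan_iota.
- by rewrite mul0r rpred0.
- by rewrite mulrDl -scalerAl; apply: rpredP.
Qed.

Lemma ispan_F u : u \in ispan -> F u \in gspan.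
Proof.
apply: (ispan_ind (P := fun u => F u \in gspan)) => [g||c y z Sy Sz].
- by rewrite Fg gspan_val.
- by rewrite linear0 rpred0.
- by rewrite linearP rpredP.
Qed.
Lemma ispan_F0 u : u \in ispan -> F u = 0 -> u = 0.
Proof.
move=> Su; have [c uE] : exists c, u = lincomb iota c.
  apply: (ispan_ind (P := fun u => exists c, u = lincomb iota c)) Su => [g||c _ _ [d ->] [e ->]].
  - by exists << g >>; rewrite lincombU.
  - by exists 0; rewrite linear0.
  - by exists (c *: d + e); rewrite linearP.
have -> : F u = lincomb (fun g : G => val g) c.
  by rewrite uE /lincomb linear_sum; apply: eq_bigr => g _; rewrite linearZ /= Fg.
rewrite -(linear0 (lincomb (fun g : G => val g))) => /gsum_inj c0.
by rewrite uE c0 linear0.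
Qed.

Lemma mul_X_ispan i w : w \in ispan -> exists w' w'', [/\ w' \in ispan, w'' \in ispan &
  X * (w * ffA i) = w' * ffA i.+1 + w'' * ffA i].
Proof.
apply: (ispan_ind (P := fun w => exists w' w'', [/\ w' \in ispan, w'' \in ispan &
  X * (w * ffA i) = w' * ffA i.+1 + w'' * ffA i])).
- move=> g; exists (chi g *: iota g),
    ((chi g * (l * qint q i)) *: iota g + alpha g *: (iota g * (1 - iota a))).
  split; first exact/rpredZ/ispan_iota.
    apply: rpredP; first exact: ispan_iota.
    apply/rpredZ/ispanM; first exact: ispan_iota.
    by apply: submodB; [exact: ispan1|exact: ispan_iota].
  rewrite mulrA (oa_rel oa) mulrDl -!scalerAl -mulrA ffpowS mulrDr scalerDr.
  by rewrite mulrDl -!scalerAl -!scalerAr scalerA addrA.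
- by exists 0, 0; rewrite rpred0 !mul0r mulr0 addr0.
- move=> c u v [u' [u'' [Su' Su'' eu]]] [v' [v'' [Sv' Sv'' ev]]].
  exists (c *: u' + v'), (c *: u'' + v''); split; rewrite ?rpredP //.
  by rewrite mulrDl -scalerAl mulrDr -scalerAr eu ev !mulrDl -!scalerAl scalerDr addrACA.
Qed.

(** Modulo J every element is a combination of falling powers of regular degree: such
    combinations are stable under left multiplication by x, because at the first vanishing
    (n+1)_q the hypothesis rewrites the next falling power. The image in H of such a combination
    vanishes only if the combination does. *)
Lemma cover_kernel (J : submodClosed A) : two_sided_ideal J ->
  (forall u, u \in J -> F u = 0) ->
  (forall n, regular_deg n -> (0 < n)%N -> qint q n.+1 = 0 ->
    exists c w, w \in ispan /\ ffA n.+1 - (c *: X + w) \in J) ->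
  forall u, F u = 0 -> u \in J.
Proof.
move=> JI JF JN u Fu.
pose B := fun u => u \in J \/ exists i w, [/\ regular_deg i, w \in ispan & u = w * ffA i].
pose S := span B.
have r0 : regular_deg 0 by case.
have r1 : regular_deg 1 by move=> [|[|m]] //; rewrite qint1 oner_eq0.
have SJ v : v \in J -> v \in S by move=> Jv; apply: mem_span; left.
have Sf i w : regular_deg i -> w \in ispan -> w * ffA i \in S.
  by move=> ri Sw; apply: mem_span; right; exists i, w.
have Sg g v : v \in S -> iota g * v \in S.
  apply: (span_ind (P := fun v => iota g * v \in S)) => [w [Jw|[i [y [ri Sy ->]]]]||c y z Sy Sz].
  - exact/SJ/(JI _ _ Jw).1.
  - by rewrite mulrA; apply: Sf => //; apply: ispanM => //; exact: ispan_iota.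
  - by rewrite mulr0 rpred0.
  - by rewrite mulrDr -scalerAr rpredP.
have Sn i w : regular_deg i -> w \in ispan -> w * ffA i.+1 \in S.
  move=> ri Sw; have [q0|qn0] := eqVneq (qint q i.+1) 0; last first.
    apply: Sf => // m /andP[m0]; rewrite leq_eqVlt ltnS => /orP[/eqP -> //|mi].
    by apply: ri; rewrite m0.
  have i0 : (0 < i)%N by case: i q0 {ri} => //; rewrite qint1 => /eqP; rewrite oner_eq0.
  have [c [y [Sy Jy]]] := JN _ ri i0 q0.
  rewrite -[ffA _](subrK (c *: X + y)) mulrDr [w * (c *: X + y)]mulrDr -scalerAr.
  apply: rpredD.
    exact/SJ/(JI _ _ Jy).1.
  apply: rpredP; first by rewrite -(ffpow1 q l X); apply: Sf.
  by rewrite -[w * y]mulr1; apply: (Sf 0%N) => //; exact: ispanM.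
have SX v : v \in S -> X * v \in S.
  apply: (span_ind (P := fun v => X * v \in S)) => [w [Jw|[i [y [ri Sy ->]]]]||c y z Sy Sz].
  - exact/SJ/(JI _ _ Jw).1.
  - by have [w' [w'' [Sw' Sw'' ->]]] := mul_X_ispan i Sy; apply: rpredD; [exact: Sn|exact: Sf].
  - by rewrite mulr0 rpred0.
  - by rewrite mulrDr -scalerAr rpredP.
have Su : u \in S.
  elim/(oa_ind oa): u {Fu} => [||c y z Sy Sz|g y Sy|y Sy]; rewrite ?rpred0 //.
  - by rewrite -[1]mulr1; apply: (Sf 0%N) => //; exact: ispan1.
  - exact: rpredP.
  - exact: Sg.
  - exact: SX.
have [n [w [Sw wr Ju]]] : exists n w, [/\ forall i, w i \in ispan,
    forall i, ~ regular_deg i \/ (n <= i)%N -> w i = 0 & u - \sum_(i < n) w i * ffA i \in J].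
  apply: (span_ind (P := fun u => exists n w, [/\ forall i, w i \in ispan,
    forall i, ~ regular_deg i \/ (n <= i)%N -> w i = 0 & u - \sum_(i < n) w i * ffA i \in J])) Su.
  - move=> v [Jv|[i [y [ri Sy ->]]]].
      exists 0%N, (fun=> 0); split=> // [i|]; first by rewrite rpred0.
      by rewrite big_ord0 subr0.
    exists i.+1, (fun j => if j == i then y else 0); split=> [j|j|].
    + by case: eqP; rewrite ?rpred0.
    + by case: eqP => // -> [//|]; rewrite ltnn.
    + rewrite big_ord_recr /= eqxx big1 ?add0r ?subrr ?rpred0 // => j _.
      by rewrite ltn_eqF // mul0r.
  - by exists 0%N, (fun=> 0); split=> [i|//|]; rewrite ?big_ord0 ?subr0 rpred0.
  - move=> c y z [n [w [Sw w0 Jy]]] [n' [w' [Sw' w0' Jz]]].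
    exists (maxn n n'), (fun i => c *: w i + w' i); split=> [i|i|].
    + exact: rpredP.
    + rewrite geq_max => ni; rewrite w0 ?w0' ?scaler0 ?addr0 //; case: ni => [|/andP[]]; by [left|right].
    have widen m (v : nat -> A) : (m <= maxn n n')%N -> (forall i, (m <= i)%N -> v i = 0) ->
        \sum_(i < m) v i * ffA i = \sum_(i < maxn n n') v i * ffA i.
      move=> mM v0; rewrite (big_ord_widen _ (fun i => v i * ffA i) mM) big_mkcond.
      by apply: eq_bigr => i _; case: ltnP => // mi; rewrite v0 // mul0r.
    rewrite (widen n w) ?leq_maxl // in Jy; last by move=> i ni; apply: w0; right.
    rewrite (widen n' w') ?leq_maxr // in Jz; last by move=> i ni; apply: w0'; right.
    rewrite (_ : \sum_(i < maxn n n') (c *: w i + w' i) * ffA i =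
      c *: (\sum_(i < maxn n n') w i * ffA i) + \sum_(i < maxn n n') w' i * ffA i).
      by rewrite opprD addrACA -scalerBr; apply: rpredP.
    rewrite scaler_sumr -big_split; apply: eq_bigr => i _ /=.
    by rewrite mulrDl scalerAl.
have w0 i : w i = 0.
  have [ni|ni] := leqP n i; first by apply: wr; right.
  apply: ispan_F0 => //; apply: (@ff_free_regular n (fun i => F (w i))) ni => [j|j nj|].
  - exact: ispan_F.
  - by rewrite wr ?linear0 //; left.
  have := JF _ Ju; rewrite linearB /= Fu sub0r => /eqP; rewrite oppr_eq0 linear_sum => /eqP e.
  rewrite -[RHS]e; apply: eq_bigr => j _.
  by rewrite -Fx -(ffpow_morph F) -rmorphM.
move: Ju; rewrite big1 ?subr0 // => i _.
by rewrite w0 mul0r.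
Qed.

End Cover.

(** * Vanishing of (n)_q, and the theorem *)

Section RootsOfUnity.
Variables (k : fieldType) (q : k).

Lemma qint_mulB n : (q - 1) * qint q n = q ^+ n - 1.
Proof. by rewrite subrX1. Qed.

Lemma qint_eq0 n : q != 1 -> (qint q n == 0) = (q ^+ n == 1).
Proof.
move=> q1; rewrite -[RHS]subr_eq0 -qint_mulB mulf_eq0 subr_eq0.
by rewrite (negPf q1).
Qed.

Lemma prim_root_neq1 n : (1 < n)%N -> n.-primitive_root q -> q != 1.
Proof.
move=> n1 qn; apply/eqP => q1.
have : (n %| 1)%N by rewrite (prim_order_dvd qn) q1 expr1n.
by rewrite dvdn1 => /eqP n1'; rewrite n1' in n1.
Qed.

End RootsOfUnity.

Lemma qint_one (k : fieldType) n : qint (1 : k) n = n%:R.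
Proof. by rewrite /qint; under eq_bigr do rewrite expr1n; rewrite sumr_const card_ord. Qed.

Lemma ffpow0 (k : fieldType) (A : algType k) (q : k) (x : A) n : ffpow q 0 x n = x ^+ n.
Proof.
elim: n => // n IH; have := ffpowS q 0 x n.
by rewrite mul0r scale0r addr0 IH -exprS => <-.
Qed.

(** The p elements of the prime field are the roots of X^p - X. *)
Lemma ffpow_poly (k : fieldType) (p : nat) : p \in [pchar k] ->
  ffpow 1 1 ('X : {poly k}) p = 'X^p - 'X.
Proof.
move=> cp; have pp := pcharf_prime cp; have p1 := prime_gt1 pp.
have ffE n : ffpow 1 1 ('X : {poly k}) n = \prod_(z <- [seq i%:R | i <- iota 0 n]) ('X - z%:P).
  elim: n => [|n IH]; first by rewrite big_nil.
  rewrite -addn1 iotaD map_cat big_cat /= big_seq1 -IH addn1 mulrC /=; congr (_ * _).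
  by rewrite /= mul1r qint_one alg_polyC.
rewrite ffE.
have sp : size ('X^p - 'X : {poly k}) = p.+1.
  by rewrite size_polyDl size_polyXn // size_polyN size_polyX ltnS.
have lp : lead_coef ('X^p - 'X : {poly k}) = 1.
  by rewrite lead_coefDl ?lead_coefXn // size_polyN size_polyX size_polyXn ltnS.
rewrite [RHS](@all_roots_prod_XsubC _ _ [seq i%:R | i <- iota 0 p]) ?lp ?scale1r //.
- by rewrite sp size_map size_iota.
- apply/allP => _ /mapP[i _ ->]; rewrite rootE !hornerE subr_eq0.
  by rewrite -(pFrobenius_autE cp) pFrobenius_aut_nat.
rewrite uniq_rootsE map_inj_in_uniq ?iota_uniq // => i j; rewrite !mem_iota /= !add0n => ip jp.
wlog ij : i j ip jp / (i <= j)%N => [W e|e].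
  by case/orP: (leq_total i j) => ij; [exact: W|apply/esym/W].
have : (p %| j - i)%N by rewrite (dvdn_pcharf cp) natrB // e subrr.
rewrite /dvdn modn_small ?subn_eq0 => [ji|]; first by apply/eqP; rewrite eqn_leq ij.
by rewrite (leq_ltn_trans _ jp) // leq_subr.
Qed.

Lemma ffpow_pchar (k : fieldType) (A : algType k) (x : A) (p : nat) : p \in [pchar k] ->
  ffpow 1 1 x p = x ^+ p - x.
Proof.
move=> /ffpow_poly e.
have hl : linear (horner_alg x) by move=> c u v; rewrite linearP /= mulr_algl.
have hm : monoid_morphism (horner_alg x) by split; [exact: rmorph1|exact: rmorphM].
pose h : {lrmorphism {poly k} -> A} := HB.pack (horner_alg x : {poly k} -> A)
  (GRing.isLinear.Build k {poly k} A *:%R _ hl) (GRing.isMonoidMorphism.Build {poly k} A _ hm).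
have := ffpow_morph h 1 1 'X p.
by rewrite e rmorphB /= rmorphXn /= horner_algX => <-.
Qed.

Section Kernel.
Variables (k : fieldType) (H : hopfAlgType k).
Local Notation G := (grouplike H).
Variables (a : G) (x : H) (chi alpha : G -> k).
Hypotheses (xv : rank_one_var a x) (xr : ore_rel a x chi alpha).
Variables (A : hopfAlgType k) (iota : G -> A) (X : A).
Hypothesis oa : ore_algebra (rank_one_ore xr) iota X.
Variable F : {lrmorphism A -> H}.
Hypotheses (Fg : forall g, F (iota g) = val g) (Fx : F X = x).
Local Notation q := (chi a).
Local Notation l := (alpha a).
Local Notation ffA := (ffpow q l X).

Lemma kernel_trivial : (forall n, (0 < n)%N -> qint q n != 0) ->
  forall u, (F u == 0) = (u == 0).
Proof.
move=> qn u; apply/eqP/eqP => [Fu|->]; last exact: linear0.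
have [J JP] : {J : submodClosed A | forall v, v \in J <-> v = 0}.
  by apply: mksubmod => // c v w -> ->; rewrite scaler0 addr0.
apply/JP; apply: (cover_kernel xv oa Fg Fx) Fu => [b v /JP ->|v /JP ->|n _ _ n0].
- by rewrite mulr0 mul0r; split; apply/JP.
- exact: linear0.
- by have := qn n.+1 isT; rewrite n0 eqxx.
Qed.

Lemma iota_expg n : iota (a ^+ n)%g = iota a ^+ n.
Proof.
elim: n => [|n IH]; first by rewrite expr0 -(oa_1 oa).
by rewrite expgS exprS (oa_M oa) IH.
Qed.

(** The falling power of degree n in H is skew primitive, so [rv_form] provides c and d. An
    ideal J that contains the resulting relation z may be larger than the kernel of F, so
    [cover_kernel] is applied to the intersection of the two. *)
Lemma kernel_gen n : (1 < n)%N -> qint q n = 0 ->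
  (forall m, (0 < m < n)%N -> qint q m != 0) ->
  exists c d, (c != 0 -> (a ^+ n)%g = a) /\
    forall u, (F u == 0) = (u \in ideal_gen (ffA n - c *: X - d *: (1 - iota a ^+ n))).
Proof.
move=> n1 qn qm; have yp := comul_ffpow_last xv xr qn (ltnW n1) qm.
have [c [d [yE ca]]] := rv_form xv yp; exists c, d; split=> //.
set z := _ - _ - _.
have Fz : F z = 0.
  have FP c' u v : F (u - c' *: v) = F u - c' *: F v by rewrite linearB /= linearZ.
  rewrite /z -iota_expg !FP -[iota _]scale1r FP scale1r rmorph1 (ffpow_morph F) Fg Fx yE.
  by rewrite addrAC addrK subrr.
move=> u; apply/eqP/asboolP => [Fu J JI Jz|]; last first.
  move=> h; have := h (ker_closed F) (@ker_ideal _ _ _ F).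
  by rewrite !kerP Fz eqxx => /(_ isT)/eqP.
have [K KP] : {K : submodClosed A | forall v, v \in K <-> v \in J /\ F v = 0}.
  apply: mksubmod => [|e v w [Jv v0] [Jw w0]]; first by rewrite rpred0 linear0.
  by rewrite rpredP // linearP /= v0 w0 scaler0 addr0.
suff /KP[] : u \in K by [].
apply: (cover_kernel xv oa Fg Fx) Fu => [b v /KP[Jv Fv]|v /KP[]//|m rm m0 qm0].
  by have [Jbv Jvb] := JI b v Jv; split; apply/KP; rewrite rmorphM /= Fv ?mulr0 ?mul0r.
have -> : m.+1 = n.
  apply/eqP; rewrite eqn_leq; apply/andP; split; rewrite leqNgt; apply/negP => h.
    by have := rm n; rewrite (ltnW n1) -ltnS h qn eqxx => /(_ isT).
  by have := qm m.+1; rewrite h qm0 eqxx => /(_ isT).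
exists c, (d *: (1 - iota a ^+ n)); split.
  apply: rpredZ; apply: submodB; first exact: (ispan1 oa).
  rewrite -iota_expg; exact: ispan_iota.
by apply/KP; rewrite opprD addrA.
Qed.

End Kernel.

Theorem theorem2p7 (k : fieldType) (H : hopfAlgType k) :
  pointed H -> has_rank H 1 ->
  exists (chi : grouplike H -> k) (a : grouplike H)
         (alpha : {scalar {malg k[grouplike H]}})
         (A : hopfAlgType k) (iota : grouplike H -> A) (x : A) (I : hopfIdeal A),
    [/\ is_character chi, (forall g, commute a g), is_cocycle chi alpha,
        is_hopf_ore chi a alpha iota x & hopf_isomorphic H (hopf_quot I)] /\
    ([pchar k] =i pred0 ->
      (forall n, (1 < n)%N -> n.-primitive_root (chi a) ->
         exists beta : k, I =i ideal_gen (x ^+ n - beta *: (1 - iota a ^+ n))) /\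
      ((forall n, (1 < n)%N -> ~~ n.-primitive_root (chi a)) -> I =i pred1 0)) /\
    (forall p : nat, p \in [pchar k] ->
      [/\ (forall n, (1 < n)%N -> n.-primitive_root (chi a) ->
             exists beta : k, I =i ideal_gen (x ^+ n - beta *: (1 - iota a ^+ n))),
          (chi a = 1 -> iota (a^-1)%g * x * iota a = x ->
             exists beta gamma : k,
               I =i ideal_gen (x ^+ p - beta *: x - gamma *: (1 - iota a ^+ p)) /\
               (beta != 0 -> (a ^+ p)%g = a)),
          (chi a = 1 -> alpha << a >> != 0 ->
             iota (a^-1)%g * x * iota a = x + alpha << a >> *: (1 - iota a) ->
             alpha << a >> = 1 /\
             exists gamma : k,
               I =i ideal_gen (x ^+ p - x - gamma *: (1 - iota a ^+ p))) &
          ((forall n, (0 < n)%N -> ~~ n.-primitive_root (chi a)) -> I =i pred1 0)]).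
Proof.
move=> Hp Hr; have [a [x [chi [alpha [xv xr n0 n1]]]]] := normalized_exists Hp Hr.
have [al alE] : exists al : {scalar {malg k[grouplike H]}}, forall g, al << g >> = alpha g.
  have als : scalar (lincomb (alpha : grouplike H -> k^o)) by move=> c u v; rewrite linearP.
  by exists (mkscalar als) => g; exact: (lincombU (alpha : grouplike H -> k^o) g).
have [A [iota [X [ho oa]]]] := hopf_ore_exists (d := rank_one_ore xr) alE.
have [F [Fg Fx Fs FD FE]] := cover_exists xv oa ho.
have [I [IF iso]] := hopf_first_isomorphism Fs FD FE.
exists chi, a, al, A, iota, X, I; split.
  split=> //; first by split; [exact: or_chi0 xr|exact: or_chiM xr].
    exact: or_central xr.
  by move=> g h; rewrite (alE (g * h)%g) (alE g) (alE h); exact: or_alphaM xr g h.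
have prim n : (1 < n)%N -> n.-primitive_root (chi a) ->
    exists beta : k, I =i ideal_gen (X ^+ n - beta *: (1 - iota a ^+ n)).
  move=> n1' qn; have q1 := prim_root_neq1 n1' qn.
  have qn0 : qint (chi a) n = 0 by apply/eqP; rewrite qint_eq0 // (prim_expr_order qn).
  have qm m : (0 < m < n)%N -> qint (chi a) m != 0.
    move=> /andP[m0 mn]; rewrite qint_eq0 // -(prim_order_dvd qn).
    by apply/negP => /(dvdn_leq m0); rewrite leqNgt mn.
  have [c [d [ca IE]]] := kernel_gen xv oa Fg Fx n1' qn0 qm; exists d => u.
  have c0 : c = 0.
    (* a^n = a would give q = q^n = 1. *)
    apply/eqP; apply: contraT => /ca an; case/eqP: q1.
    have <- : chi (a ^+ n)%g = chi a by rewrite an.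
    rewrite -(prim_expr_order qn); elim: (n) => [|m IH].
      exact: (od_chi1 (rank_one_ore xr)).
    by rewrite expgS exprS (or_chiM xr) IH.
  by rewrite IF IE c0 scale0r subr0 (n0 q1) ffpow0.
have triv : (forall n, (0 < n)%N -> qint (chi a) n != 0) -> I =i pred1 0.
  by move=> qn u; rewrite IF (kernel_trivial xv oa Fg Fx qn).
have nroot : chi a != 1 -> (forall n, (1 < n)%N -> ~~ n.-primitive_root (chi a)) -> I =i pred1 0.
  move=> q1 nr; apply: triv => n np; rewrite qint_eq0 //; apply/negP => /eqP qn.
  have [m qm _] := prim_order_exists np qn.
  have [m1|m1] := ltnP 1 m; first by have := nr m m1; rewrite qm.
  have m0 := prim_order_gt0 qm; have m1' : m = 1%N by apply/eqP; rewrite eqn_leq m1.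
  by have := prim_expr_order qm; rewrite m1' expr1 => /eqP; rewrite (negPf q1).
have kernel_p p : p \in [pchar k] -> chi a = 1 -> exists c d, (c != 0 -> (a ^+ p)%g = a) /\
    forall u, (F u == 0) = (u \in ideal_gen (ffpow (chi a) (alpha a) X p - c *: X -
      d *: (1 - iota a ^+ p))).
  move=> cp q1; have pp := pcharf_prime cp.
  apply: (kernel_gen xv oa Fg Fx (prime_gt1 pp)); first by rewrite q1 qint_one (pcharf0 cp).
  move=> m /andP[m0 mp]; rewrite q1 qint_one -(dvdn_pcharf cp).
  by apply/negP => /(dvdn_leq m0); rewrite leqNgt mp.
split=> [ch0|p cp]; split=> //.
- move=> nr; have [q1|q1] := eqVneq (chi a) 1; last exact: nroot.
  apply: triv => n np; rewrite q1 qint_one.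
  by have /pcharf0P -> := ch0; rewrite -lt0n.
- move=> q1 xa; have [c [d [ca IE]]] := kernel_p _ cp q1; exists c, d; split=> // u.
  have l0 : alpha a = 0.
    have e : alpha a *: (1 - val a) = 0.
      have := congr1 F xa; rewrite !rmorphM /= !Fg Fx -mulrA (or_comm xr) q1 scale1r.
      rewrite mulrDr -scalerAr !gl_mulVKr => /eqP.
      by rewrite -subr_eq0 addrAC subrr add0r => /eqP.
    have [a1|a1] := eqVneq a 1%g; first exact: (or_alpha0 xr).
    move/eqP: e; rewrite scaler_eq0 => /orP[/eqP //|]; rewrite subr_eq0 eq_sym => /eqP ae.
    by case/eqP: a1; apply: val_inj.
  by rewrite IF IE q1 l0 ffpow0.
- move=> q1 al0 _; rewrite alE in al0 *; have l1 := n1 q1 al0; split=> //.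
  have [c [d [ca IE]]] := kernel_p _ cp q1; exists d => u.
  have c0 : c = 0.
    (* a^p = a would give alpha(a) = alpha(a^p) = p alpha(a) = 0. *)
    apply/eqP; apply: contraT => /ca ap; case/eqP: al0.
    have am m : alpha (a ^+ m)%g = m%:R * alpha a.
      elim: m => [|m IH]; first by rewrite mul0r; exact: (od_alpha1 (rank_one_ore xr)).
      by rewrite expgS (or_alphaM xr) q1 mul1r IH -nat1r mulrDl mul1r.
    by rewrite -ap am (pcharf0 cp) mul0r.
  by rewrite IF IE c0 scale0r subr0 q1 l1 ffpow_pchar.
- move=> nr; apply: nroot => [|n n1']; last by apply: nr; exact: ltnW.
  apply/eqP => q1; have [m qm] := prim_order_exists (ltn0Sn 0) (expr1n k 1).
  by rewrite dvdn1 => /eqP m1; have := nr 1%N isT; rewrite q1 -[1%N]m1 qm.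
Qed.
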